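(* Let $\mathfrak{A}$ be a unital $C^*$-algebra. For any spreadable state $\varphi$ on $\ast_{\mathbb{N}}\mathfrak{A}$ there exists a unique normal shift-invariant conditional expectation $E_\tau:\mathcal{R}_{\varphi_{\mathbb{Z}}}\to\mathcal{T}_{\varphi_{\mathbb{Z}}}$, which is also $\varphi$-invariant, i.e. $\langle E_\tau(T)\xi_{\varphi_{\mathbb{Z}}},\xi_{\varphi_{\mathbb{Z}}}\rangle=\langle T\xi_{\varphi_{\mathbb{Z}}},\xi_{\varphi_{\mathbb{Z}}}\rangle$ for all $T\in\mathcal{R}_{\varphi_{\mathbb{Z}}}$. Moreover, for $T=\pi_{\varphi_{\mathbb{Z}}}(a)$ with $a$ a localized element of $\ast_{\mathbb{N}}\mathfrak{A}$, one has $$E_\tau(T)=\lim_{n\to\infty}\pi_{\varphi_{\mathbb{Z}}}(\tau^n(a))$$ in the weak operator topology of $\mathcal{B}(\mathcal{H}_{\varphi_{\mathbb{Z}}})$. $E_\tau$ is $\mathbb{J}_{\mathbb{N}}$-invariant, that is, for all $h\in\mathbb{J}_{\mathbb{N}}$ one has $E_\tau(\pi_{\varphi_{\mathbb{Z}}}(\alpha_h(a)))=E_\tau(\pi_{\varphi_{\mathbb{Z}}}(a))$ for all $a\in\ast_{\mathbb{N}}\mathfrak{A}$. In addition, if $\varphi$ is also exchangeable, $E_\tau$ is permutation invariant, that is, $E_\tau(\pi_{\varphi_{\mathbb{Z}}}(\alpha_\sigma(a)))=E_\tau(\pi_{\varphi_{\mathbb{Z}}}(a))$ for all $\sigma\in\mathbb{P}_{\mathbb{N}}$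 and $a\in\ast_{\mathbb{N}}\mathfrak{A}$.
   Context: $\mathbb{N}=\{0,1,2,\dots\}$. $\ast_{\mathbb{N}}\mathfrak{A}$ and $\ast_{\mathbb{Z}}\mathfrak{A}$ are the unital free product $C^*$-algebras (units amalgamated) of copies of $\mathfrak{A}$ indexed by $\mathbb{N}$, resp. $\mathbb{Z}$, with canonical unital embeddings $i_j$; $\ast_{\mathbb{N}}\mathfrak{A}\subset\ast_{\mathbb{Z}}\mathfrak{A}$. For an injective map $f$ of the index set, $\alpha_f$ is the unital $*$-endomorphism with $\alpha_f(i_j(a))=i_{f(j)}(a)$; $\tau$ is the shift, $\tau(i_j(a))=i_{j+1}(a)$. $\mathbb{P}_{\mathbb{N}}$ is the group of bijections of $\mathbb{N}$ moving only finitely many points; $\mathbb{J}_{\mathbb{N}}$ is the semigroup of strictly increasing maps $h:\mathbb{N}\to\mathbb{N}$ with $|\mathbb{N}\setminus h(\mathbb{N})|<\infty$. A state $\varphi$ on $\ast_{\mathbb{N}}\mathfrak{A}$ is spreadable if $\varphi\circ\alpha_h=\varphi$ for all $h\in\mathbb{J}_{\mathbb{N}}$, and exchangeable if $\varphi\circ\alpha_\sigma=\varphi$ for all $\sigma\in\mathbb{P}_{\mathbb{N}}$; both imply $\varphi\circ\tau=\varphi$. An element of $\ast_{\mathbb{N}}\mathfrak{A}$ is localized if it lies in $\ast_F\mathfrak{A}$, the $C^*$-subalgebra generated by $i_j(\mathfrak{A})$, $j\in F$, for some finite $F\subset\mathbb{N}$. $\varphi_{\mathbb{Z}}$ is the unique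 shift-invariant state on $\ast_{\mathbb{Z}}\mathfrak{A}$ extending $\varphi$, with GNS triple $(\pi_{\varphi_{\mathbb{Z}}},\mathcal{H}_{\varphi_{\mathbb{Z}}},\xi_{\varphi_{\mathbb{Z}}})$. Set $\mathcal{R}_{\varphi_{\mathbb{Z}}}:=\pi_{\varphi_{\mathbb{Z}}}(\ast_{\mathbb{N}}\mathfrak{A})''$ and $\mathcal{T}_{\varphi_{\mathbb{Z}}}:=\bigcap_{n\in\mathbb{N}}\{\pi_{\varphi_{\mathbb{Z}}}(i_k(\mathfrak{A})):k\ge n\}''$. A normal conditional expectation $E:\mathcal{M}\to\mathcal{N}$ of a von Neumann algebra onto a von Neumann subalgebra is a normal, contractive, completely positive projection onto $\mathcal{N}$ with $E(nmn')=nE(m)n'$ for $m\in\mathcal{M}$, $n,n'\in\mathcal{N}$. $E:\mathcal{R}_{\varphi_{\mathbb{Z}}}\to\mathcal{T}_{\varphi_{\mathbb{Z}}}$ is shift-invariant if $E(\pi_{\varphi_{\mathbb{Z}}}(\tau(x)))=E(\pi_{\varphi_{\mathbb{Z}}}(x))$ for all $x\in\ast_{\mathbb{N}}\mathfrak{A}$. *)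

(* Defs.v *)
From HB Require Import structures.
From mathcomp Require Import all_boot all_order all_algebra complex.
From mathcomp Require Import all_classical all_reals all_analysis.

Set Implicit Arguments.
Unset Strict Implicit.
Unset Printing Implicit Defensive.

Import Order.TTheory GRing.Theory Num.Theory.
Import numFieldNormedType.Exports.

Local Open Scope classical_set_scope.
Local Open Scope ring_scope.
Local Open Scope complex_scope.

(* Norms of complex normed spaces take values in R[i] (and are real).
   The product is a field of the mixin because no structure of the library
   joins normed modules over R[i] with non-commutative rings. *)
HB.mixin Record isCStarAlgebra (R : realType) A
    & CompleteNormedModule R[i] A := {
  cmul : A -> A -> A ;
  cone : A ;
  star : A -> A ;
  cmulA : associative cmul ;
  cmul1l : left_id cone cmul ;
  cmul1r : right_id cone cmul ;
  cmulDl : left_distributive cmul +%R ;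
  cmulDr : right_distributive cmul +%R ;
  cmulZl : forall (c : R[i]) a b, cmul (c *: a) b = c *: cmul a b ;
  cmulZr : forall (c : R[i]) a b, cmul a (c *: b) = c *: cmul a b ;
  starK : involutive star ;
  starD : {morph star : a b / a + b} ;
  starZ : forall (c : R[i]) a, star (c *: a) = Num.conj c *: star a ;
  starM : forall a b, star (cmul a b) = cmul (star b) (star a) ;
  norm_cmul_le : forall a b, `|cmul a b| <= `|a| * `|b| ;
  norm_cmul_star : forall a, `|cmul (star a) a| = `|a| ^+ 2
}.

#[short(type="cstarType")]
HB.structure Definition CStarAlgebra (R : realType) :=
  {A of CompleteNormedModule R[i] A & isCStarAlgebra R A}.

(* [{dot H for Num.conj}] is linear in the first argument and
   conjugate-linear in the second one. *)
HB.mixin Record isHilbertSpace (R : realType) H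
    & CompleteNormedModule R[i] H := {
  inner : {dot H for (@Num.conj R[i])} ;
  sqr_normE : forall x : H, `|x| ^+ 2 = inner x x
}.

#[short(type="hilbertType")]
HB.structure Definition HilbertSpace (R : realType) :=
  {H of CompleteNormedModule R[i] H & isHilbertSpace R H}.

Section CStar.
Variable R : realType.

Definition star_hom (A B : cstarType R) (f : A -> B) : Prop :=
  [/\ linear f, {morph f : a b / cmul a b}, f cone = cone
    & {morph f : a / star a}].

Definition cstar_subalgebra (P : cstarType R) (B : set P) : Prop :=
  [/\ B cone, forall (c : R[i]) a b, B a -> B b -> B (c *: a + b),
      forall a b, B a -> B b -> B (cmul a b),
      forall a, B a -> B (star a) & closed B].

Definition cstar_generated (P : cstarType R) (S : set P) : set P :=
  smallest (@cstar_subalgebra P) S.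

Definition state (P : cstarType R) (phi : P -> R[i]) : Prop :=
  [/\ scalar phi, forall a, 0 <= phi (cmul (star a) a) & phi cone = 1].

(* The morphism given by the universal property is unique, because it is
   determined on a generating set. *)
Record free_product (A : cstarType R) (I : Type) := FreeProduct {
  fp_alg :> cstarType R ;
  fp_in : I -> A -> fp_alg ;
  fp_in_hom : forall j, star_hom (fp_in j) ;
  fp_generated : cstar_generated (\bigcup_j range (fp_in j)) = [set: fp_alg] ;
  fp_universal : forall (B : cstarType R) (g : I -> A -> B),
    (forall j, star_hom (g j)) ->
    exists2 F : fp_alg -> B, star_hom F & forall j a, F (fp_in j a) = g j a
}.

Definition fp_lift (A : cstarType R) (I : Type) (P : free_product A I)
    (B : cstarType R) (g : I -> A -> B) : P -> B :=
  xget (fun=> 0) [set F | star_hom F /\ forall j a, F (fp_in P j a) = g j a].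

Definition fp_endo (A : cstarType R) (I : Type) (P : free_product A I)
    (f : I -> I) : P -> P :=
  fp_lift (fun j => fp_in P (f j)).

Definition shiftN (A : cstarType R) (P : free_product A nat) : P -> P :=
  fp_endo succn.

Definition shiftZ (A : cstarType R) (P : free_product A int) : P -> P :=
  fp_endo (fun j => j + 1).

Definition fp_incl (A : cstarType R) (PN : free_product A nat)
    (PZ : free_product A int) : PN -> PZ :=
  fp_lift (fun j : nat => fp_in PZ j%:Z).

Definition localized (A : cstarType R) (P : free_product A nat) (a : P) : Prop :=
  exists2 F : set nat, finite_set F
    & cstar_generated (\bigcup_(j in F) range (fp_in P j)) a.

End CStar.

Definition finite_permutation (s : nat -> nat) : Prop :=
  bijective s /\ finite_set [set n | s n != n].

Definition cofinite_increasing (h : nat -> nat) : Prop :=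
  {homo h : m n / (m < n)%N} /\ finite_set (~` range h).

Section Invariance.
Variables (R : realType) (A : cstarType R).

Definition spreadable (P : free_product A nat) (phi : P -> R[i]) : Prop :=
  forall h, cofinite_increasing h -> phi \o fp_endo h = phi.

Definition exchangeable (P : free_product A nat) (phi : P -> R[i]) : Prop :=
  forall s, finite_permutation s -> phi \o fp_endo s = phi.

Definition shift_extension (PN : free_product A nat) (PZ : free_product A int)
    (phi : PN -> R[i]) (phiZ : PZ -> R[i]) : Prop :=
  [/\ state phiZ, phiZ \o @shiftZ _ _ PZ = phiZ
    & phiZ \o @fp_incl _ _ PN PZ = phi].

End Invariance.

Section Operators.
Variables (R : realType) (H : hilbertType R).
Implicit Types (S T : H -> H) (M N : set (H -> H)) (E : (H -> H) -> (H -> H)).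

(* B(H), as a subset of the linear space of all functions H -> H *)
Definition bounded_op : set (H -> H) := [set T | linear T /\ continuous T].

Definition opnorm T : R :=
  inf [set c : R | 0 <= c /\ forall x, `|T x| <= c%:C * `|x|].

Definition commutant M : set (H -> H) :=
  [set T | bounded_op T /\ forall S, M S -> T \o S = S \o T].

Definition bicommutant M : set (H -> H) := commutant (commutant M).

Definition wot_cvg (T_ : nat -> H -> H) T : Prop :=
  forall x y : H,
    (fun n => inner (T_ n x) y : R[i]^o) @ \oo --> (inner (T x) y : R[i]^o).

Definition square_summable (x : nat -> H) : Prop :=
  cvgn (series (fun n => `|x n| ^+ 2 : R[i]^o)).

Definition ultraweak_functional (x y : nat -> H) T : R[i]^o :=
  limn (series (fun n => inner (T (x n)) (y n) : R[i]^o)).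

Definition ultraweak_cvg (F : set_system (H -> H)) T : Prop :=
  forall x y, square_summable x -> square_summable y ->
    ultraweak_functional x y @ F --> ultraweak_functional x y T.

(* Continuity on M for the ultraweak topologies of M and of B(H). *)
Definition normal_map M E : Prop :=
  forall F : set_system (H -> H), ProperFilter F -> F M ->
  forall T, M T -> ultraweak_cvg F T -> ultraweak_cvg (E @ F) (E T).

(* Positivity of the operator matrix T acting on the n-fold direct sum of H. *)
Definition positive_opmx n (T : 'I_n -> 'I_n -> H -> H) : Prop :=
  forall x : 'I_n -> H, 0 <= \sum_i \sum_j inner (T i j (x j)) (x i).

Definition completely_positive M E : Prop :=
  forall n (T : 'I_n -> 'I_n -> H -> H), (forall i j, M (T i j)) ->
    positive_opmx T -> positive_opmx (fun i j => E (T i j)).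

(* Only the values of E on M are relevant. *)
Record normal_conditional_expectation M N E : Prop := {
  cexp_range : forall T, M T -> N (E T) ;
  cexp_linear : forall (c : R[i]) S T, M S -> M T ->
    E (c *: S + T) = c *: E S + E T ;
  cexp_projection : forall T, N T -> E T = T ;
  cexp_bimodule : forall S T S', N S -> M T -> N S' ->
    E (S \o T \o S') = S \o E T \o S' ;
  cexp_contractive : forall T, M T -> opnorm (E T) <= opnorm T ;
  cexp_completely_positive : completely_positive M E ;
  cexp_normal : normal_map M E
}.

Definition star_representation (P : cstarType R) (pi : P -> H -> H) : Prop :=
  [/\ forall a, bounded_op (pi a), linear pi,
      forall a b, pi (cmul a b) = pi a \o pi b, pi cone = id
    & forall a x y, inner (pi (star a) x) y = inner x (pi a y)].

Definition gns_triple (P : cstarType R) (phi : P -> R[i])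
    (pi : P -> H -> H) (xi : H) : Prop :=
  [/\ star_representation pi,
      closure (range (fun a => pi a xi)) = [set: H]
    & forall a, phi a = inner (pi a xi) xi].

End Operators.

Section Algebras.
Variables (R : realType) (A : cstarType R).
Variables (PN : free_product A nat) (PZ : free_product A int).
Variables (H : hilbertType R) (pi : PZ -> H -> H).

Definition vN_right : set (H -> H) :=
  bicommutant (range (pi \o @fp_incl _ _ PN PZ)).

Definition vN_tail : set (H -> H) :=
  \bigcap_n bicommutant
    (\bigcup_(k in [set k : nat | (n <= k)%N]) range (pi \o fp_in PZ k%:Z)).

Definition invariant_under (f : PN -> PN) (E : (H -> H) -> (H -> H)) : Prop :=
  forall a : PN, E (pi (fp_incl PZ (f a))) = E (pi (fp_incl PZ a)).

End Algebras.

Arguments vN_right {R A} PN {PZ H} pi.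
Arguments vN_tail {R A PZ H} pi.
Arguments invariant_under {R A PN PZ H} pi f E.

(* Main.v *)
From HB Require Import structures.
From mathcomp Require Import all_boot all_order all_algebra complex ring lra.
From mathcomp Require Import all_classical all_reals all_analysis.
Require Import Defs.

Set Implicit Arguments.
Unset Strict Implicit.
Unset Printing Implicit Defensive.

Import Order.TTheory GRing.Theory Num.Theory.
Import numFieldNormedType.Exports.

Local Open Scope classical_set_scope.
Local Open Scope ring_scope.
Local Open Scope complex_scope.

(** Let U be the unitary of the GNS space that implements the shift, let M be
    the von Neumann algebra of the nonnegative indices and N its tail. The
    expectation is E(T) = lim U^n T U^-n, in the weak operator topology, and
    the main point is that the limit exists for all T in M.

    A map f of the nonnegative indices that is concerned by spreadability (or
    by exchangeability) is extended by the identity to the negative indices.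
    The extension preserves phiZ (state_invariant_extend), hence it is
    implemented by an isometry V_f, and V_f fixes pi(b) xi whenever b is built
    from negative indices. For f the successor, U^-1 V_f commutes with pi(a)
    for a in PN, because U and V_f move pi(a) in the same way; therefore it
    commutes with M. It follows that <U^n T U^-n x, y> does not depend on n
    as soon as U^-n x and U^-n y are fixed by V_f (conj_shift_past), which
    happens eventually for all x and y in a dense subspace (past_dense). On
    that subspace E is given by <E(T) x, y> = <T U^-m x, U^-m y> for large m
    (tail_expectation_past).

    The properties of E are read off this description. An operator in the tail
    commutes with all translates of U^-1 V_f, hence with U, so that E fixes the
    tail and is a bimodule map over it (tail_shift_invariant). Inserting V_f on
    both sides of the formula gives the invariance under f, for all f at once
    (tail_expectation_invariant). Complete positivity and contractivity pass to
    the limit. For normality, an ultraweak functional evaluated at E(T) is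
    approximated at a geometric rate by finite sums of coefficients as in the
    formula; their differences add up to an ultraweak functional evaluated at T
    (ultraweak_preimage).

    For uniqueness, let E' be normal and shift-invariant. The shifted copies of
    pi(a) converge ultraweakly to E(pi(a)), so that E'(pi(a)) = E(pi(a)) by
    normality. Two normal maps that agree on the star-algebra pi(PN) agree on
    its bicommutant, because it is the ultraweak closure
    (bicommutant_ultraweak_limit); this is von Neumann's density theorem, proved
    by amplifying operators to square-summable sequences.

    Identities between morphisms of free products need only be checked on the
    generators once they are composed with pi, because representations of
    C-star-algebras are automatically continuous (rep_bound). *)

(** * Real-valued norms and limits *)

Section RealNorm.
Variables (R : realType) (V : normedModType R[i]).
Implicit Types x y z : V.

(** Norms over R[i] are complex numbers that happen to be real. Estimates are
    carried out on the real part, where the order is total. *)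
Definition nrm x : R := complex.Re `|x|.

Lemma nrmE x : `|x| = (nrm x)%:C.
Proof. by rewrite RRe_real// normr_real. Qed.

Lemma nrm_ge0 x : 0 <= nrm x.
Proof. by rewrite -ler0c -nrmE. Qed.

Lemma nrm0 : nrm 0 = 0.
Proof. by rewrite /nrm normr0. Qed.

Lemma nrm0_eq0 x : nrm x = 0 -> x = 0.
Proof. by move=> x0; apply/normr0_eq0; rewrite nrmE x0. Qed.

Lemma nrmN x : nrm (- x) = nrm x.
Proof. by rewrite /nrm normrN. Qed.

Lemma nrmC x y : nrm (x - y) = nrm (y - x).
Proof. by rewrite -nrmN opprB. Qed.

Lemma nrmD x y : nrm (x + y) <= nrm x + nrm y.
Proof. by have := ler_normD x y; rewrite !nrmE -rmorphD lecR. Qed.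

Lemma nrmB x y : nrm (x - y) <= nrm x + nrm y.
Proof. by rewrite (le_trans (nrmD _ _))// nrmN. Qed.

Lemma nrm_triangle z x y : nrm (x - y) <= nrm (x - z) + nrm (z - y).
Proof. by rewrite -[x - y](subrKA z) nrmD. Qed.

Lemma nrm_cvgP (u : nat -> V) (l : V) : u @ \oo --> l <->
  forall e : R, 0 < e -> exists N, forall n, (N <= n)%N -> nrm (u n - l) < e.
Proof.
split=> [ul e e0|ul].
  have e0C : 0 < e%:C by rewrite ltcR.
  have /cvgrPdist_lt/(_ _ e0C)[N _ uN] := ul.
  exists N => n Nn; have := uN n Nn.
  by rewrite nrmE ltcR nrmC.
apply/cvgrPdist_lt => e e0.
have eE : e = (complex.Re e)%:C by rewrite RRe_real// gtr0_real.
have [|N uN] := ul (complex.Re e); first by rewrite -ltcR -eE.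
by exists N => // n /= /uN; rewrite nrmC nrmE eE ltcR.
Qed.

Lemma closure_nrmP (B : set V) x : closure B x <->
  forall e : R, 0 < e -> exists2 y, B y & nrm (x - y) < e.
Proof.
split=> [Bx e e0|Bx D /nbhs_ballP[e /= e0 De]].
  have e0C : 0 < e%:C by rewrite ltcR.
  have [y [By]] := Bx _ (nbhsx_ballx x _ e0C).
  by rewrite -ball_normE/= nrmE ltcR => xy; exists y.
have eE : e = (complex.Re e)%:C by rewrite RRe_real// gtr0_real.
have [|y By xy] := Bx (complex.Re e); first by rewrite -ltcR -eE.
by exists y; split=> //; apply: De; rewrite -ball_normE/= nrmE eE ltcR.
Qed.

End RealNorm.

Lemma nrm_complex (R : realType) (z : R[i]) :
  nrm (z : R[i]^o) = Num.sqrt (complex.Re z ^+ 2 + complex.Im z ^+ 2).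
Proof. by rewrite /nrm normc_def. Qed.

Lemma nrmZ (R : realType) (V : normedModType R[i]) (c : R[i]) (x : V) :
  nrm (c *: x) = nrm (c : R[i]^o) * nrm x.
Proof. by apply: complexI; rewrite rmorphM/= -!nrmE normrZ. Qed.

Lemma nrm_real (R : realType) (r : R) : nrm (r%:C : R[i]^o) = `|r|.
Proof. by rewrite nrm_complex/= expr0n/= addr0 sqrtr_sqr. Qed.

Lemma nrmZR (R : realType) (V : normedModType R[i]) (r : R) (x : V) :
  nrm (r%:C *: x) = `|r| * nrm x.
Proof. by rewrite nrmZ nrm_real. Qed.

Lemma Re_le_nrm (R : realType) (z : R[i]) : `|complex.Re z| <= nrm (z : R[i]^o).
Proof. by rewrite nrm_complex -sqrtr_sqr ler_wsqrtr// lerDl sqr_ge0. Qed.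

Lemma Im_le_nrm (R : realType) (z : R[i]) : `|complex.Im z| <= nrm (z : R[i]^o).
Proof. by rewrite nrm_complex -sqrtr_sqr ler_wsqrtr// lerDr sqr_ge0. Qed.

Lemma nrm_le_ReIm (R : realType) (z : R[i]) :
  nrm (z : R[i]^o) <= `|complex.Re z| + `|complex.Im z|.
Proof.
rewrite nrm_complex -[leRHS]ger0_norm ?addr_ge0// -sqrtr_sqr ler_wsqrtr//.
by rewrite sqrrD !real_normK ?num_real// addrAC lerDl mulrn_wge0// mulr_ge0.
Qed.

Lemma nrm_cauchy_cvg (R : realType) (V : completeNormedModType R[i])
    (u : nat -> V) :
  (forall e : R, 0 < e -> exists N, forall m n, (N <= m)%N -> (N <= n)%N ->
     nrm (u m - u n) < e) -> exists l : V, u @ \oo --> l.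
Proof.
move=> uc; suff uv : cvgn u by exists (limn u).
apply: cauchy_cvg.
apply: cauchy_exP => e e0.
have eE : e = (complex.Re e)%:C by rewrite RRe_real// gtr0_real.
have [|N uN] := uc (complex.Re e); first by rewrite -ltcR -eE.
exists (u N), N => // n /= Nn.
by rewrite -ball_normE/= nrmE eE ltcR; apply: uN.
Qed.

(** Real and imaginary parts are dominated by the modulus and dominate it
    together, so that completeness is inherited from R. *)
Lemma complex_cauchy_cvg (R : realType) (u : nat -> R[i]^o) :
  (forall e : R, 0 < e -> exists N, forall m n, (N <= m)%N -> (N <= n)%N ->
     nrm (u m - u n) < e) -> exists l : R[i]^o, u @ \oo --> l.
Proof.
move=> uc.
have part (p : R[i] -> R) : (forall x y, p (x - y) = p x - p y) ->
    (forall z : R[i], `|p z| <= nrm (z : R[i]^o)) ->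
    exists l : R, (fun n => p (u n)) @ \oo --> l.
  move=> pB ple; suff uv : cvgn (p \o u) by exists (limn (p \o u)).
  apply: cauchy_cvg.
  apply: cauchy_exP => e /uc[N uN].
  exists (p (u N)), N => // n /= Nn.
  by rewrite -ball_normE/= -pB (le_lt_trans (ple _))// uN.
have [a ua] : exists l : R, (fun n => complex.Re (u n)) @ \oo --> l.
  by apply: part => [[? ?] [? ?]//|]; exact: Re_le_nrm.
have [b ub] : exists l : R, (fun n => complex.Im (u n)) @ \oo --> l.
  by apply: part => [[? ?] [? ?]//|]; exact: Im_le_nrm.
exists (a +i* b); apply/nrm_cvgP => e e0.
have e20 : 0 < e / 2 by rewrite divr_gt0.
move/cvgrPdist_lt/(_ _ e20): ua => [N _ uaN].
move/cvgrPdist_lt/(_ _ e20): ub => [M _ ubM].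
exists (maxn N M) => n; rewrite geq_max => /andP[Nn Mn].
apply: le_lt_trans (nrm_le_ReIm _) _.
move: (uaN n Nn) (ubM n Mn); case: (u n) => c d /=.
rewrite [`|a - c|]distrC [`|b - d|]distrC; lra.
Qed.

Lemma nrm_dist (R : realType) (V : normedModType R[i]) (x y : V) :
  `|nrm x - nrm y| <= nrm (x - y).
Proof.
have h (a b : V) : nrm a <= nrm (a - b) + nrm b by rewrite -{1}(subrK b a) nrmD.
by rewrite ler_norml; have := h x y; have := h y x; rewrite [nrm (y - x)]nrmC; lra.
Qed.

Lemma cvg_nrm (R : realType) (V : normedModType R[i]) (u : nat -> V) (l : V) :
  u @ \oo --> l -> (fun n => nrm (u n)) @ \oo --> nrm l.
Proof.
move=> /nrm_cvgP ul; apply/cvgrPdist_lt => e /ul[N uN]; exists N => // n /= /uN.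
by rewrite distrC; apply: le_lt_trans (nrm_dist _ _).
Qed.

Lemma conj_real (R : realType) (r : R) : Num.conj (r%:C : R[i]) = r%:C.
Proof. by rewrite conj_Creal//; apply/complex_realP; exists r. Qed.

Lemma cvg_finite_sum (R : realType) (V : normedModType R[i])
    (a : nat -> nat -> V) (b : nat -> V) t :
  (forall k, (fun n => a n k) @ \oo --> b k) ->
  (fun n => \sum_(0 <= k < t) a n k) @ \oo --> \sum_(0 <= k < t) b k.
Proof.
move=> ab; elim: t => [|t IH].
  by rewrite big_nil; under eq_fun do rewrite big_nil; exact: cvg_cst.
rewrite big_nat_recr//; under eq_fun do rewrite big_nat_recr//.
by apply: cvgD.
Qed.

Lemma sum_telescope (V : zmodType) (f q : nat -> V) N :
  (forall k, f k = q k.+1 - q k) -> \sum_(0 <= k < N) f k = q N - q 0%N.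
Proof.
move=> fq; elim: N => [|N IH]; first by rewrite big_nil subrr.
by rewrite big_nat_recr//= IH fq addrC addrA subrK.
Qed.

(** A nonnegative complex number is its own modulus, and the modulus is
    continuous. *)
Lemma cvg_complex_ge0 (R : realType) (u : nat -> R[i]^o) (l : R[i]^o) :
  (forall n, 0 <= (u n : R[i])) -> u @ \oo --> l -> 0 <= (l : R[i]).
Proof.
move=> u0 ul; have ul' : u @ \oo --> ((nrm l)%:C : R[i]^o).
  apply/nrm_cvgP => e /(iffLR (nrm_cvgP _ _) ul)[N uN]; exists N => n /uN.
  apply: le_lt_trans; have uE : u n = (nrm (u n))%:C by rewrite -nrmE ger0_norm.
  by rewrite {1}uE -rmorphB nrm_real nrm_dist.
by rewrite (cvg_unique (@norm_hausdorff _ _) ul ul') ler0c nrm_ge0.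
Qed.

(** * Inner products *)

Section CauchySchwarz.
Variables (C : numClosedFieldType) (U : lmodType C) (form : {dot U for (@Num.conj C)}).

(** This is the squared length of the part of u orthogonal to v. That it is
    nonnegative is the Cauchy-Schwarz inequality; that it is strictly below the
    squared length of u unless u is orthogonal to v characterizes nearest
    points. *)
Lemma form_residual u v : v != 0 ->
  let w := u - (form u v / form v v) *: v in
  form w w = form u u - `|form u v| ^+ 2 / form v v.
Proof.
move=> v0; have vgt0 : 0 < form v v by rewrite neq0_dnorm_gt0.
have vu : form v u = Num.conj (form u v) by rewrite [LHS]hermC /= mul1r.
have [a aE] : exists a, a = form u v / form v v by exists (form u v / form v v).
have av : a * form v v = form u v by rewrite aE divfK// gt_eqF.
have fZl c x y : form (c *: x) y = c * form x y by exact: linearZl_LR.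
have fZr c x y : form x (c *: y) = Num.conj c * form x y.
  by exact: linearZr_LR.
have fBl x y z : form (x - y) z = form x z - form y z by exact: linearBl.
have fBr x y z : form z (x - y) = form z x - form z y by exact: linearBr.
rewrite -aE /= fBl !fBr !(fZl, fZr).
rewrite vu [a * (_ * form v v)]mulrCA av opprB addrA subrK.
by rewrite aE mulrAC -normCK.
Qed.

Lemma form_cauchy_schwarz u v :
  `|form u v| ^+ 2 <= form u u * form v v.
Proof.
have [->|v0] := eqVneq v 0; first by rewrite !(linear0r form) normr0 expr0n ?mulr0.
rewrite -ler_pdivrMr ?neq0_dnorm_gt0// -subr_ge0 -form_residual//.
Qed.

End CauchySchwarz.

Section InnerProduct.
Variables (R : realType) (H : hilbertType R).
Implicit Types (x y z : H) (c : R[i]).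

Lemma innerDl x y z : inner (x + y) z = inner x z + inner y z.
Proof. exact: linearDl. Qed.
Lemma innerDr x y z : inner z (x + y) = inner z x + inner z y.
Proof. exact: linearDr. Qed.
Lemma innerBl x y z : inner (x - y) z = inner x z - inner y z.
Proof. exact: linearBl. Qed.
Lemma innerBr x y z : inner z (x - y) = inner z x - inner z y.
Proof. exact: linearBr. Qed.
Lemma innerZl c x z : inner (c *: x) z = c * inner x z.
Proof. exact: linearZl_LR. Qed.
Lemma innerZr c x z : inner z (c *: x) = Num.conj c * inner z x.
Proof. exact: linearZr_LR. Qed.
Lemma inner0l z : inner 0 z = 0.
Proof. exact: linear0l. Qed.
Lemma inner0r z : inner z 0 = 0.
Proof. exact: linear0r. Qed.
Lemma innerC x y : inner x y = Num.conj (inner y x).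
Proof. by rewrite [LHS]hermC /= mul1r. Qed.

Lemma inner_nrm x : inner x x = (nrm x ^+ 2)%:C.
Proof. by rewrite -sqr_normE nrmE rmorphXn. Qed.

Lemma inner_cauchy_schwarz x y : nrm (inner x y : R[i]^o) <= nrm x * nrm y.
Proof.
rewrite -ler_sqr ?nnegrE ?mulr_ge0 ?nrm_ge0// exprMn -lecR rmorphXn rmorphM/=.
by rewrite -nrmE -!inner_nrm form_cauchy_schwarz.
Qed.

Lemma inner_eqP x y : (forall z, inner x z = inner y z) -> x = y.
Proof.
move=> xy; apply/eqP; rewrite -subr_eq0; apply/eqP/nrm0_eq0/eqP.
rewrite -sqrf_eq0; apply/eqP/complexI.
by rewrite -inner_nrm innerBl xy subrr.
Qed.

Lemma parallelogram x y :
  nrm (x + y) ^+ 2 + nrm (x - y) ^+ 2 = (nrm x ^+ 2 + nrm y ^+ 2) *+ 2.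
Proof.
apply: complexI; rewrite rmorphMn !rmorphD /= -!inner_nrm.
by rewrite dnormD dnormB [LHS]addrACA subrr addr0 mulr2n.
Qed.

End InnerProduct.

(** * Projections, Riesz representation, bounded operators *)

Section HilbertGeometry.
Variables (R : realType) (H : hilbertType R).
Implicit Types (x y z : H) (c : R[i]) (M : set H).

Definition submodule M :=
  M 0 /\ forall c x y, M x -> M y -> M (c *: x + y).

(** A sequence that minimizes the distance to M is Cauchy by the parallelogram
    identity. Its limit p cannot be improved by moving along any y in M, so that
    x - p is orthogonal to y. *)
Lemma orthogonal_projection M : submodule M -> closed M ->
  forall x, exists2 p, M p & forall y, M y -> inner (x - p) y = 0.
Proof.
move=> [M0 ML] Mcl x.
pose D := [set nrm (x - y) ^+ 2 | y in M].
have D0 : D !=set0 by exists (nrm (x - 0) ^+ 2); exists 0.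
have Dlb : has_lbound D by exists 0 => _ [y _ <-]; rewrite sqr_ge0.
have d_le y : M y -> inf D <= nrm (x - y) ^+ 2.
  by move=> My; apply: ge_inf => //; exists y.
have near_inf n : exists y, M y /\ nrm (x - y) ^+ 2 < inf D + n.+1%:R^-1.
  have [|_ [y My <-] h] := @inf_adherent _ D n.+1%:R^-1 _ (conj D0 Dlb).
    by rewrite invr_gt0.
  by exists y.
have [u uP] := choice near_inf.
have MZ y c : M y -> M (c *: y) by move=> My; rewrite -[_ *: _]addr0; exact: ML.
have uu m n : nrm (u m - u n) ^+ 2 <= (m.+1%:R^-1 + n.+1%:R^-1) *+ 2.
  have [Mm xm] := uP m; have [Mn xn] := uP n.
  have := parallelogram (x - u m) (x - u n).
  have -> : x - u m - (x - u n) = u n - u m by rewrite opprB addrC addrA subrK.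
  have -> : x - u m + (x - u n) = (2 : R)%:C *: (x - 2%:R^-1 *: (u m + u n)).
    rewrite scalerBr scalerA rmorph_nat mulfV ?pnatr_eq0// scale1r.
    by rewrite scaler_nat mulr2n addrACA opprD.
  rewrite nrmZR exprMn ger0_norm//.
  have := d_le (2%:R^-1 *: (u m + u n)).
  rewrite [_ *: (_ + _)]scalerDr -[_ *: u n]addr0 => /(_ _).
  have Mmid : M (2^-1 *: u m + (2^-1 *: u n + 0)).
    by apply: (ML); [|rewrite addr0; exact: MZ].
  move=> /(_ Mmid); rewrite addr0 -scalerDr [nrm (u n - u m)]nrmC.
  move: xm xn.
  move: (nrm (x - _ *: (u m + u n)) ^+ 2) => q.
  have -> : 2 ^+ 2 = 4 :> R by rewrite -natrX.
  move: (m.+1%:R^-1) (n.+1%:R^-1) => a b; lra.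
have [p up] : exists p : H, u @ \oo --> p.
  apply: nrm_cauchy_cvg => e e0.
  have e4 : 0 < e ^+ 2 / 4 by rewrite divr_gt0// exprn_gt0.
  have [N _ NP] := near_infty_natSinv_lt (PosNum e4).
  exists N => m n Nm Nn; rewrite -ltr_sqr ?nnegrE ?nrm_ge0 ?(ltW e0)//.
  apply: le_lt_trans (uu m n) _.
  have := NP m Nm; have := NP n Nn; rewrite /=.
  move: (m.+1%:R^-1) (n.+1%:R^-1) (e ^+ 2) => a b d; lra.
have Mp : M p.
  apply: Mcl; apply/closure_nrmP => e e0.
  have [N uN] := (iffLR (nrm_cvgP _ _) up) e e0.
  by exists (u N); [exact: (uP N).1|rewrite nrmC uN].
have xp : nrm (x - p) ^+ 2 <= inf D.
  have xu : (fun n => nrm (x - u n) ^+ 2) @ \oo --> nrm (x - p) ^+ 2.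
    by apply: cvgM; apply: cvg_nrm; apply: cvgB => //; apply: cvg_cst.
  have dn : (fun n => inf D + n.+1%:R^-1) @ \oo --> inf D + 0.
    by apply: cvgD; [exact: cvg_cst|exact: cvg_harmonic].
  rewrite -[leRHS]addr0; apply: ler_cvg_to xu dn _.
  by apply: nearW => n; exact/ltW/(uP n).2.
exists p => // y My; have [->|y0] := eqVneq y 0; first exact: inner0r.
set w := x - p; set b := inner w y / inner y y.
have Mpy : M (b *: y + p) by exact: ML.
have := le_trans xp (d_le _ Mpy).
rewrite opprD addrCA addrC -lecR -!inner_nrm -/w form_residual//.
rewrite lerBrDr gerDl => h; apply/normr0_eq0/eqP; rewrite -sqrf_eq0 eq_le exprn_ge0// andbT.
by move: h; rewrite pmulr_lle0// invr_gt0 neq0_dnorm_gt0.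
Qed.

(** A vector orthogonal to the kernel of f represents f up to a scalar. *)
Lemma riesz (f : H -> R[i]) (C : R) :
  (forall c x y, f (c *: x + y) = c * f x + f y) ->
  (forall x, nrm (f x : R[i]^o) <= C * nrm x) ->
  exists v, forall x, f x = inner x v.
Proof.
move=> fL fC.
have f0 : f 0 = 0.
  by have := fL 1 0 0; rewrite scale1r addr0 mul1r => /eqP; rewrite -subr_eq0 opprD addNKr oppr_eq0 => /eqP.
have fZ c x : f (c *: x) = c * f x by rewrite -[c *: x]addr0 fL f0 addr0.
have fB x y : f (x - y) = f x - f y by rewrite addrC -scaleN1r fL mulN1r addrC.
have [[x0 fx0]|fz] := pselect (exists x, f x != 0); last first.
  exists 0 => x; rewrite inner0r; apply/eqP/negPn/negP => fx.
  by apply: fz; exists x.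
pose M := [set x | f x = 0].
have Msub : submodule M.
  by split=> // c x y; rewrite /M /= fL => -> ->; rewrite mulr0 addr0.
have Mcl : closed M.
  move=> x /closure_nrmP xM.
  apply/(@nrm0_eq0 _ R[i]^o)/eqP; rewrite eq_le nrm_ge0 andbT.
  apply/ler_addgt0Pl => e e0; rewrite addr0.
  have C1 : 0 < `|C| + 1 by rewrite ltr_wpDl.
  have [|y My xy] := xM (e / (`|C| + 1)); first by rewrite divr_gt0.
  rewrite -[f x]subr0 -My -fB (le_trans (fC _))//.
  move: xy; rewrite ltr_pdivlMr// => xy; apply: le_trans (ltW xy).
  rewrite mulrC ler_wpM2l ?nrm_ge0//.
  by rewrite (le_trans (ler_norm C)) ?lerDl.
have [p Mp pP] := orthogonal_projection Msub Mcl x0.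
set w := x0 - p in pP.
have fw : f w != 0 by rewrite /w fB Mp subr0.
have w0 : inner w w != 0.
  by rewrite gt_eqF// neq0_dnorm_gt0//; apply: contraNneq fw => ->; rewrite f0.
exists (Num.conj (f w / inner w w) *: w) => x; rewrite innerZr conjCK.
have : inner w (f x *: w - f w *: x) = 0.
  by apply: pP; rewrite /M/= fB !fZ mulrC subrr.
move/(congr1 (@Num.conj _)); rewrite -innerC rmorph0 innerBl !innerZl.
by move/eqP; rewrite subr_eq0 mulrAC => /eqP <-; rewrite mulfK.
Qed.

(** Continuity at 0 gives a ball that is mapped into the unit ball; rescaling
    turns its radius into a bound. *)
Lemma bounded_opP (T : H -> H) : bounded_op T <->
  linear T /\ exists2 C : R, 0 <= C & forall x, nrm (T x) <= C * nrm x.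
Proof.
split=> [[Tl Tc]|[Tl [C C0 TC]]]; split=> //.
- have T0 : T 0 = 0.
    by have := Tl (-1) 0 0; rewrite scaleN1r oppr0 addr0 scaleN1r addNr.
  have TZ c x : T (c *: x) = c *: T x by rewrite -[c *: x]addr0 Tl T0 addr0.
  have /cvgrPdist_lt/(_ 1 ltr01) := Tc 0.
  rewrite T0 => /nbhs_ballP[d /= d0 dP].
  have dE : d = (complex.Re d)%:C by rewrite RRe_real// gtr0_real.
  have dr0 : 0 < complex.Re d by rewrite -ltcR -dE.
  exists (2 / complex.Re d) => [|x]; first by rewrite divr_ge0// ltW.
  have [->|x0] := eqVneq x 0; first by rewrite T0 !nrm0 mulr0.
  have nx0 : 0 < nrm x.
    by rewrite lt_def nrm_ge0 andbT; apply: contraNneq x0 => /nrm0_eq0->.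
  set t := complex.Re d / 2 / nrm x.
  have t0 : 0 < t by rewrite !divr_gt0.
  have : ball 0 d (t%:C *: x).
    rewrite -ball_normE/= sub0r normrN dE nrmE ltcR nrmZR gtr0_norm//.
    by rewrite /t divfK ?gt_eqF// ltr_pdivrMr// ltr_pMr// ltr1n.
  move=> /dP/=; rewrite sub0r normrN nrmE TZ -[1]/((1 : R)%:C) ltcR.
  rewrite nrmZR gtr0_norm// -ltr_pdivlMl// => /ltW/le_trans; apply.
  by rewrite mulr1 /t !invfM !invrK [2 / _]mulrC.
- move=> x; apply/cvgrPdist_lt => e e0.
  have eE : e = (complex.Re e)%:C by rewrite RRe_real// gtr0_real.
  have e1 : 0 < complex.Re e by rewrite -ltcR -eE.
  have C1 : 0 < C + 1 by rewrite ltr_wpDl.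
  apply/nbhs_ballP; exists (complex.Re e / (C + 1))%:C => /=.
    by rewrite ltcR divr_gt0.
  move=> y; rewrite -ball_normE/= nrmE ltcR ltr_pdivlMr// => xy.
  rewrite nrmE eE ltcR.
  have -> : T x - T y = T (x - y) by rewrite [x - y]addrC -[- y]scaleN1r Tl scaleN1r addrC.
  apply: le_lt_trans (TC _) (le_lt_trans _ xy).
  by rewrite mulrC ler_wpM2l ?nrm_ge0// lerDl.
Qed.

End HilbertGeometry.

(** * Linear maps, isometries and weak limits of operators *)

Section LinearMaps.
Variables (K : nzRingType) (U V : lmodType K) (f : U -> V).
Hypothesis fL : linear f.

Lemma lin0 : f 0 = 0.
Proof. by have := fL (-1) 0 0; rewrite scaleN1r oppr0 addr0 scaleN1r addNr. Qed.

Lemma linZ c x : f (c *: x) = c *: f x.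
Proof. by rewrite -[c *: x]addr0 fL lin0 addr0. Qed.

Lemma linD x y : f (x + y) = f x + f y.
Proof. by have := fL 1 x y; rewrite !scale1r. Qed.

Lemma linN x : f (- x) = - f x.
Proof. by rewrite -scaleN1r linZ scaleN1r. Qed.

Lemma linB x y : f (x - y) = f x - f y.
Proof. by rewrite linD linN. Qed.

Lemma lin_sum I (r : seq I) (P : pred I) (F : I -> U) :
  f (\sum_(i <- r | P i) F i) = \sum_(i <- r | P i) f (F i).
Proof. exact: (big_morph f linD lin0). Qed.

End LinearMaps.

Lemma linear_comp (K : nzRingType) (U V W : lmodType K) (f : V -> W) (g : U -> V) :
  linear f -> linear g -> linear (f \o g).
Proof. by move=> fL gL c x y /=; rewrite gL fL. Qed.

Lemma nrm_cvg_unique (R : realType) (V : normedModType R[i]) (u : nat -> V) (a b : V) :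
  u @ \oo --> a -> u @ \oo --> b -> a = b.
Proof. by move=> ua ub; apply: (cvg_unique (@norm_hausdorff _ _)) ua ub. Qed.

(** The pairs (y, v) that are approximated by pairs (f x, g x) form a linear
    relation that preserves norms; such a relation is single valued, and it is
    everywhere defined because the range of f is dense. *)
Lemma isometry_extension (R : realType) (X : lmodType R[i]) (H : hilbertType R)
    (f g : X -> H) :
  linear f -> linear g -> closure (range f) = setT ->
  (forall x, nrm (g x) = nrm (f x)) ->
  exists V : H -> H, [/\ linear V, forall y, nrm (V y) = nrm y
    & forall x, V (f x) = g x].
Proof.
move=> fL gL fD gf.
pose app (y v : H) := forall e : R, 0 < e ->
  exists x, nrm (y - f x) < e /\ nrm (v - g x) < e.
have appL c y v y' v' : app y v -> app y' v' -> app (c *: y + y') (c *: v + v').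
  move=> yv yv' e e0.
  have c0 : 0 < nrm (c : R[i]^o) + 1 by rewrite ltr_wpDl ?nrm_ge0.
  have d0 : 0 < e / (nrm (c : R[i]^o) + 1) by rewrite divr_gt0.
  have [x [yx vx]] := yv _ d0; have [x' [yx' vx']] := yv' _ d0.
  have key (a a' b b' : H) : nrm (a - b) < e / (nrm (c : R[i]^o) + 1) ->
      nrm (a' - b') < e / (nrm (c : R[i]^o) + 1) ->
      nrm (c *: a + a' - (c *: b + b')) < e.
    rewrite !ltr_pdivlMr// => h h'.
    rewrite opprD addrACA -scalerBr (le_lt_trans (nrmD _ _))// nrmZ.
    move: (nrm_ge0 (a - b)) (nrm_ge0 (a' - b')) (nrm_ge0 (c : R[i]^o)) h h'.
    move: (nrm _) (nrm _) (nrm _) => p q r p0 q0 r0 h h'.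
    have h1 := ler_wpM2r r0 (ltW h).
    have r1 : 0 < r + 1 by rewrite ltr_wpDl.
    rewrite -(ltr_pM2l r1); nra.
  by exists (c *: x + x'); rewrite fL gL; split; apply: key.
have app_nrm y v : app y v -> nrm v = nrm y.
  move=> yv; apply/eqP; rewrite -subr_eq0 -normr_le0.
  apply/ler_addgt0Pl => e e0; rewrite addr0.
  have [|x [h1 h2]] := yv (e / 2); first by rewrite divr_gt0.
  have := nrm_dist v (g x); have := nrm_dist y (f x); rewrite gf.
  move: (nrm v) (nrm y) (nrm (f x)) h1 h2 => a b c h1 h2.
  rewrite !ler_norml => /andP[? ?] /andP[? ?].
  by clear fD; apply/andP; split; lra.
have app_uniq y v v' : app y v -> app y v' -> v = v'.
  move=> yv yv'; have /app_nrm := appL (-1) _ _ _ _ yv yv'.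
  rewrite !scaleN1r addNr nrm0 => /nrm0_eq0/eqP.
  by rewrite addrC subr_eq0 => /eqP.
have app_ex y : exists v, app y v.
  have yx n : exists x, nrm (y - f x) < n.+1%:R^-1.
    have : closure (range f) y by rewrite fD.
    move=> /closure_nrmP/(_ n.+1%:R^-1); rewrite invr_gt0 ltr0Sn => /(_ isT).
    by move=> [_ [x _ <-] ?]; exists x.
  have [x xP] := choice yx.
  have small e : 0 < e -> exists N, forall n, (N <= n)%N -> n.+1%:R^-1 < e :> R.
    by move=> e0; have [N _ NP] := near_infty_natSinv_lt (PosNum e0); exists N.
  have [v xv] : exists v : H, (g \o x) @ \oo --> v.
    apply: nrm_cauchy_cvg => e e0.
    have [|N NP] := small (e / 2); first by rewrite divr_gt0.
    exists N => m n Nm Nn /=.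
    rewrite -linB// gf linB//; apply: le_lt_trans (nrm_triangle y _ _) _.
    rewrite [nrm (f _ - y)]nrmC.
    have := xP m; have := xP n; have := NP m Nm; have := NP n Nn.
    move: (m.+1%:R^-1) (n.+1%:R^-1) (nrm (y - f (x m))) (nrm (y - f (x n))).
    by clear fD => a b p q; lra.
  exists v => e e0; have [N NP] := small e e0.
  have [M MP] := (iffLR (nrm_cvgP _ _) xv) e e0.
  exists (x (maxn N M)); rewrite [nrm (v - _)]nrmC; split.
    by apply: lt_trans (xP _) (NP _ (leq_maxl _ _)).
  exact: MP (leq_maxr _ _).
have [V VP] := choice app_ex; exists V; split.
- by move=> c x y; apply: app_uniq (VP _) (appL _ _ _ _ _ (VP _) (VP _)).
- by move=> y; exact: app_nrm.
- by move=> x; apply: app_uniq (VP _) _ => e e0; exists x; rewrite !subrr !nrm0.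
Qed.

Section WeakLimits.
Variables (R : realType) (H : hilbertType R).

Lemma uniform_approx_cvg (a : nat -> R[i]^o) :
  (forall e : R, 0 < e -> exists2 b : nat -> R[i]^o,
     exists l : R[i]^o, b @ \oo --> l & forall n, nrm (a n - b n) <= e) ->
  exists l : R[i]^o, a @ \oo --> l.
Proof.
move=> ab; apply: complex_cauchy_cvg => e e0.
have e4 : 0 < e / 4 by rewrite divr_gt0.
have [b [l /nrm_cvgP/(_ _ e4)[N bN]] abe] := ab _ e4.
exists N => m n /bN bm /bN bn.
have h1 := nrm_triangle (b m) (a m) (a n).
have h2 := nrm_triangle l (b m) (a n).
have h3 := nrm_triangle (b n) l (a n).
have := abe m; have := abe n; move: bm bn h1 h2 h3.
by rewrite [nrm (b n - a n)]nrmC [nrm (l - b n)]nrmC; lra.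
Qed.

Lemma inner_op_approx (T : H -> H) C x y x' y' : linear T ->
  (forall x, nrm (T x) <= C * nrm x) ->
  nrm (inner (T x) y - inner (T x') y' : R[i]^o) <=
    C * nrm (x - x') * nrm y + C * nrm x' * nrm (y - y').
Proof.
move=> TL TC; apply: le_trans (nrm_triangle (inner (T x') y : R[i]^o) _ _) _.
rewrite -innerBl -innerBr -linB//.
by apply: lerD; apply: le_trans (inner_cauchy_schwarz _ _) _;
  rewrite ler_wpM2r ?nrm_ge0.
Qed.

Lemma inner_op_cvg (T : H -> H) C (x y : H) (u v : nat -> H) : 0 <= C -> linear T ->
  (forall x, nrm (T x) <= C * nrm x) -> u @ \oo --> x -> v @ \oo --> y ->
  (fun n => inner (T (u n)) (v n) : R[i]^o) @ \oo --> (inner (T x) y : R[i]^o).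
Proof.
move=> C0 TL TC ux vy.
have v_bound : (fun n => C * nrm (u n - x) * nrm (v n) + C * nrm x * nrm (v n - y))
    @ \oo --> C * 0 * nrm y + C * nrm x * 0.
  have ux0 : (fun n => nrm (u n - x)) @ \oo --> (0 : R).
    by rewrite -(nrm0 H) -(subrr x); apply: cvg_nrm; apply: cvgB => //; exact: cvg_cst.
  have vy0 : (fun n => nrm (v n - y)) @ \oo --> (0 : R).
    by rewrite -(nrm0 H) -(subrr y); apply: cvg_nrm; apply: cvgB => //; exact: cvg_cst.
  apply: cvgD; apply: cvgM => //; [|exact: cvg_nrm|exact: cvg_cst].
  by apply: cvgM => //; exact: cvg_cst.
rewrite !mulr0 mul0r addr0 in v_bound.
apply/nrm_cvgP => e e0; move/cvgrPdist_lt/(_ _ e0): v_bound => [N _ NP].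
exists N => n /NP; rewrite sub0r normrN ger0_norm; last first.
  by rewrite addr_ge0// !mulr_ge0 ?nrm_ge0.
by apply: le_lt_trans; exact: inner_op_approx.
Qed.

(** The uniform bound propagates the convergence of matrix coefficients from a
    dense set to all vectors. The limits form a bounded sesquilinear form, which
    is given by an operator through the Riesz representation. *)
Lemma wot_limit (T : nat -> H -> H) (C : R) (D : set H) :
  0 <= C -> (forall n, linear (T n)) -> (forall n x, nrm (T n x) <= C * nrm x) ->
  closure D = setT ->
  (forall x y, D x -> D y -> exists l : R[i]^o,
     (fun n => inner (T n x) y : R[i]^o) @ \oo --> l) ->
  exists L, [/\ linear L, forall x, nrm (L x) <= C * nrm x & wot_cvg T L].
Proof.
move=> C0 TL TC DD TD.
have dense x e : 0 < e -> exists2 y, D y & nrm (x - y) < e.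
  by apply: (iffLR (closure_nrmP D x)); rewrite DD.
have lim_ex x y : exists l : R[i]^o, (fun n => inner (T n x) y : R[i]^o) @ \oo --> l.
  apply: uniform_approx_cvg => e e0.
  have c1 : 0 < C * nrm y + 1 by rewrite ltr_wpDl// mulr_ge0 ?nrm_ge0.
  have [|x' Dx' xx'] := dense x (e / 2 / (C * nrm y + 1)).
    by rewrite !divr_gt0.
  have c2 : 0 < C * nrm x' + 1 by rewrite ltr_wpDl// mulr_ge0 ?nrm_ge0.
  have [|y' Dy' yy'] := dense y (e / 2 / (C * nrm x' + 1)).
    by rewrite !divr_gt0.
  exists (fun n => inner (T n x') y'); first exact: TD.
  move=> n; apply: le_trans (inner_op_approx x y x' y' (TL n) (TC n)) _.
  rewrite mulrAC; move: xx' yy'; rewrite !ltr_pdivlMr// !mulrDr !mulr1.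
  have := nrm_ge0 (x - x'); have := nrm_ge0 (y - y').
  by clear DD; move: (C * nrm y) (C * nrm x') (nrm (x - x')) (nrm (y - y')) => a b p q; lra.
have [B BP] := choice (fun xy : H * H => lim_ex xy.1 xy.2).
have Buniq x y l : (fun n => inner (T n x) y : R[i]^o) @ \oo --> (l : R[i]^o) ->
    B (x, y) = l by apply: nrm_cvg_unique (BP (x, y)).
have BC x y : nrm (B (x, y)) <= C * nrm x * nrm y.
  apply: (cvgr_to_le (cvg_nrm (BP (x, y)))); apply: nearW => n /=.
  by apply: le_trans (inner_cauchy_schwarz _ _) _; rewrite ler_wpM2r ?nrm_ge0.
have nrm_conj (z : R[i]) : nrm (Num.conj z : R[i]^o) = nrm (z : R[i]^o).
  by rewrite /nrm norm_conjC.
have L_ex x : exists v, forall y, B (x, y) = inner v y.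
  have [|y|v vP] := @riesz _ _ (fun y => Num.conj (B (x, y))) (C * nrm x).
  - move=> c y z; rewrite -[c in RHS]conjCK -rmorphM -rmorphD/=; congr Num.conj.
    apply: Buniq.
    have -> : (fun n => inner (T n x) (c *: y + z) : R[i]^o) =
        (fun n => Num.conj c *: (inner (T n x) y : R[i]^o) + (inner (T n x) z : R[i]^o)).
      by apply/funext => n; rewrite innerDr innerZr.
    by apply: cvgD; [apply: cvgZr; exact: (BP (x, y))|exact: (BP (x, z))].
  - by rewrite nrm_conj BC.
  by exists v => y; rewrite innerC -vP conjCK.
have [L LP] := choice L_ex.
exists L; split=> [c x y|x|x y]; last by rewrite -LP; exact: (BP (x, y)).
- apply: inner_eqP => z; rewrite innerDl innerZl -!LP; apply: Buniq.
  have -> : (fun n => inner (T n (c *: x + y)) z : R[i]^o) =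
      (fun n => c *: (inner (T n x) z : R[i]^o) + (inner (T n y) z : R[i]^o)).
    by apply/funext => n; rewrite TL innerDl innerZl.
  by apply: cvgD; [apply: cvgZr; exact: (BP (x, z))|exact: (BP (y, z))].
- have := BC x (L x); rewrite LP inner_nrm nrm_real ger0_norm ?sqr_ge0//.
  have [->|L0] := eqVneq (nrm (L x)) 0; first by rewrite mulr_ge0 ?nrm_ge0.
  by rewrite expr2 ler_pM2r// lt_def L0 nrm_ge0.
Qed.

Lemma wot_cvg_unique (T : nat -> H -> H) L L' :
  wot_cvg T L -> wot_cvg T L' -> L = L'.
Proof.
move=> TL TL'; apply/funext => x; apply: inner_eqP => y.
exact: nrm_cvg_unique (TL x y) (TL' x y).
Qed.

End WeakLimits.

(** * Continuity of positive functionals and of representations *)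

Section CStarAlgebras.
Variables (R : realType) (P : cstarType R).
Implicit Types (a b c : P) (B : set P).

Lemma cmul_linl b : linear (cmul^~ b : P -> P).
Proof. by move=> k a c; rewrite cmulDl cmulZl. Qed.

Lemma cmul_linr a : linear (cmul a).
Proof. by move=> k b c; rewrite cmulDr cmulZr. Qed.

Lemma star_cone : star (cone : P) = cone.
Proof. by rewrite -[LHS]cmul1r -[X in cmul _ X]starK -starM cmul1r starK. Qed.

Lemma starN a : star (- a) = - star a.
Proof. by rewrite -scaleN1r starZ rmorphN1 scaleN1r. Qed.

Lemma starB a b : star (a - b) = star a - star b.
Proof. by rewrite starD starN. Qed.

Lemma nrm_cmul_le a b : nrm (cmul a b) <= nrm a * nrm b.
Proof. by have := norm_cmul_le a b; rewrite !nrmE -rmorphM/= lecR. Qed.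

Lemma nrm_star_mul a : nrm (cmul (star a) a) = nrm a ^+ 2.
Proof. by apply: complexI; rewrite rmorphXn/= -!nrmE norm_cmul_star. Qed.

Lemma nrm_star a : nrm (star a) = nrm a.
Proof.
have le b : nrm b <= nrm (star b).
  have [->|b0] := eqVneq (nrm b) 0; first exact: nrm_ge0.
  have bp : 0 < nrm b by rewrite lt_def b0 nrm_ge0.
  by rewrite -(ler_pM2r bp) -expr2 -nrm_star_mul nrm_cmul_le.
by apply/eqP; rewrite eq_le -{2}(starK a) !le.
Qed.

Definition star_subalgebra B :=
  [/\ B cone, forall (k : R[i]) a b, B a -> B b -> B (k *: a + b),
      forall a b, B a -> B b -> B (cmul a b) & forall a, B a -> B (star a)].

Lemma closure_star_subalgebra B :
  star_subalgebra B -> cstar_subalgebra (closure B).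
Proof.
move=> [B1 BL BM BS]; split; last exact: closed_closure.
- exact: subset_closure.
- move=> k a b /closure_nrmP aB /closure_nrmP bB; apply/closure_nrmP => e e0.
  have k0 : 0 < nrm (k : R[i]^o) + 1 by rewrite ltr_wpDl ?nrm_ge0.
  have [|a' Ba' aa'] := aB (e / 2 / (nrm (k : R[i]^o) + 1)).
    by rewrite !divr_gt0.
  have [|b' Bb' bb'] := bB (e / 2); first by rewrite divr_gt0.
  exists (k *: a' + b'); first exact: BL.
  rewrite opprD addrACA -scalerBr (le_lt_trans (nrmD _ _))// nrmZ.
  move: aa' bb'; rewrite ltr_pdivlMr//.
  by have := nrm_ge0 (a - a'); move: (nrm (k : R[i]^o)) (nrm (a - a')) => p q; nra.
- move=> a b /closure_nrmP aB /closure_nrmP bB; apply/closure_nrmP => e e0.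
  have b0 : 0 < nrm b + 1 by rewrite ltr_wpDl ?nrm_ge0.
  have [|a' Ba' aa'] := aB (e / 2 / (nrm b + 1)); first by rewrite !divr_gt0.
  have a0 : 0 < nrm a' + 1 by rewrite ltr_wpDl ?nrm_ge0.
  have [|b' Bb' bb'] := bB (e / 2 / (nrm a' + 1)); first by rewrite !divr_gt0.
  exists (cmul a' b'); first exact: BM.
  apply: le_lt_trans (nrm_triangle (cmul a' b) _ _) _.
  rewrite -(linB (cmul_linl b)) -(linB (cmul_linr a')).
  apply: le_lt_trans (lerD (nrm_cmul_le _ _) (nrm_cmul_le _ _)) _.
  move: aa' bb'; rewrite !ltr_pdivlMr//.
  have := nrm_ge0 (a - a'); have := nrm_ge0 (b - b').
  by move: (nrm b) (nrm a') (nrm (a - a')) (nrm (b - b')) => p q r s; nra.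
- move=> a /closure_nrmP aB; apply/closure_nrmP => e /aB[a' Ba' aa'].
  by exists (star a'); [exact: BS|rewrite -starB nrm_star].
Qed.

(** A property that passes through the algebraic operations, but perhaps not to
    limits, still holds on a dense set once it holds on the generators. *)
Lemma star_subalgebra_dense (S B : set P) : cstar_generated S = setT ->
  star_subalgebra B -> S `<=` B -> closure B = setT.
Proof.
move=> ST Bsub SB; apply/seteqP; split=> // a _.
have : cstar_generated S a by rewrite ST.
apply: smallest_sub; first exact: closure_star_subalgebra.
by apply: subset_trans SB _; exact: subset_closure.
Qed.

(** With b = 1 - y, the equation b b = 1 - a reads y = (a + y y) / 2. The right-
    hand side maps the ball of radius 1/2 to itself, since (3/4 + 1/4) / 2 =
    1/2, and contracts it by the factor 1/2; Banach iteration from 0 stays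
    selfadjoint. *)
Lemma sqrt_one_minus a : star a = a -> nrm a <= 3 / 4 ->
  exists2 b, star b = b & cmul b b = cone - a.
Proof.
move=> sa na.
have half : Num.conj (2^-1 : R[i]) = 2^-1 by rewrite fmorphV rmorph_nat.
have nhalf (x : P) : nrm ((2^-1 : R[i]) *: x) = nrm x / 2.
  by rewrite -[2^-1]/(2%:R^-1) -(rmorph_nat (real_complex R)) -fmorphV nrmZR
    ger0_norm ?invr_ge0// mulrC.
pose step (y : P) : P := (2^-1 : R[i]) *: (a + cmul y y).
pose y n := iter n step 0.
have sy n : star (y n) = y n.
  elim: n => [|n IH]; first by have := starB (0 : P) 0; rewrite !subrr.
  by rewrite /= starZ half starD starM sa IH.
have ny n : nrm (y n) <= 1 / 2.
  elim: n => [|n IH] /=; first by rewrite nrm0 divr_ge0.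
  rewrite nhalf; have := nrmD a (cmul (y n) (y n)).
  have := nrm_cmul_le (y n) (y n); have := nrm_ge0 (y n).
  by move: (nrm (y n)) (nrm (cmul _ _)) (nrm (a + _)) IH => p q r IH; nra.
have lip u v : nrm u <= 1 / 2 -> nrm v <= 1 / 2 ->
    nrm (step u - step v) <= nrm (u - v) / 2.
  move=> nu nv; rewrite -scalerBr nhalf opprD addrACA subrr add0r.
  have -> : cmul u u - cmul v v = cmul u (u - v) + cmul (u - v) v.
    by rewrite (linB (cmul_linr u)) (linB (cmul_linl v)) addrA subrK.
  have := nrmD (cmul u (u - v)) (cmul (u - v) v).
  have := nrm_cmul_le u (u - v); have := nrm_cmul_le (u - v) v.
  have := nrm_ge0 (u - v).
  move: nu nv; move: (nrm u) (nrm v) (nrm (u - v)) (nrm (_ + _)) (nrm (cmul u _)).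
  by move: (nrm _) => p q r s t o; nra.
have yc n k : nrm (y (n + k)%N - y n) <= 2^-1 ^+ n.
  elim: n => [|n IH].
    by rewrite subr0 expr0 (le_trans (ny _))// ler_pdivrMr ?mul1r ?ler1n.
  apply: le_trans (lip _ _ (ny _) (ny _)) _.
  by rewrite exprSr ler_pM2r ?invr_gt0.
have [z yz] : exists z : P, y @ \oo --> z.
  apply: nrm_cauchy_cvg => e e0.
  have e2 : 0 < e / 2 by rewrite divr_gt0.
  have [N _ NP] := near_infty_natSinv_expn_lt (PosNum e2).
  exists N => m n Nm Nn; apply: le_lt_trans (nrm_triangle (y N) _ _) _.
  have := yc N (m - N)%N; have := yc N (n - N)%N; rewrite !subnKC//.
  have := NP N (leqnn N); rewrite /= mul1r -exprVn [nrm (y n - _)]nrmC.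
  by move: (2^-1 ^+ N) => p; lra.
have nz : nrm z <= 1 / 2.
  by apply: (cvgr_to_le (cvg_nrm yz)); apply: nearW.
have yz1 : (fun n => y n.+1) @ \oo --> z by move: (yz); rewrite -cvg_shiftS.
have fix_z : step z = z.
  apply: (nrm_cvg_unique _ yz1).
  apply/nrm_cvgP => e /(iffLR (nrm_cvgP _ _) yz)[N yN].
  exists N => n /yN; apply: le_lt_trans.
  by apply: le_trans (lip _ _ (ny _) nz) _; have := nrm_ge0 (y n - z); lra.
have sz : star z = z.
  apply: (nrm_cvg_unique _ yz); apply/nrm_cvgP => e /(iffLR (nrm_cvgP _ _) yz)[N yN].
  by exists N => n /yN; rewrite -[in X in _ -> X](sy n) -starB nrm_star.
have zz : cmul z z = z + z - a.
  apply/eqP; rewrite -subr_eq opprK eq_sym addrC -{1 2}fix_z -scalerDl.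
  by rewrite -[2^-1]mul1r -splitr scale1r addrC.
exists (cone - z); first by rewrite starB star_cone sz.
rewrite (linB (cmul_linr _)) cmul1r (linB (cmul_linl _)) cmul1l zz.
have -> : z - (z + z - a) = a - z.
  by rewrite opprB addrCA opprD [z + (_ - _)]addrA subrr sub0r.
by rewrite opprB addrA subrK.
Qed.

Section PositiveFunctionals.
Variable f : P -> R[i].
Hypotheses (fL : scalar f) (fP : forall a, 0 <= f (cmul (star a) a)).

(** The element a^* a, rescaled to norm 3/4, is 1 minus a square, on which f is
    nonnegative. Hence positive functionals are continuous. *)
Lemma positive_functional_bound a :
  f (cmul (star a) a) <= (2 * nrm a ^+ 2)%:C * f cone.
Proof.
have f1 : 0 <= f cone by have := fP cone; rewrite star_cone cmul1r.
have fLo : linear (f : P -> R[i]^o) by exact: fL.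
have fZ k b : f (k *: b) = k * f b by exact: (linZ fLo).
have [a0|a0] := eqVneq (nrm a) 0.
  rewrite (nrm0_eq0 a0) (lin0 (cmul_linr _)) (lin0 fLo).
  by rewrite mulr_ge0// ler0c mulr_ge0 ?sqr_ge0.
have s0 : 0 < nrm a ^+ 2 by rewrite exprn_gt0// lt_def a0 nrm_ge0.
set t := 3 / 4 / nrm a ^+ 2.
have t0 : 0 < t by rewrite !divr_gt0.
have [||b sb bb] := @sqrt_one_minus (t%:C *: cmul (star a) a).
- by rewrite starZ starM starK conj_real.
- by rewrite nrmZR nrm_star_mul ger0_norm ?(ltW t0)// divfK// gt_eqF.
have := fP b; rewrite sb bb (linB fLo) fZ subr_ge0 => h.
rewrite -(ler_pM2l (_ : 0 < t%:C)) ?ltcR// (le_trans h)// mulrA -rmorphM/=.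
rewrite -[leLHS]mul1r ler_wpM2r// -[1]/((1 : R)%:C) lecR /t.
by rewrite mulrCA divfK ?gt_eqF//; lra.
Qed.

End PositiveFunctionals.

Section Representations.
Variable H : hilbertType R.

(** The functional a |-> <rho(a) x, x> is positive, and its value at a^* a is
    the squared norm of rho(a) x. *)
Lemma rep_bound (rho : P -> H -> H) a x : star_representation rho ->
  nrm (rho a x) <= 2 * nrm a * nrm x.
Proof.
move=> [rB rL rM r1 rS].
have := @positive_functional_bound (fun a => inner (rho a x) x) _ _ a.
rewrite rM /= rS r1 !inner_nrm -rmorphM lecR => h.
rewrite -ler_sqr ?nnegrE ?mulr_ge0 ?nrm_ge0//.
apply: le_trans (h _ _) _.
- by move=> k b c; rewrite rL innerDl innerZl.
- by move=> b; rewrite rM /= rS inner_nrm ler0c sqr_ge0.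
- rewrite !exprMn; have : 0 <= nrm a ^+ 2 * nrm x ^+ 2 by rewrite mulr_ge0 ?sqr_ge0.
  by move: (nrm a ^+ 2) (nrm x ^+ 2) => p q; nra.
Qed.

(** Representations are continuous, so that the set where two of them agree is a
    closed subalgebra. *)
Lemma rep_eq (rho rho' : P -> H -> H) (S : set P) : cstar_generated S = setT ->
  star_representation rho -> star_representation rho' ->
  (forall a, S a -> rho a = rho' a) -> rho = rho'.
Proof.
move=> ST rho_rep rho'_rep Srho.
have [rB rL rM r1 rS] := rho_rep; have [rB' rL' rM' r1' rS'] := rho'_rep.
pose B := [set a | rho a = rho' a].
have Bsub : star_subalgebra B.
  split=> [|k a b|a b|a]; rewrite /B /=; first by rewrite r1 r1'.
  - by rewrite rL rL' => -> ->.
  - by rewrite rM rM' => -> ->.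
  - by move=> aa; apply/funext => x; apply: inner_eqP => y; rewrite rS rS' aa.
have BT := star_subalgebra_dense ST Bsub Srho.
apply/funext => a; apply/funext => x.
apply/eqP; rewrite -subr_eq0; apply/eqP/nrm0_eq0/eqP.
rewrite eq_le nrm_ge0 andbT; apply/ler_addgt0Pl => e e0; rewrite addr0.
have : closure B a by rewrite BT.
have c0 : 0 < 4 * nrm x + 1 by rewrite ltr_wpDl// mulr_ge0 ?nrm_ge0.
move=> /closure_nrmP/(_ (e / (4 * nrm x + 1))) [|b Bb]; first by rewrite divr_gt0.
rewrite ltr_pdivlMr// => h; apply: le_trans (ltW h).
have -> : rho a x - rho' a x = rho (a - b) x - rho' (a - b) x.
  by rewrite (linB rL) (linB rL') !fctE -[rho b]/(rho b) Bb opprB addrA subrK.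
apply: le_trans (nrmB _ _) _.
have := rep_bound (a - b) x rho_rep; have := rep_bound (a - b) x rho'_rep.
by have := nrm_ge0 (a - b); move: (nrm (a - b)) (nrm x) => p q; nra.
Qed.

End Representations.
End CStarAlgebras.

(** * Square-summable sequences *)

Section AbsoluteSeries.
Variables (R : realType).

Lemma nondecreasing_bounded_cauchy (S : nat -> R) (C : R) :
  (forall n, S n <= S n.+1) -> (forall n, S n <= C) ->
  forall e, 0 < e -> exists N, forall m n, (N <= m)%N -> (N <= n)%N ->
    `|S m - S n| < e.
Proof.
move=> Smono SC e e0.
have : cvgn S.
  apply: nondecreasing_is_cvgn; first exact/nondecreasing_seqP.
  by exists C => _ [n _ <-].
move=> /cvgrPdist_lt/(_ (e / 2)) []; first by rewrite divr_gt0.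
move=> N _ SN; exists N => m n /SN + /SN.
rewrite [`|_ - S m|]distrC.
have := ler_normD (S m - limn S) (limn S - S n); rewrite addrA subrK.
lra.
Qed.

Lemma abs_series_cvg (a : nat -> R[i]^o) (C : R) :
  (forall N, \sum_(0 <= k < N) nrm (a k) <= C) -> cvgn (series a).
Proof.
move=> aC.
suff [l al] : exists l : R[i]^o, series a @ \oo --> l by apply: cvgP al.
apply: complex_cauchy_cvg => e e0.
have [||N SN] := @nondecreasing_bounded_cauchy
    (fun N => \sum_(0 <= k < N) nrm (a k)) C _ _ e e0 => // [n|].
  by rewrite big_nat_recr//= lerDl nrm_ge0.
have le m n : (m <= n)%N -> nrm (series a m - series a n) <=
    `|\sum_(0 <= k < m) nrm (a k) - \sum_(0 <= k < n) nrm (a k)|.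
  move=> mn; rewrite nrmC distrC sub_series_geq// (big_cat_nat (leq0n m) mn)/=.
  rewrite addrAC subrr add0r ger0_norm ?sumr_ge0// => [|k _]; last exact: nrm_ge0.
  elim/big_ind2 : _ => [|x y z t xy zt|//]; first by rewrite nrm0.
  by apply: le_trans (nrmD _ _) _; exact: lerD.
exists N => m n Nm Nn; case: (leqP m n) => [mn|/ltnW nm].
  by apply: le_lt_trans (le _ _ mn) (SN _ _ Nm Nn).
by rewrite nrmC; apply: le_lt_trans (le _ _ nm) (SN _ _ Nn Nm).
Qed.

(** A Cauchy filter contains, for each n, a ball of radius 1 / (n + 1); the
    sequence of the centers is Cauchy and has the same limit. *)
Lemma complete_of_sequences (V : normedModType R[i]) :
  (forall u : nat -> V, (forall e : R, 0 < e -> exists N, forall m n,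
     (N <= m)%N -> (N <= n)%N -> nrm (u m - u n) < e) ->
     exists l : V, u @ \oo --> l) ->
  forall F : set_system V, ProperFilter F -> cauchy F -> cvg F.
Proof.
move=> cV F FF Fc.
have small e : 0 < e -> exists N, forall n, (N <= n)%N -> n.+1%:R^-1 < e :> R.
  by move=> e0; have [N _ NP] := near_infty_natSinv_lt (PosNum e0); exists N.
have inv0 n : 0 < n.+1%:R^-1 :> R by rewrite invr_gt0.
have ex n : exists x : V, F [set y | nrm (x - y) < n.+1%:R^-1].
  have e0 : 0 < (n.+1%:R^-1 : R)%:C by rewrite ltcR.
  have [x xF] := (iffLR (cauchyP F) Fc) _ e0.
  by exists x; apply: filterS xF => y; rewrite -ball_normE/= nrmE ltcR.
have [u uF] := choice ex.
have uu m n : nrm (u m - u n) < m.+1%:R^-1 + n.+1%:R^-1.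
  have [y [/= ym yn]] := @filter_ex _ _ FF _ (filterI (uF m) (uF n)).
  by apply: le_lt_trans (nrm_triangle y _ _) _; rewrite [nrm (y - _)]nrmC ltrD.
have [l ul] : exists l : V, u @ \oo --> l.
  apply: cV => e e0.
  have [|N NP] := small (e / 2); first by rewrite divr_gt0.
  exists N => m n Nm Nn; apply: lt_trans (uu m n) _.
  by rewrite [e]splitr ltrD ?NP.
apply/cvg_ex; exists l; apply/cvgrPdist_lt => e e0.
have eE : e = (complex.Re e)%:C by rewrite RRe_real// gtr0_real.
have e2 : 0 < complex.Re e / 2 by rewrite divr_gt0// -ltcR -eE.
have [N NP] := small _ e2; have [M MP] := (iffLR (nrm_cvgP _ _) ul) _ e2.
apply: filterS (uF (maxn N M)) => y /= uy.
rewrite nrmE eE ltcR; apply: le_lt_trans (nrm_triangle (u (maxn N M)) _ _) _.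
rewrite [complex.Re e]splitr ltrD//; first by rewrite nrmC MP ?leq_maxr.
by apply: lt_trans uy (NP _ (leq_maxl _ _)).
Qed.

End AbsoluteSeries.

Section SquareSummable.
Variables (R : realType) (H : hilbertType R).
Implicit Types x y : nat -> H.

Lemma square_summableP x : square_summable x <->
  exists C : R, forall N, \sum_(0 <= k < N) nrm (x k) ^+ 2 <= C.
Proof.
have sE N : series (fun n => `|x n| ^+ 2 : R[i]^o) N =
    (\sum_(0 <= k < N) nrm (x k) ^+ 2)%:C.
  by rewrite rmorph_sum /=; apply: eq_bigr => k _; rewrite nrmE rmorphXn.
split=> [xs|[C xC]]; last first.
  apply: (@abs_series_cvg _ _ C) => N.
  rewrite (eq_bigr (fun k => nrm (x k) ^+ 2))// => k _.
  by rewrite nrmE -rmorphXn nrm_real ger0_norm ?sqr_ge0.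
have /nrm_cvgP/(_ 1 ltr01)[N sN] := xs.
set l := limn _ in sN.
exists (nrm l + 1) => m.
have := sN (maxn N m) (leq_maxl _ _).
have := nrm_dist (series (fun n => `|x n| ^+ 2 : R[i]^o) (maxn N m)) l.
rewrite {1}sE nrm_real [`|\sum_(_ <= _ < _) _|]ger0_norm; last first.
  by apply: sumr_ge0 => k _; exact: sqr_ge0.
move=> h1 h2.
have : \sum_(0 <= k < m) nrm (x k) ^+ 2 <= \sum_(0 <= k < maxn N m) nrm (x k) ^+ 2.
  rewrite (big_cat_nat (leq0n m) (leq_maxr N m))/= lerDl.
  by rewrite sumr_ge0// => k _; exact: sqr_ge0.
move: h1; rewrite ler_norml => /andP[_]; lra.
Qed.

Lemma square_summable_submod : submod_closed
  [pred x : nat -> H | `[< square_summable x >]].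
Proof.
split=> [|c x y].
  apply/asboolP/square_summableP; exists 0 => N.
  by rewrite big1// => k _; rewrite [nrm _](nrm0 H) expr0n.
move=> /asboolP/square_summableP[C xC] /asboolP/square_summableP[D yD].
apply/asboolP/square_summableP; exists (2 * (nrm (c : R[i]^o) ^+ 2 * C + D)) => N.
have le k : nrm ((c *: x + y) k) ^+ 2 <=
    2 * (nrm (c : R[i]^o) ^+ 2 * nrm (x k) ^+ 2 + nrm (y k) ^+ 2).
  have -> : (c *: x + y) k = c *: x k + y k by [].
  have := parallelogram (c *: x k) (y k); have := sqr_ge0 (nrm (c *: x k - y k)).
  by rewrite nrmZ exprMn mulr2n; move: (_ ^+ 2) => a; lra.
apply: le_trans (ler_sum _ (fun k _ => le k)) _.
rewrite -mulr_sumr ler_pM2l// big_split/= -mulr_sumr.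
by rewrite lerD// ler_wpM2l ?sqr_ge0.
Qed.

HB.instance Definition _ := GRing.isSubmodClosed.Build _ _
  [pred x : nat -> H | `[< square_summable x >]] square_summable_submod.

End SquareSummable.

(** A concrete model, which serves only to inhabit ell2_space. *)
Record l2 (R : realType) (H : hilbertType R) := L2 {
  l2_val :> nat -> H;
  l2_pred : [pred x : nat -> H | `[< square_summable x >]] l2_val
}.

Section L2Lmodule.
Variables (R : realType) (H : hilbertType R).

HB.instance Definition _ := [isSub for @l2_val R H].
HB.instance Definition _ := [Choice of l2 H by <:].
HB.instance Definition _ := [SubChoice_isSubLmodule of l2 H by <:].
End L2Lmodule.

(** * The Hilbert space of square-summable sequences *)

Section L2Form.
Variables (R : realType) (H : hilbertType R).
Implicit Types x y z : l2 H.

Lemma l2P x : square_summable x.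
Proof. exact/asboolP/(l2_pred x). Qed.

Lemma l2_ext x y : x =1 y -> x = y.
Proof. by move=> xy; apply/val_inj/funext. Qed.

Definition l2_inner x y : R[i] := ultraweak_functional x y id.

Lemma square_summable_series_cvg (x y : nat -> H) :
  square_summable x -> square_summable y ->
  cvgn (series (fun n => inner (x n) (y n) : R[i]^o)).
Proof.
move=> /square_summableP[C xC] /square_summableP[D yD].
apply: (@abs_series_cvg _ _ (C + D)) => N.
apply: le_trans (lerD (xC N) (yD N)); rewrite -big_split/=.
apply: ler_sum => k _; apply: le_trans (inner_cauchy_schwarz _ _) _.
have := sqr_ge0 (nrm (x k) - nrm (y k)); have := sqr_ge0 (nrm (x k) + nrm (y k)).
by rewrite sqrrB sqrrD; move: (_ * _) (_ ^+ 2) => *; lra.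
Qed.

Lemma l2_inner_cvg x y :
  series (fun n => inner (x n) (y n) : R[i]^o) @ \oo --> (l2_inner x y : R[i]^o).
Proof. exact: (square_summable_series_cvg (@l2P x) (@l2P y)). Qed.

Lemma l2_inner_unique x y (l : R[i]^o) :
  series (fun n => inner (x n) (y n) : R[i]^o) @ \oo --> l -> l2_inner x y = l.
Proof. exact: (nrm_cvg_unique (@l2_inner_cvg x y)). Qed.

Lemma cvg_conj (u : nat -> R[i]^o) (l : R[i]^o) :
  u @ \oo --> l -> (fun n => Num.conj (u n) : R[i]^o) @ \oo --> (Num.conj l : R[i]^o).
Proof.
move=> /nrm_cvgP ul; apply/nrm_cvgP => e /ul[N uN]; exists N => n /uN.
by rewrite -rmorphB /nrm norm_conjC.
Qed.

Lemma l2_inner_linl c x y z :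
  l2_inner (c *: x + y) z = c * l2_inner x z + l2_inner y z.
Proof.
apply: l2_inner_unique.
have -> : series (fun n => inner ((c *: x + y) n) (z n) : R[i]^o) =
    (fun n => c *: series (fun n => inner (x n) (z n) : R[i]^o) n +
       series (fun n => inner (y n) (z n) : R[i]^o) n).
  apply/funext => n; rewrite /series/= scaler_sumr -big_split/=.
  by apply: eq_bigr => k _; rewrite innerDl innerZl.
by apply: cvgD; [apply: cvgZr|]; exact: l2_inner_cvg.
Qed.

Lemma l2_inner_conj x y : l2_inner x y = Num.conj (l2_inner y x).
Proof.
apply: l2_inner_unique.
have -> : series (fun n => inner (x n) (y n) : R[i]^o) =
    (fun n => Num.conj (series (fun n => inner (y n) (x n) : R[i]^o) n)).
  apply/funext => n; rewrite /series/= rmorph_sum; apply: eq_bigr => k _.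
  exact: innerC.
by apply: cvg_conj; exact: l2_inner_cvg.
Qed.

Lemma l2_bilinear :
  bilinear_for ( *%R : R[i] -> R[i] -> R[i])
    (Num.conj \; *%R : R[i] -> R[i] -> R[i]) l2_inner.
Proof.
split=> [z c x y|z c x y]; first exact: l2_inner_linl.
rewrite l2_inner_conj l2_inner_linl rmorphD rmorphM/=.
by rewrite -!(l2_inner_conj z).
Qed.

HB.instance Definition _ := bilinear_isBilinear.Build _ _ _ _ _ _ l2_inner
  l2_bilinear.

Lemma l2_hermitian x y :
  l2_inner x y = (-1) ^+ false * Num.conj (l2_inner y x).
Proof. by rewrite mul1r -l2_inner_conj. Qed.

HB.instance Definition _ := isHermitianSesquilinear.Build _ _ _ _ l2_inner
  l2_hermitian.

Lemma l2_innerE x : exists2 s : R, l2_inner x x = s%:C &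
  (forall N, \sum_(0 <= k < N) nrm (x k) ^+ 2 <= s) /\
  (forall C, (forall N, \sum_(0 <= k < N) nrm (x k) ^+ 2 <= C) -> s <= C).
Proof.
pose S N := \sum_(0 <= k < N) nrm (x k) ^+ 2.
have Smono : nondecreasing_seq S.
  apply/nondecreasing_seqP => n.
  by rewrite /S big_nat_recr//= lerDl sqr_ge0.
have [C SC] := (iffLR (square_summableP _) (@l2P x)).
have Scvg : cvgn S.
  by apply: nondecreasing_is_cvgn => //; exists C => _ [n _ <-]; exact: SC.
exists (limn S); last split=> [N|D SD].
- apply: l2_inner_unique; apply/nrm_cvgP => e e0.
  have [N _ SN] := (iffLR (cvgrPdist_lt _ _) Scvg) _ e0.
  exists N => n /SN; rewrite distrC -nrm_real rmorphB/= rmorph_sum/=.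
  by under eq_bigr do rewrite -inner_nrm.
- exact: nondecreasing_cvgn_le.
- by apply: limr_le => //; apply: nearW.
Qed.

Lemma l2_dot x : x != 0 -> 0 < l2_inner x x.
Proof.
move=> x0; have [s -> [sS _]] := l2_innerE x.
have [[k xk]|x_0] := pselect (exists k, x k != 0); last first.
  case/negP: x0; apply/eqP/l2_ext => k; apply/eqP/negPn/negP => xk.
  by apply: x_0; exists k.
rewrite ltcR; apply: lt_le_trans (sS k.+1); rewrite big_nat_recr//=.
rewrite ltr_wpDl ?sumr_ge0// => [j _|]; first exact: sqr_ge0.
rewrite exprn_gt0// lt_def nrm_ge0 andbT.
by apply: contraNneq xk => /nrm0_eq0->.
Qed.

HB.instance Definition _ := isDotProduct.Build _ _ l2_inner l2_dot.

Definition l2_form : {dot (l2 H) for (@Num.conj R[i])} := l2_inner.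

Definition l2_norm x : R[i] := (Num.sqrt (complex.Re (l2_inner x x)))%:C.

Lemma l2_inner_ge0 x : 0 <= complex.Re (l2_inner x x).
Proof.
have [s -> [sS _]] := l2_innerE x.
by apply: le_trans (sS 0); rewrite big_nil.
Qed.

Lemma l2_inner_self x : l2_inner x x = (complex.Re (l2_inner x x))%:C.
Proof. by have [s -> _] := l2_innerE x. Qed.

Lemma sqr_l2_norm x : l2_norm x ^+ 2 = l2_inner x x.
Proof.
by rewrite /l2_norm -rmorphXn/= sqr_sqrtr ?l2_inner_ge0// -l2_inner_self.
Qed.

Lemma l2_normD x y : l2_norm (x + y) <= l2_norm x + l2_norm y.
Proof.
rewrite /l2_norm -rmorphD lecR.
set p := Num.sqrt _; set q := Num.sqrt _; set r := Num.sqrt _.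
have [p0 q0 r0] : [/\ 0 <= p, 0 <= q & 0 <= r] by split; exact: sqrtr_ge0.
have qr0 : 0 <= q + r by exact: addr_ge0.
suff : p ^+ 2 <= (q + r) ^+ 2 by rewrite ler_sqr ?nnegrE.
have pE : p ^+ 2 = complex.Re (l2_inner (x + y) (x + y)).
  by rewrite sqr_sqrtr ?l2_inner_ge0.
have qE : q ^+ 2 = complex.Re (l2_inner x x) by rewrite sqr_sqrtr ?l2_inner_ge0.
have rE : r ^+ 2 = complex.Re (l2_inner y y) by rewrite sqr_sqrtr ?l2_inner_ge0.
have := form_cauchy_schwarz l2_form x y.
rewrite (dnormD l2_form) in pE.
rewrite nrmE [l2_form x x]l2_inner_self [l2_form y y]l2_inner_self.
rewrite -qE -rE -!rmorphM -rmorphXn lecR -exprMn.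
rewrite ler_sqr ?nnegrE ?mulr_ge0 ?nrm_ge0// => xy.
have : complex.Re (l2_form x y) <= q * r.
  by apply: le_trans xy; apply: le_trans (ler_norm _) (Re_le_nrm _).
have -> : p ^+ 2 = q ^+ 2 + r ^+ 2 + complex.Re (l2_form x y) *+ 2.
  rewrite pE qE rE /l2_form /=.
  by move: (l2_inner x x) (l2_inner y y) (l2_inner x y) => [? ?] [? ?] [? ?].
by rewrite sqrrD mulr2n; move: (q * r) (complex.Re _) => *; lra.
Qed.

Lemma l2_normZ (c : R[i]) x : l2_norm (c *: x) = `|c| * l2_norm x.
Proof.
have h0 : 0 <= l2_norm (c *: x) by rewrite ler0c sqrtr_ge0.
have h1 : 0 <= `|c| * l2_norm x by rewrite mulr_ge0// ler0c sqrtr_ge0.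
apply/eqP; rewrite -(eqrXn2 (isT : (0 < 2)%N) h0 h1) exprMn !sqr_l2_norm.
by rewrite -(dnormZ l2_form).
Qed.

Lemma l2_norm_eq0 x : l2_norm x = 0 -> x = 0.
Proof.
move=> /eqP; rewrite -sqrf_eq0 sqr_l2_norm => /eqP x0.
by apply/eqP; rewrite -(dnorm_eq0 l2_form) /l2_form/= x0.
Qed.

HB.instance Definition _ := Lmodule_isNormed.Build R[i] (l2 H)
  l2_normD l2_normZ l2_norm_eq0.

Lemma nrm_l2E x : nrm x = Num.sqrt (complex.Re (l2_inner x x)).
Proof. by []. Qed.

Lemma l2_partial_le x N : \sum_(0 <= k < N) nrm (x k) ^+ 2 <= nrm x ^+ 2.
Proof.
rewrite nrm_l2E sqr_sqrtr ?l2_inner_ge0//.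
by have [s -> [sS _]] := l2_innerE x; exact: sS.
Qed.

Lemma l2_nrm_le x C : 0 <= C ->
  (forall N, \sum_(0 <= k < N) nrm (x k) ^+ 2 <= C ^+ 2) -> nrm x <= C.
Proof.
move=> C0 xC; rewrite -ler_sqr ?nnegrE ?nrm_ge0//.
rewrite nrm_l2E sqr_sqrtr ?l2_inner_ge0//.
by have [s -> [_ sS]] := l2_innerE x; exact: sS.
Qed.

Lemma l2_coord_le x k : nrm (x k) <= nrm x.
Proof.
rewrite -ler_sqr ?nnegrE ?nrm_ge0//; apply: le_trans (l2_partial_le x k.+1).
by rewrite big_nat_recr//= lerDr sumr_ge0// => j _; exact: sqr_ge0.
Qed.

(** Limits are taken in each coordinate, and the bounds on finite partial sums
    of squares survive the passage to the limit. *)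
Lemma l2_complete (F : set_system (l2 H)) : ProperFilter F -> cauchy F -> cvg F.
Proof.
apply: complete_of_sequences => u uc.
have coord k : exists l : H, (fun n => u n k) @ \oo --> l.
  apply: nrm_cauchy_cvg => e /uc[N uN]; exists N => m n Nm Nn.
  apply: le_lt_trans (uN _ _ Nm Nn).
  by have := l2_coord_le (u m - u n) k.
have [z zP] := choice coord.
have tail e : 0 < e -> exists N, forall n, (N <= n)%N -> forall M,
    \sum_(0 <= k < M) nrm (u n k - z k) ^+ 2 <= e ^+ 2.
  move=> e0; have [N uN] := uc e e0; exists N => n Nn M.
  have lim : (fun m => \sum_(0 <= k < M) nrm (u n k - u m k) ^+ 2) @ \oo -->
      \sum_(0 <= k < M) nrm (u n k - z k) ^+ 2.
    elim: M => [|M IH].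
      by rewrite big_nil; under eq_fun do rewrite big_nil; exact: cvg_cst.
    rewrite big_nat_recr//=; under eq_fun do rewrite big_nat_recr//=.
    apply: cvgD => //; apply: cvgM; apply: cvg_nrm; apply: cvgB => //;
      exact: cvg_cst.
  apply: (cvgr_to_le lim); exists N => // m /= Nm.
  apply: le_trans (l2_partial_le (u n - u m) M) _.
  by rewrite ler_sqr ?nnegrE ?nrm_ge0 ?(ltW e0)// ltW ?uN.
have zs : square_summable z.
  have [N /(_ N (leqnn N)) zN] := tail 1 ltr01.
  apply/square_summableP; exists (2 * (nrm (u N) ^+ 2 + 1 ^+ 2)) => M.
  apply: le_trans (ler_wpM2l _ (lerD (l2_partial_le (u N) M) (zN M))) => //.
  rewrite -big_split mulr_sumr; apply: ler_sum => k _ /=.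
  have := nrmB (u N k) (u N k - z k); rewrite subKr.
  have := nrm_ge0 (z k); move: (nrm _) (nrm _) (nrm _) => a b c.
  by have := sqr_ge0 (b - a); nra.
exists (L2 (asboolT zs)); apply/nrm_cvgP => e e0.
have [|N tN] := tail (e / 2); first by rewrite divr_gt0.
exists N => n /tN h; apply: (@le_lt_trans _ _ (e / 2)).
  by apply: l2_nrm_le; [rewrite divr_ge0// ltW|exact: h].
by rewrite ltr_pdivrMr// ltr_pMr// ltr1n.
Qed.

HB.instance Definition _ := Uniform_isComplete.Build (l2 H) l2_complete.

Lemma l2_sqr_normE x : `|x| ^+ 2 = l2_form x x.
Proof. exact: sqr_l2_norm. Qed.

HB.instance Definition _ := isHilbertSpace.Build R (l2 H) l2_sqr_normE.

Definition l2_mk (s : nat -> H) : l2 H := insubd (0 : l2 H) s.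

Lemma l2_mkE s : square_summable s -> l2_mk s = s :> (nat -> H).
Proof. by move=> ss; rewrite /l2_mk insubdK//; exact/asboolP. Qed.

End L2Form.

(** The properties of the Hilbert space of square-summable sequences on which
    the sequel rests. *)
Record ell2_space (R : realType) (H : hilbertType R) := Ell2Space {
  ell2_carrier : hilbertType R ;
  ell2_coord : ell2_carrier -> nat -> H ;
  ell2_make : (nat -> H) -> ell2_carrier ;
  ell2_summable : forall x, square_summable (ell2_coord x) ;
  ell2_ext : forall x y, ell2_coord x =1 ell2_coord y -> x = y ;
  ell2_makeE : forall s, square_summable s -> ell2_coord (ell2_make s) = s ;
  ell2_coord_linear : forall k, linear (ell2_coord^~ k) ;
  ell2_innerE : forall x y,
    inner x y = ultraweak_functional (ell2_coord x) (ell2_coord y) id ;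
  ell2_partial_le : forall x N,
    \sum_(0 <= k < N) nrm (ell2_coord x k) ^+ 2 <= nrm x ^+ 2 ;
  ell2_nrm_le : forall x C, 0 <= C ->
    (forall N, \sum_(0 <= k < N) nrm (ell2_coord x k) ^+ 2 <= C ^+ 2) -> nrm x <= C
}.

(** The proof is opaque on purpose: unification would otherwise unfold the
    operations of the model. *)
Lemma the_ell2 (R : realType) (H : hilbertType R) : ell2_space H.
Proof.
apply: (@Ell2Space R H (l2 H : hilbertType R) (@l2_val R H) (@l2_mk R H)).
- exact: l2P.
- exact: l2_ext.
- exact: l2_mkE.
- by move=> k c x y.
- by [].
- exact: l2_partial_le.
- exact: l2_nrm_le.
Qed.

Definition ell2 (R : realType) (H : hilbertType R) : hilbertType R :=
  ell2_carrier (the_ell2 H).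

Definition coord (R : realType) (H : hilbertType R) : ell2 H -> nat -> H :=
  @ell2_coord R H (the_ell2 H).

Section Ell2.
Variables (R : realType) (H : hilbertType R).
Implicit Types x y : ell2 H.

Lemma coord_lin c x y k : coord (c *: x + y) k = c *: coord x k + coord y k.
Proof. exact: ell2_coord_linear. Qed.

Lemma coord0 k : coord (0 : ell2 H) k = 0.
Proof. exact: (lin0 (ell2_coord_linear k)). Qed.

Lemma coordB x y k : coord (x - y) k = coord x k - coord y k.
Proof. exact: (linB (ell2_coord_linear k)). Qed.

Lemma ell2_of_summable (s : nat -> H) : square_summable s -> exists x, coord x = s.
Proof. by move=> ss; exists (ell2_make (the_ell2 H) s); exact: ell2_makeE. Qed.

Lemma nrm_coord_le x k : nrm (coord x k) <= nrm x.
Proof.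
rewrite -ler_sqr ?nnegrE ?nrm_ge0//; apply: le_trans (ell2_partial_le x k.+1).
by rewrite big_nat_recr//= lerDr sumr_ge0// => j _; exact: sqr_ge0.
Qed.

End Ell2.

(** * Amplification of operators *)

Section Projections.
Variables (R : realType) (H : hilbertType R).

Lemma projection_operator (M : set H) : submodule M -> closed M ->
  exists P : H -> H, [/\ linear P, forall x, nrm (P x) <= nrm x,
    forall x, M (P x) &
    forall x p, M p -> (forall y, M y -> inner (x - p) y = 0) -> P x = p].
Proof.
move=> Msub Mcl; have [_ ML] := Msub.
have ex x : exists p, M p /\ forall y, M y -> inner (x - p) y = 0.
  by have [p Mp pP] := orthogonal_projection Msub Mcl x; exists p.
have [P PP] := choice ex; exists P.
have uniq x p : M p -> (forall y, M y -> inner (x - p) y = 0) -> P x = p.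
  move=> Mp pP; have [MP P0] := PP x.
  have Md : M (- 1 *: p + P x) by exact: ML.
  apply/eqP; rewrite -subr_eq0; apply/eqP/nrm0_eq0/eqP.
  rewrite -sqrf_eq0; apply/eqP/complexI; rewrite -inner_nrm.
  move: Md; rewrite scaleN1r addrC => Md.
  have E : P x - p = (x - p) - (x - P x) by rewrite opprB [RHS]addrC addrA subrK.
  by rewrite {1}E innerBl pP// P0// subrr.
split=> [c x y|x|x|//]; last by have [] := PP x.
- have [Mx Px] := PP x; have [My Py] := PP y.
  apply: uniq; first exact: ML.
  move=> z Mz; rewrite opprD addrACA -scalerBr innerDl innerZl Px// Py//.
  by rewrite mulr0 addr0.
- have [Mx Px] := PP x.
  have [->|P0] := eqVneq (nrm (P x)) 0; first exact: nrm_ge0.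
  have Pp : 0 < nrm (P x) by rewrite lt_def P0 nrm_ge0.
  rewrite -(ler_pM2r Pp) -expr2; apply: le_trans (inner_cauchy_schwarz _ _).
  have /eqP := Px _ Mx; rewrite innerBl subr_eq0 => /eqP ->.
  by rewrite inner_nrm nrm_real ger0_norm ?sqr_ge0.
Qed.

End Projections.

Section Amplification.
Variables (R : realType) (H : hilbertType R).
Implicit Types (x y z : ell2 H) (S T : H -> H) (u v : H).

Definition ell2_single j v : ell2 H :=
  ell2_make (the_ell2 H) (fun k => if k == j then v else 0).

Lemma coord_single j v k : coord (ell2_single j v) k = if k == j then v else 0.
Proof.
rewrite /coord ell2_makeE//; apply/square_summableP.
exists (nrm v ^+ 2) => N.
have -> : \sum_(0 <= k0 < N) nrm (if k0 == j then v else 0) ^+ 2 =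
    \sum_(0 <= k0 < N) if k0 == j then nrm v ^+ 2 else 0.
  by apply: eq_bigr => i _; case: ifP => // _; rewrite nrm0 expr0n.
rewrite -big_mkcond/= big_nat1_eq; case: ifP => // _.
exact: sqr_ge0.
Qed.

Lemma coord_sum I (r : seq I) (Q : pred I) (F : I -> ell2 H) k :
  coord (\sum_(i <- r | Q i) F i) k = \sum_(i <- r | Q i) coord (F i) k.
Proof. exact: (lin_sum (ell2_coord_linear (e := the_ell2 H) k)). Qed.

Lemma coord_trunc x N k :
  coord (\sum_(0 <= j < N) ell2_single j (coord x j)) k =
  if (k < N)%N then coord x k else 0.
Proof.
rewrite coord_sum; under eq_bigr do rewrite coord_single eq_sym.
by rewrite -big_mkcond/= big_nat1_eq.
Qed.

Lemma ell2_trunc_cvg x :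
  (fun N => \sum_(0 <= j < N) ell2_single j (coord x j)) @ \oo --> x.
Proof.
apply/nrm_cvgP => e e0; have e20 : 0 < (e / 2) ^+ 2 by rewrite exprn_gt0// divr_gt0.
pose S N := \sum_(0 <= k < N) nrm (coord x k) ^+ 2.
have [||N SN] := @nondecreasing_bounded_cauchy _ S (nrm x ^+ 2) _ _ _ e20.
- by move=> n; rewrite /S big_nat_recr//= lerDl sqr_ge0.
- by move=> n; exact: ell2_partial_le.
exists N => n Nn; rewrite nrmC; apply: (@le_lt_trans _ _ (e / 2)); last first.
  by rewrite ltr_pdivrMr// ltr_pMr// ltr1n.
apply: ell2_nrm_le => [|M]; first by rewrite divr_ge0// ltW.
have termE k :
    nrm (coord (x - \sum_(0 <= j < n) ell2_single j (coord x j)) k) ^+ 2 =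
    if (k < n)%N then 0 else nrm (coord x k) ^+ 2.
  by rewrite coordB coord_trunc; case: ifP; rewrite ?subrr ?subr0// nrm0 expr0n.
under eq_bigr do rewrite termE.
have [Mn|nM] := leqP M n.
  rewrite big_nat_cond big1 ?sqr_ge0// => k /andP[/andP[_ kM] _].
  by rewrite (leq_trans kM Mn).
have := SN M n (leq_trans Nn (ltnW nM)) Nn.
rewrite /S (big_cat_nat (leq0n n) (ltnW nM))/= addrAC subrr add0r.
rewrite (big_cat_nat (leq0n n) (ltnW nM))/= => /ltW/(le_trans (ler_norm _)).
rewrite [X in _ -> X + _ <= _]big_nat_cond [X in _ -> X + _ <= _]big1 ?add0r.
  apply: le_trans; rewrite [leLHS]big_nat_cond [leRHS]big_nat_cond.
  by apply: ler_sum => k /andP[/andP[nk _] _]; rewrite ltnNge nk.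
by move=> k /andP[/andP[_ ->] _].
Qed.

(** Sequences with finite support are dense. *)
Lemma ell2_op_ext (V : normedModType R[i]) (F G : ell2 H -> V) (C : R) :
  linear F -> linear G -> (forall x, nrm (F x) <= C * nrm x) ->
  (forall x, nrm (G x) <= C * nrm x) ->
  (forall j v, F (ell2_single j v) = G (ell2_single j v)) -> F = G.
Proof.
move=> FL GL FC GC FG; apply/funext => x.
have cont (K : ell2 H -> V) : linear K -> (forall x, nrm (K x) <= C * nrm x) ->
    (fun N => K (\sum_(0 <= j < N) ell2_single j (coord x j))) @ \oo --> K x.
  move=> KL KC; apply/nrm_cvgP => e e0.
  have C1 : 0 < `|C| + 1 by rewrite ltr_wpDl.
  have [|N xN] := (iffLR (nrm_cvgP _ _) (@ell2_trunc_cvg x)) (e / (`|C| + 1)).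
    by rewrite divr_gt0.
  exists N => n /xN; rewrite -linB// ltr_pdivlMr//; apply: le_lt_trans.
  apply: le_trans (KC _) _; rewrite mulrC ler_wpM2l ?nrm_ge0//.
  by rewrite (le_trans (ler_norm C)) ?lerDl.
apply: (nrm_cvg_unique (cont F FL FC)).
have -> : (fun N => F (\sum_(0 <= j < N) ell2_single j (coord x j))) =
          (fun N => G (\sum_(0 <= j < N) ell2_single j (coord x j))).
  by apply/funext => N; rewrite !lin_sum//; apply: eq_bigr.
exact: cont.
Qed.

Definition amplify T x : ell2 H := ell2_make (the_ell2 H) (fun k => T (coord x k)).

Section Bounded.
Variables (T : H -> H).
Hypothesis Tb : bounded_op T.

Lemma coord_amplify x k : coord (amplify T x) k = T (coord x k).
Proof.
rewrite /coord ell2_makeE//; apply/square_summableP.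
have [TL [C C0 TC]] := (iffLR (bounded_opP T) Tb).
exists (C ^+ 2 * nrm x ^+ 2) => N.
apply: le_trans (ler_wpM2l (sqr_ge0 C) (ell2_partial_le x N)).
rewrite mulr_sumr; apply: ler_sum => j _.
by rewrite -exprMn ler_sqr ?nnegrE ?mulr_ge0 ?nrm_ge0.
Qed.

Lemma amplify_bound C x : 0 <= C -> (forall v, nrm (T v) <= C * nrm v) ->
  nrm (amplify T x) <= C * nrm x.
Proof.
move=> C0 TC; apply: ell2_nrm_le => [|N]; first by rewrite mulr_ge0 ?nrm_ge0.
rewrite exprMn; apply: le_trans (ler_wpM2l (sqr_ge0 C) (ell2_partial_le x N)).
rewrite mulr_sumr; apply: ler_sum => j _.
by rewrite -/(coord _ _) coord_amplify -exprMn ler_sqr ?nnegrE ?mulr_ge0 ?nrm_ge0.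
Qed.

Lemma amplify_linear : linear (amplify T).
Proof.
have [TL _] := Tb; move=> c x y; apply: ell2_ext => k.
by rewrite -!/(coord _ _) coord_lin !coord_amplify coord_lin TL.
Qed.

Lemma amplify_single j v : amplify T (ell2_single j v) = ell2_single j (T v).
Proof.
have [TL _] := Tb; apply: ell2_ext => k; rewrite -!/(coord _ _).
by rewrite coord_amplify !coord_single; case: ifP => // _; exact: lin0.
Qed.

Lemma ultraweak_amplify x y :
  ultraweak_functional (coord x) (coord y) T = inner (amplify T x) y.
Proof.
rewrite ell2_innerE /ultraweak_functional; congr (limn (series _)).
by apply/funext => n; rewrite -!/(coord _ _) coord_amplify.
Qed.

End Bounded.

Lemma amplify_adjoint S S' x y : bounded_op S -> bounded_op S' ->
  (forall u v, inner (S u) v = inner u (S' v)) ->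
  inner (amplify S x) y = inner x (amplify S' y).
Proof.
move=> Sb S'b SS'; rewrite !ell2_innerE /ultraweak_functional.
congr (limn (series _)); apply/funext => n.
by rewrite -!/(coord _ _) !coord_amplify//= SS'.
Qed.

End Amplification.

(** * Von Neumann density *)

Section Bicommutant.
Variables (R : realType) (H : hilbertType R).
Implicit Types (S T : H -> H) (x y z : ell2 H).

Lemma bounded_op_comp S T : bounded_op S -> bounded_op T -> bounded_op (S \o T).
Proof.
move=> [Sl Sc] [Tl Tc]; split; first exact: linear_comp.
by move=> u; apply: continuous_comp; [exact: Tc|exact: Sc].
Qed.

Lemma bounded_op_lin c S T : bounded_op S -> bounded_op T -> bounded_op (c *: S + T).
Proof.
move=> [Sl Sc] [Tl Tc]; split.
  move=> k u v; rewrite !fctE Sl Tl !scalerDr !scalerA [c * k]mulrC addrACA.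
  by rewrite -scalerA.
by move=> u; apply: cvgD; [apply: cvgZr; exact: Sc|exact: Tc].
Qed.

Record star_algebra_of_operators (A : set (H -> H)) : Prop := {
  soa_bounded : forall S, A S -> bounded_op S ;
  soa_id : A id ;
  soa_linear : forall (c : R[i]) S T, A S -> A T -> A (c *: S + T) ;
  soa_comp : forall S T, A S -> A T -> A (S \o T) ;
  soa_adjoint : forall S, A S -> exists2 S', A S' &
    forall u v, inner (S u) v = inner u (S' v)
}.

Variables (A : set (H -> H)) (T : H -> H).
Hypotheses (A_alg : star_algebra_of_operators A) (AT : bicommutant A T).

Let Tb : bounded_op T. Proof. by case: AT. Qed.

(** Let P be the projection onto the closed orbit of x under the amplified
    algebra. It commutes with the amplified algebra, so that its matrix entries
    commute with A, and hence with T. Therefore P commutes with the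
    amplification of T, which then maps x into the closed orbit. *)
Lemma bicommutant_density x (e : R) : 0 < e ->
  exists2 S, A S & nrm (amplify T x - amplify S x) < e.
Proof.
move=> e0; have [Ab A1 AL AM AS] := A_alg.
pose M0 := [set amplify S x | S in A]; pose M := closure M0.
have bnd S : bounded_op S -> exists C : R,
    [/\ 0 <= C, forall v, nrm (S v) <= C * nrm v &
        forall z, nrm (amplify S z) <= C * nrm z].
  move=> Sb; have [_ [C C0 SC]] := (iffLR (bounded_opP S) Sb).
  by exists C; split=> // z; exact: amplify_bound.
have M0sub : submodule M0.
  split.
    exists ((-1) *: id + id); first exact: AL.
    apply: ell2_ext => k; rewrite -!/(coord _ _) coord_amplify; last by apply: bounded_op_lin; exact: Ab.
    by rewrite coord0 -[LHS]/(-1 *: coord x k + coord x k) scaleN1r addNr.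
  move=> c _ _ [S AS1 <-] [S' AS2 <-]; exists (c *: S + S'); first exact: AL.
  by apply: ell2_ext => k; rewrite -!/(coord _ _) coord_lin !coord_amplify//; [exact: Ab|exact: Ab|exact/Ab/AL].
have Msub : submodule M.
  split; first by apply: subset_closure; case: M0sub.
  move=> c y z /closure_nrmP yM /closure_nrmP zM; apply/closure_nrmP => d d0.
  have c0 : 0 < nrm (c : R[i]^o) + 1 by rewrite ltr_wpDl ?nrm_ge0.
  have [|y' My' yy'] := yM (d / 2 / (nrm (c : R[i]^o) + 1)).
    by rewrite !divr_gt0.
  have [|z' Mz' zz'] := zM (d / 2); first by rewrite divr_gt0.
  exists (c *: y' + z'); first by case: M0sub => _; apply.
  rewrite opprD addrACA -scalerBr (le_lt_trans (nrmD _ _))// nrmZ.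
  move: yy' zz'; rewrite ltr_pdivlMr//.
  by have := nrm_ge0 (y - y'); move: (nrm (c : R[i]^o)) (nrm (y - y')) => p q; nra.
have Minv S : A S -> forall y, M y -> M (amplify S y).
  move=> AS1 y /closure_nrmP yM; apply/closure_nrmP => d d0.
  have [C [C0 _ SC]] := bnd S (Ab _ AS1).
  have C1 : 0 < C + 1 by rewrite ltr_wpDl.
  have [|_ [S' AS' <-] yy'] := yM (d / (C + 1)); first by rewrite divr_gt0.
  exists (amplify (S \o S') x); first by exists (S \o S') => //; exact: AM.
  have -> : amplify (S \o S') x = amplify S (amplify S' x).
    by apply: ell2_ext => k; rewrite -!/(coord _ _) !coord_amplify//; [exact: Ab|exact: Ab|exact/Ab/AM].
  rewrite -(linB (amplify_linear (Ab _ AS1))); apply: le_lt_trans (SC _) _.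
  move: yy'; rewrite ltr_pdivlMr//; apply: le_lt_trans.
  by rewrite mulrC ler_wpM2l ?nrm_ge0// lerDl.
have [P [PL Pn PM Puniq]] := projection_operator Msub (@closed_closure _ M0).
have Pfix y : M y -> P y = y.
  by move=> My; apply: Puniq => // z _; rewrite subrr inner0l.
have Portho y z : M z -> inner (y - P y) z = 0.
  have [p Mp pP] := orthogonal_projection Msub (@closed_closure _ M0) y.
  by rewrite (Puniq _ _ Mp pP); exact: pP.
have PA S : A S -> forall y, P (amplify S y) = amplify S (P y).
  move=> AS1 y; apply: Puniq; first exact: Minv.
  move=> z Mz; have [S' AS' SS'] := AS _ AS1.
  rewrite -(linB (amplify_linear (Ab _ AS1))).
  rewrite (amplify_adjoint _ _ (Ab _ AS1) (Ab _ AS') SS').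
  by apply: Portho; exact: Minv.
pose Q i j (v : H) : H := coord (P (ell2_single j v)) i.
have single_lin j : linear (ell2_single j : H -> ell2 H).
  move=> c u v; apply: ell2_ext => k; rewrite -!/(coord _ _) coord_lin !coord_single.
  by case: ifP => // _; rewrite scaler0 addr0.
have single_nrm j v : nrm (ell2_single j v) <= nrm v.
  apply: ell2_nrm_le => [|N]; first exact: nrm_ge0.
  have -> : \sum_(0 <= k < N) nrm (coord (ell2_single j v) k) ^+ 2 =
      \sum_(0 <= k < N) if k == j then nrm v ^+ 2 else 0.
    apply: eq_bigr => k _; rewrite coord_single; case: ifP => // _.
    by rewrite nrm0 expr0n.
  by rewrite -big_mkcond/= big_nat1_eq; case: ifP => // _; exact: sqr_ge0.
have QA i j : commutant A (Q i j).
  split=> [|S AS1]; last first.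
    apply/funext => v; rewrite /Q /= -(amplify_single (Ab _ AS1)) PA//.
    by rewrite coord_amplify//; exact: Ab.
  apply/bounded_opP; split.
    by move=> c u v; rewrite /Q single_lin PL coord_lin.
  exists 1 => // v; rewrite mul1r.
  by apply: le_trans (nrm_coord_le _ _) (le_trans (Pn _) _).
have TQ i j v : T (Q i j v) = Q i j (T v).
  by have [_ /(_ _ (QA i j))] := AT; move/(congr1 (fun f => f v)).
have [C [C0 _ TC]] := bnd T Tb.
have PT : P \o amplify T = amplify T \o P.
  apply: (@ell2_op_ext _ _ _ _ _ C).
  - by apply: linear_comp => //; exact: amplify_linear.
  - by apply: linear_comp => //; exact: amplify_linear.
  - by move=> y; apply: le_trans (Pn _) (TC _).
  - by move=> y; apply: le_trans (TC _) _; rewrite ler_wpM2l.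
  - move=> j v /=; apply: ell2_ext => i; rewrite -!/(coord _ _).
    by rewrite amplify_single// coord_amplify//; rewrite -[RHS]/(T (Q i j v)) TQ.
have Mx : M x.
  apply: subset_closure; exists id => //.
  by apply: ell2_ext => k; rewrite -!/(coord _ _) coord_amplify//; exact: Ab.
have /closure_nrmP/(_ e e0)[_ [S AS1 <-] TS] : M (amplify T x).
  have := congr1 (fun f => f x) PT; rewrite /= (Pfix x Mx) => <-; exact: PM.
by exists S.
Qed.

(** Approximation at x and at y simultaneously is approximation at a single
    sequence that contains both. *)
Definition interleave x y : ell2 H := ell2_make (the_ell2 H)
  (fun k => if odd k then coord y k./2 else coord x k./2).

Lemma sum_interleave (f g : nat -> R) N :
  \sum_(0 <= k < N.*2) (if odd k then g k./2 else f k./2) =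
  \sum_(0 <= k < N) (f k + g k).
Proof.
elim: N => [|N IH]; first by rewrite !big_nil.
rewrite doubleS !big_nat_recr//= IH odd_double /= doubleK uphalf_double.
by rewrite addrA.
Qed.

Lemma interleaveE x y k :
  coord (interleave x y) k = if odd k then coord y k./2 else coord x k./2.
Proof.
rewrite /coord ell2_makeE//; apply/square_summableP.
exists (nrm x ^+ 2 + nrm y ^+ 2) => N.
apply: le_trans (lerD (ell2_partial_le x N) (ell2_partial_le y N)).
rewrite -big_split /= -sum_interleave.
rewrite [leRHS](@big_cat_nat _ _ _ N)//= -?addnn ?leq_addr// -[leLHS]addr0.
apply: lerD; last by rewrite sumr_ge0// => j _; case: ifP => _; exact: sqr_ge0.
by rewrite le_eqVlt; apply/orP; left; apply/eqP; apply: eq_bigr => j _; case: ifP.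
Qed.

Lemma nrm_interleave x y :
  nrm x <= nrm (interleave x y) /\ nrm y <= nrm (interleave x y).
Proof.
have key N : \sum_(0 <= k < N) nrm (coord x k) ^+ 2 + \sum_(0 <= k < N) nrm (coord y k) ^+ 2
    <= nrm (interleave x y) ^+ 2.
  apply: le_trans (ell2_partial_le _ N.*2).
  rewrite -big_split /= -sum_interleave le_eqVlt; apply/orP; left; apply/eqP.
  by apply: eq_bigr => j _; rewrite -/(coord _ _) interleaveE; case: ifP.
split; apply: ell2_nrm_le => [|N]; rewrite ?nrm_ge0//; apply: le_trans (key N).
- by rewrite lerDl sumr_ge0// => j _; exact: sqr_ge0.
- by rewrite lerDr sumr_ge0// => j _; exact: sqr_ge0.
Qed.

(** The filter is generated by the sets of all S in A that are close to T at a
    given element of ell2. These sets are nonempty by density and directed by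
    interleaving; Cauchy-Schwarz gives the ultraweak convergence. *)
Lemma bicommutant_ultraweak_limit :
  exists F : set_system (H -> H), [/\ ProperFilter F, F A & ultraweak_cvg F T].
Proof.
have [Ab A1 AL AM AS] := A_alg.
pose B (p : ell2 H * R) := [set S | A S /\ nrm (amplify T p.1 - amplify S p.1) < p.2].
pose F := filter_from [set p : ell2 H * R | 0 < p.2] B.
have FF : Filter F.
  apply: filter_from_filter; first by exists (0, 1); exact: ltr01.
  move=> [x d] [y e] /= d0 e0; exists (interleave x y, Num.min d e).
    by rewrite /= lt_min d0.
  move=> S [/= AS1]; rewrite lt_min => /andP[Sd Se].
  have E : amplify T (interleave x y) - amplify S (interleave x y) =
      interleave (amplify T x - amplify S x) (amplify T y - amplify S y).
    apply: ell2_ext => k; rewrite -!/(coord _ _) coordB !interleaveE !coord_amplify//; last exact: Ab.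
    by rewrite !interleaveE; case: ifP => _; rewrite coordB !coord_amplify//; exact: Ab.
  move: Sd Se; rewrite E.
  have [h1 h2] := nrm_interleave (amplify T x - amplify S x) (amplify T y - amplify S y).
  by move=> Sd Se; split; split=> //=; [exact: le_lt_trans Sd|exact: le_lt_trans Se].
exists F; split.
- apply: filter_from_proper => -[x e] /= e0.
  by have [S AS1 h] := bicommutant_density x e0; exists S.
- by exists (0, 1) => [|S []//]; exact: ltr01.
- move=> x y xs ys; have [X Xx] := ell2_of_summable xs; have [Y Yy] := ell2_of_summable ys.
  apply/cvgrPdist_lt => e e0.
  have eE : e = (complex.Re e)%:C by rewrite RRe_real// gtr0_real.
  have e1 : 0 < complex.Re e by rewrite -ltcR -eE.
  have Y1 : 0 < nrm Y + 1 by rewrite ltr_wpDl ?nrm_ge0.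
  exists (X, complex.Re e / (nrm Y + 1)) => /=; first by rewrite divr_gt0.
  move=> S [/= AS1]; rewrite ltr_pdivlMr// => h.
  have -> : ultraweak_functional x y T = inner (amplify T X) Y.
    by rewrite -(ultraweak_amplify Tb) Xx Yy.
  have -> : ultraweak_functional x y S = inner (amplify S X) Y.
    by rewrite -(ultraweak_amplify (Ab _ AS1)) Xx Yy.
  rewrite (nrmE (_ : R[i]^o)) eE ltcR -innerBl.
  apply: le_lt_trans (inner_cauchy_schwarz _ _) (le_lt_trans _ h).
  by rewrite ler_wpM2l ?nrm_ge0// lerDl.
Qed.

End Bicommutant.

(** * Ultraweak functionals and normal maps *)

Section Ultraweak.
Variables (R : realType) (H : hilbertType R).
Implicit Types (S T : H -> H) (X Y Z : ell2 H).

(** A series of finite sums of vector functionals is a single ultraweak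
    functional: concatenate the finite lists of pairs. Boundedness of the
    partial sums of squares at the ends of the blocks makes the whole series
    absolutely convergent, so that its limit can be computed along the ends of
    the blocks. *)
Lemma ultraweak_of_blocks (B : nat -> seq (H * H)) (C : R) :
  (forall N, \sum_(0 <= k < N) \sum_(p <- B k) nrm p.1 ^+ 2 <= C) ->
  (forall N, \sum_(0 <= k < N) \sum_(p <- B k) nrm p.2 ^+ 2 <= C) ->
  exists u v : nat -> H, [/\ square_summable u, square_summable v &
    forall S, bounded_op S ->
      (fun N => \sum_(0 <= k < N) \sum_(p <- B k) inner (S p.1) p.2 : R[i]^o)
        @ \oo --> ultraweak_functional u v S].
Proof.
move=> B1 B2.
(* The zero pair in front of each block makes all blocks nonempty, so that the
   first N blocks contain at least N pairs. *)
pose L N := flatten [seq (0, 0) :: B k | k <- iota 0 N].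
have LS N : L N.+1 = L N ++ (0, 0) :: B N.
  by rewrite /L -addn1 iotaD map_cat flatten_cat /= cats0.
have sizeL N : (N <= size (L N))%N.
  by elim: N => // N IH; rewrite LS size_cat /= addnS ltnS (leq_trans IH)// leq_addr.
have nthL N d i : (i < size (L N))%N -> nth (0, 0) (L (N + d)%N) i = nth (0, 0) (L N) i.
  move=> iN; elim: d => [|d IH]; first by rewrite addn0.
  rewrite addnS LS nth_cat IH ifT//; apply: leq_trans iN _.
  elim: d {IH} => [|d IH]; first by rewrite addn0.
  by rewrite addnS LS size_cat (leq_trans IH)// leq_addr.
pose w i := nth (0, 0) (L i.+1) i.
have wL N i : (i < size (L N))%N -> w i = nth (0, 0) (L N) i.
  move=> iN; rewrite /w.
  have h1 : (i < size (L i.+1))%N by exact: sizeL.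
  by rewrite -(nthL _ N _ h1) -(nthL _ i.+1 _ iN) addnC.
have sumL (V : zmodType) (f : H * H -> V) N : f (0, 0) = 0 ->
    \sum_(0 <= i < size (L N)) f (w i) = \sum_(0 <= k < N) \sum_(p <- B k) f p.
  move=> f0.
  have -> : \sum_(0 <= i < size (L N)) f (w i) = \sum_(p <- L N) f p.
    rewrite [RHS](big_nth (0, 0)) !big_nat; apply: eq_bigr => i /andP[_ iN].
    by rewrite (wL N).
  rewrite /L big_flatten big_map /index_iota subn0.
  by apply: eq_bigr => k _; rewrite big_cons f0 Monoid.mul1m.
have summ (f : H * H -> H) : f (0, 0) = 0 ->
    (forall N, \sum_(0 <= k < N) \sum_(p <- B k) nrm (f p) ^+ 2 <= C) ->
    square_summable (fun i => f (w i)).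
  move=> f0 fC; apply/square_summableP; exists C => N.
  apply: le_trans (fC N); rewrite -(sumL _ (fun p => nrm (f p) ^+ 2)); last first.
    by rewrite f0 nrm0 expr0n.
  rewrite (big_cat_nat (leq0n N) (sizeL N))/= lerDl sumr_ge0// => i _.
  exact: sqr_ge0.
exists (fun i => (w i).1), (fun i => (w i).2); split; [exact: summ|exact: summ|].
move=> S Sb; have [SL _] := Sb.
pose u := fun i => (w i).1; pose v := fun i => (w i).2.
have us : square_summable u by exact: summ.
have vs : square_summable v by exact: summ.
have Sus : square_summable (S \o u).
  have [_ [D D0 SD]] := (iffLR (bounded_opP S) Sb).
  have [c uc] := (iffLR (square_summableP u) us).
  apply/square_summableP; exists (D ^+ 2 * c) => N.
  apply: le_trans (ler_wpM2l (sqr_ge0 D) (uc N)).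
  rewrite mulr_sumr; apply: ler_sum => j _.
  by rewrite -exprMn ler_sqr ?nnegrE ?mulr_ge0 ?nrm_ge0//; exact: SD.
have /nrm_cvgP cvS := square_summable_series_cvg Sus vs.
apply/nrm_cvgP => e /cvS[N NP]; exists N => n Nn.
rewrite -(sumL _ (fun p => inner (S p.1) p.2)); last by rewrite inner0r.
exact: NP (leq_trans Nn (sizeL n)).
Qed.

Lemma inner_finite_support X Y s : (forall k, (s <= k)%N -> coord Y k = 0) ->
  inner X Y = \sum_(0 <= k < s) inner (coord X k) (coord Y k).
Proof.
move=> Ys; rewrite ell2_innerE; apply: cvg_lim; first exact: norm_hausdorff.
apply/nrm_cvgP => e e0; exists s => n sn.
rewrite /series/= (big_cat_nat (leq0n s) sn)/= addrAC subrr add0r.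
rewrite big_nat_cond big1 ?nrm0// => k /andP[/andP[sk _] _].
by rewrite -[X in inner _ X]/(coord Y k) Ys// inner0r.
Qed.

(** Truncating y turns the functional into a finite sum of matrix coefficients,
    up to an error that is uniform in n. *)
Lemma wot_cvg_bounded_ultraweak (T_ : nat -> H -> H) T (C : R) : 0 <= C ->
  (forall n, bounded_op (T_ n)) -> bounded_op T ->
  (forall n x, nrm (T_ n x) <= C * nrm x) -> (forall x, nrm (T x) <= C * nrm x) ->
  wot_cvg T_ T -> ultraweak_cvg (T_ @ \oo) T.
Proof.
move=> C0 Tnb Tb TnC TC TT x y xs ys.
have [X Xx] := ell2_of_summable xs; have [Y Yy] := ell2_of_summable ys.
have -> : ultraweak_functional x y T = inner (amplify T X) Y.
  by rewrite -(ultraweak_amplify Tb) Xx Yy.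
suff : (fun n => inner (amplify (T_ n) X) Y : R[i]^o) @ \oo -->
    (inner (amplify T X) Y : R[i]^o).
  apply: cvg_trans; rewrite -fmap_comp.
  have -> // : ultraweak_functional x y \o T_ =
      (fun n => inner (amplify (T_ n) X) Y : R[i]^o).
  by apply/funext => n /=; rewrite -(ultraweak_amplify (Tnb n)) Xx Yy.
apply/nrm_cvgP => e e0.
pose a (z : nat -> H) n k : R[i]^o := inner (coord (amplify (T_ n) X) k) (z k).
pose b (z : nat -> H) k : R[i]^o := inner (coord (amplify T X) k) (z k).
have ab z k : (fun n => a z n k) @ \oo --> b z k.
  have -> : (fun n => a z n k) = (fun n => inner (T_ n (coord X k)) (z k) : R[i]^o).
    by apply/funext => n; rewrite /a (coord_amplify (Tnb n)).
  have -> : b z k = inner (T (coord X k)) (z k) by rewrite /b (coord_amplify Tb).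
  exact: TT.
have c1 : 0 < C * nrm X + 1 by rewrite ltr_wpDl// mulr_ge0 ?nrm_ge0.
have d0 : 0 < e / 4 / (C * nrm X + 1) by rewrite !divr_gt0.
have [s sP] := (iffLR (nrm_cvgP _ _) (@ell2_trunc_cvg _ _ Y)) _ d0.
set Z := \sum_(0 <= j < s) ell2_single j (coord Y j) in sP.
have {sP} YZ : nrm (Z - Y) < e / 4 / (C * nrm X + 1) by exact: sP (leqnn s).
have Zs k : (s <= k)%N -> coord Z k = 0.
  by move=> sk; rewrite coord_trunc ltnNge sk.
have err S : bounded_op S -> (forall x, nrm (S x) <= C * nrm x) ->
    nrm (inner (amplify S X) Y - inner (amplify S X) Z : R[i]^o) < e / 4.
  move=> Sb SC; rewrite -innerBr; apply: le_lt_trans (inner_cauchy_schwarz _ _) _.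
  move: YZ; rewrite ltr_pdivlMr// nrmC; apply: le_lt_trans.
  rewrite mulrC ler_wpM2l ?nrm_ge0//.
  by apply: le_trans (amplify_bound Sb _ C0 SC) _; rewrite lerDl.
have cvZ : (fun n => inner (amplify (T_ n) X) Z : R[i]^o) @ \oo -->
    (inner (amplify T X) Z : R[i]^o).
  rewrite (inner_finite_support _ Zs).
  have -> : (fun n => inner (amplify (T_ n) X) Z : R[i]^o) =
      (fun n => \sum_(0 <= k < s) a (coord Z) n k).
    by apply/funext => n; rewrite (inner_finite_support _ Zs).
  have h := @cvg_finite_sum R R[i]^o (a (coord Z)) (b (coord Z)) s (ab (coord Z)).
  exact: h.
have e4 : 0 < e / 4 by rewrite divr_gt0.
have [N NP] := (iffLR (nrm_cvgP _ _) cvZ) _ e4.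
exists N => n /NP h; have h1 := err _ (Tnb n) (TnC n); have h2 := err _ Tb TC.
have h3 := nrm_triangle (inner (amplify (T_ n) X) Z : R[i]^o)
  (inner (amplify (T_ n) X) Y : R[i]^o) (inner (amplify T X) Y : R[i]^o).
have h4 := nrm_triangle (inner (amplify T X) Z : R[i]^o)
  (inner (amplify (T_ n) X) Z : R[i]^o) (inner (amplify T X) Y : R[i]^o).
move: h h1 h2 h3 h4; rewrite [nrm (inner (amplify T X) Y - _ : R[i]^o)]nrmC.
by clear TT xs ys Xx Yy; lra.
Qed.

(** The map E is known only through its matrix coefficients on an increasing
    family of subspaces P m with dense union, where it is a compression by the
    contraction A m. *)
Section NormalMaps.
Variables (M : set (H -> H)) (E : (H -> H) -> (H -> H)).
Variables (P : nat -> set H) (A : nat -> H -> H).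
Hypotheses (M_bounded : forall T, M T -> bounded_op T)
  (E_bounded : forall T, M T -> bounded_op (E T))
  (P_sub : forall m, submodule (P m))
  (P_mono : forall m, P m `<=` P m.+1)
  (P_dense : closure (\bigcup_m P m) = setT)
  (A_contr : forall m x, nrm (A m x) <= nrm x)
  (EA : forall T m x y, M T -> P m x -> P m y ->
    inner (E T x) y = inner (T (A m x)) (A m y)).

Let P_le m n : (m <= n)%N -> P m `<=` P n.
Proof.
move=> /subnK <-; elim: (n - m)%N => // d IH.
by rewrite addSn; apply: subset_trans IH _; exact: P_mono.
Qed.

Definition finite_past m s X :=
  (forall k, P m (coord X k)) /\ (forall k, (s <= k)%N -> coord X k = 0).

Lemma finite_past_le m n s t X : (m <= n)%N -> (s <= t)%N ->
  finite_past m s X -> finite_past n t X.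
Proof.
move=> mn st [XP Xs]; split=> k; first exact/(P_le mn)/XP.
by move=> tk; apply: Xs; exact: leq_trans tk.
Qed.

Lemma finite_past_lin m s c X Y :
  finite_past m s X -> finite_past m s Y -> finite_past m s (c *: X + Y).
Proof.
move=> [XP Xs] [YP Ys]; split=> k; rewrite coord_lin.
  by have [_] := P_sub m; apply.
by move=> sk; rewrite Xs// Ys// scaler0 addr0.
Qed.

Lemma finite_past0 : finite_past 0 0 0.
Proof. by split=> k; rewrite coord0//; have [] := P_sub 0. Qed.

Lemma finite_past_dense X (e : R) : 0 < e ->
  exists Z, (exists m s, finite_past m s Z) /\ nrm (X - Z) < e.
Proof.
move=> e0; have e2 : 0 < e / 2 by rewrite divr_gt0.
have [N /(_ N (leqnn N)) XN] := (iffLR (nrm_cvgP _ _) (@ell2_trunc_cvg _ _ X)) _ e2.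
suff [Z [[m [s Zms]] ZN]] : exists Z, (exists m s, finite_past m s Z) /\
    nrm (\sum_(0 <= j < N) ell2_single j (coord X j) - Z) < e / 2.
  exists Z; split; first by exists m, s.
  apply: le_lt_trans (nrm_triangle (\sum_(0 <= j < N) ell2_single j (coord X j)) _ _) _.
  by rewrite nrmC [e]splitr ltrD.
elim: N (e / 2) e2 {e0 XN} => [|N IH] d d0.
  exists 0; split; first by exists 0, 0; exact: finite_past0.
  by rewrite big_nil subr0 nrm0.
have d2 : 0 < d / 2 by rewrite divr_gt0.
have [Z [[m [s Zms]] ZN]] := IH _ d2.
have [y [n _ Py] xy] : exists2 y, (\bigcup_m P m) y & nrm (coord X N - y) < d / 2.
  by apply: (iffLR (closure_nrmP _ (coord X N))) d2; rewrite P_dense.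
exists (1 *: ell2_single N y + Z); split.
  exists (maxn m n), (maxn s N.+1); apply: finite_past_lin.
    split=> k; rewrite coord_single.
      case: ifP => _; first exact: P_le (leq_maxr _ _) _ Py.
      by have [] := P_sub (maxn m n).
    by rewrite geq_max => /andP[_ Nk]; case: eqP => // kN; rewrite kN ltnn in Nk.
  exact: finite_past_le (leq_maxl _ _) (leq_maxl _ _) Zms.
rewrite scale1r big_nat_recr//= addrC opprD addrACA.
apply: le_lt_trans (nrmD _ _) _; rewrite [d]splitr ltrD//.
apply: le_lt_trans xy; apply: ell2_nrm_le => [|K]; first exact: nrm_ge0.
have -> : \sum_(0 <= k < K) nrm (coord (ell2_single N (coord X N) - ell2_single N y) k) ^+ 2 =
    \sum_(0 <= k < K) if k == N then nrm (coord X N - y) ^+ 2 else 0.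
  apply: eq_bigr => k _; rewrite coordB !coord_single; case: ifP => // _.
  by rewrite subrr nrm0 expr0n.
by rewrite -big_mkcond/= big_nat1_eq; case: ifP => // _; exact: sqr_ge0.
Qed.

Lemma fast_approximation X : exists Xs : nat -> ell2 H, [/\ Xs 0 = 0,
  forall n, exists m s, finite_past m s (Xs n) &
  forall n, nrm (X - Xs n) <= (nrm X + 1) * 4^-1 ^+ n].
Proof.
have X1 : 0 < nrm X + 1 by rewrite ltr_wpDl ?nrm_ge0.
have ex n : exists Z, (n = 0%N -> Z = 0) /\ (exists m s, finite_past m s Z) /\
    nrm (X - Z) <= (nrm X + 1) * 4^-1 ^+ n.
  case: n => [|n].
    exists 0; split=> //; split; first by exists 0, 0; exact: finite_past0.
    by rewrite subr0 expr0 mulr1 lerDl.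
  have d0 : 0 < (nrm X + 1) * 4^-1 ^+ n.+1 by rewrite mulr_gt0// exprn_gt0// invr_gt0.
  by have [Z [? ?]] := finite_past_dense X d0; exists Z; split=> //; split=> //; exact: ltW.
have [Xs XsP] := choice ex; exists Xs; split.
- by have [->] := XsP 0.
- by move=> n; have [_ []] := XsP n.
- by move=> n; have [_ []] := XsP n.
Qed.

Let sum_geometric N : \sum_(0 <= k < N) 4^-1 ^+ k <= 2 :> R.
Proof.
suff : \sum_(0 <= k < N) 4^-1 ^+ k <= 2 - 2 * 4^-1 ^+ N :> R.
  have : 0 <= 4^-1 ^+ N :> R by rewrite exprn_ge0 ?invr_ge0.
  by move: (\sum_(_ <= _ < _) _) (4^-1 ^+ N) => a b; lra.
elim: N => [|N IH]; first by rewrite big_nil expr0 mulr1 subrr.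
rewrite big_nat_recr//= exprS.
have : 0 <= 4^-1 ^+ N :> R by rewrite exprn_ge0 ?invr_ge0.
by move: IH; move: (\sum_(_ <= _ < _) _) (4^-1 ^+ N) => a b; lra.
Qed.

Lemma inner_amplify_past T m s X Y : M T -> finite_past m s X ->
  finite_past m s Y ->
  inner (amplify (E T) X) Y =
  \sum_(0 <= k < s) inner (T (A m (coord X k))) (A m (coord Y k)).
Proof.
move=> MT [XP _] [YP Ys]; rewrite (inner_finite_support _ Ys).
apply: eq_bigr => k _; rewrite (coord_amplify (E_bounded MT)).
exact: EA.
Qed.

Let block_sum_le (D : ell2 H) (a : R) m s : 0 <= a ->
  \sum_(0 <= i < s) nrm (a%:C *: A m (coord D i)) ^+ 2 <= a ^+ 2 * nrm D ^+ 2.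
Proof.
move=> a0; apply: le_trans (ler_wpM2l (sqr_ge0 a) (ell2_partial_le D s)).
rewrite mulr_sumr; apply: ler_sum => i _.
by rewrite -exprMn nrmZR (ger0_norm a0) ler_sqr ?nnegrE ?mulr_ge0 ?nrm_ge0// ler_wpM2l.
Qed.

Let double_scaling T (a b : R) x y : M T -> a * b = 1 ->
  inner (T (a%:C *: x)) (b%:C *: y) = inner (T x) y.
Proof.
move=> MT ab; have [TL _] := M_bounded MT.
by rewrite (linZ TL) innerZl innerZr conj_real mulrA -rmorphM ab mul1r.
Qed.

(** Approximate x and y in ell2, at the rate 4^-n, by finitely supported X_n and
    Y_n with entries in some P m. The numbers <E(T) X_n, Y_n> converge to the
    value of the functional at E T. Each of their successive differences is a
    finite sum of matrix coefficients of T, and these finite sums are assembled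
    by ultraweak_of_blocks. *)
Lemma ultraweak_preimage x y : square_summable x -> square_summable y ->
  exists u v : nat -> H, [/\ square_summable u, square_summable v &
    forall T, M T -> ultraweak_functional x y (E T) = ultraweak_functional u v T].
Proof.
move=> xs ys.
have [X Xx] := ell2_of_summable xs; have [Y Yy] := ell2_of_summable ys.
have [Xs [Xs0 XsP XsC]] := fast_approximation X.
have [Ys [Ys0 YsP YsC]] := fast_approximation Y.
have ms_ex n : exists ms : nat * nat, [/\ finite_past ms.1 ms.2 (Xs n),
    finite_past ms.1 ms.2 (Xs n.+1), finite_past ms.1 ms.2 (Ys n) &
    finite_past ms.1 ms.2 (Ys n.+1)].
  have [m1 [s1 P1]] := XsP n; have [m2 [s2 P2]] := XsP n.+1.
  have [m3 [s3 P3]] := YsP n; have [m4 [s4 P4]] := YsP n.+1.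
  exists (m1 + m2 + (m3 + m4), s1 + s2 + (s3 + s4))%N => /=; split.
  - by apply: finite_past_le P1; rewrite -addnA leq_addr.
  - by apply: finite_past_le P2; rewrite addnAC leq_addl.
  - by apply: finite_past_le P3; rewrite addnCA leq_addr.
  - by apply: finite_past_le P4; rewrite addnA leq_addl.
have [ms msP] := choice ms_ex.
pose D (Zs : nat -> ell2 H) n := Zs n.+1 - Zs n.
pose blk (a b : R) n (U V : ell2 H) : seq (H * H) :=
  [seq (a%:C *: A (ms n).1 (coord U i), b%:C *: A (ms n).1 (coord V i)) |
    i <- index_iota 0 (ms n).2].
(* The increments have norm of order 4^-n and the approximants are only
   bounded. The factors 2^n and 2^-n leave the matrix coefficients unchanged
   and give both members of a pair a square-summable size. *)
pose B n := blk (2 ^+ n) (2^-1 ^+ n) n (D Xs n) (Ys n.+1) ++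
            blk (2^-1 ^+ n) (2 ^+ n) n (Xs n) (D Ys n).
have blk1 a b n U V : 0 <= a ->
    \sum_(p <- blk a b n U V) nrm p.1 ^+ 2 <= a ^+ 2 * nrm U ^+ 2.
  by move=> a0; rewrite big_map /=; exact: block_sum_le.
have blk2 a b n U V : 0 <= b ->
    \sum_(p <- blk a b n U V) nrm p.2 ^+ 2 <= b ^+ 2 * nrm V ^+ 2.
  by move=> b0; rewrite big_map /=; exact: block_sum_le.
have q2 n : 0 <= 2 ^+ n :> R by rewrite exprn_ge0.
have r2 n : 0 <= 2^-1 ^+ n :> R by rewrite exprn_ge0 ?invr_ge0.
have est Z Zs n : (forall n, nrm (Z - Zs n) <= (nrm Z + 1) * 4^-1 ^+ n) ->
    (2 ^+ n) ^+ 2 * nrm (D Zs n) ^+ 2 <= 4 * (nrm Z + 1) ^+ 2 * 4^-1 ^+ n /\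
    (forall m, (2^-1 ^+ n) ^+ 2 * nrm (Zs m) ^+ 2 <= 4 * (nrm Z + 1) ^+ 2 * 4^-1 ^+ n).
  move=> ZC; have Z0 := nrm_ge0 Z.
  have f0 k : 0 <= 4^-1 ^+ k :> R by rewrite exprn_ge0 ?invr_ge0.
  have f1 k : 4^-1 ^+ k <= 1 :> R by rewrite exprn_ile1 ?invr_ge0// invf_le1 ?ler1n.
  have E2 : (2 ^+ n) ^+ 2 * 4^-1 ^+ n = 1 :> R.
    by rewrite exprAC -natrX -exprMn mulfV ?expr1n// pnatr_eq0.
  have E3 : (2^-1 ^+ n) ^+ 2 = 4^-1 ^+ n :> R.
    by rewrite exprAC exprVn -natrX.
  split=> [|m].
    have h : nrm (D Zs n) <= 2 * (nrm Z + 1) * 4^-1 ^+ n.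
      apply: le_trans (nrm_triangle Z _ _) _.
      have := ZC n; have := ZC n.+1; rewrite [nrm (Zs n.+1 - Z)]nrmC exprS.
      have := f0 n; move: (nrm Z) Z0 (4^-1 ^+ n) => z z0 f f00; nra.
    have h2 : nrm (D Zs n) ^+ 2 <= (2 * (nrm Z + 1) * 4^-1 ^+ n) ^+ 2.
      by rewrite ler_sqr ?nnegrE ?nrm_ge0//; apply: le_trans h; exact: nrm_ge0.
    apply: le_trans (ler_wpM2l (sqr_ge0 _) h2) _.
    rewrite le_eqVlt; apply/orP; left; apply/eqP.
    rewrite exprMn [(2 * _) ^+ 2]exprMn [(4^-1 ^+ n) ^+ 2]expr2.
    transitivity ((2 ^+ n) ^+ 2 * 4^-1 ^+ n * (2 ^+ 2 * (nrm Z + 1) ^+ 2 * 4^-1 ^+ n)).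
      ring.
    by rewrite E2 mul1r -natrX.
  rewrite E3 mulrC ler_wpM2r//.
  have h : nrm (Zs m) <= 2 * (nrm Z + 1).
    have := nrm_dist (Zs m) Z; rewrite ler_norml => /andP[_].
    rewrite [nrm (_ - Z)]nrmC; have := ZC m; have := f1 m; have := f0 m.
    move: (nrm Z) Z0 (4^-1 ^+ m) => z z0 f f00; nra.
  have -> : 4 * (nrm Z + 1) ^+ 2 = (2 * (nrm Z + 1)) ^+ 2 by rewrite exprMn -natrX.
  by rewrite ler_sqr ?nnegrE ?nrm_ge0//; apply: le_trans h; exact: nrm_ge0.
pose K := 2 * (4 * (nrm X + 1) ^+ 2) + 2 * (4 * (nrm Y + 1) ^+ 2).
have [KX KY] : 0 <= 4 * (nrm X + 1) ^+ 2 /\ 0 <= 4 * (nrm Y + 1) ^+ 2.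
  by split; rewrite mulr_ge0// sqr_ge0.
have total (f : nat -> R) : (forall n, f n <= K * 4^-1 ^+ n) ->
    forall N, \sum_(0 <= n < N) f n <= K * 2.
  move=> fK N; apply: le_trans (ler_sum _ (fun n _ => fK n)) _.
  rewrite -mulr_sumr ler_wpM2l// /K.
  by rewrite addr_ge0// mulr_ge0.
have f0 n : 0 <= 4^-1 ^+ n :> R by rewrite exprn_ge0 ?invr_ge0.
have K_le a b n : a <= 4 * (nrm X + 1) ^+ 2 * 4^-1 ^+ n ->
    b <= 4 * (nrm X + 1) ^+ 2 * 4^-1 ^+ n -> a + b <= K * 4^-1 ^+ n.
  rewrite /K; have := mulr_ge0 KY (f0 n).
  move: (4 * _) (4 * _) (4^-1 ^+ n) => p r f h ha hb; nra.
have K_le' a b n : a <= 4 * (nrm Y + 1) ^+ 2 * 4^-1 ^+ n ->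
    b <= 4 * (nrm Y + 1) ^+ 2 * 4^-1 ^+ n -> a + b <= K * 4^-1 ^+ n.
  rewrite /K; have := mulr_ge0 KX (f0 n).
  move: (4 * _) (4 * _) (4^-1 ^+ n) => p r f h ha hb; nra.
have B1 n : \sum_(p <- B n) nrm p.1 ^+ 2 <= K * 4^-1 ^+ n.
  have [h1 h2] := est X Xs n XsC; rewrite big_cat /=; apply: K_le.
    exact: le_trans (blk1 _ _ _ _ _ (q2 n)) h1.
  exact: le_trans (blk1 _ _ _ _ _ (r2 n)) (h2 n).
have B2 n : \sum_(p <- B n) nrm p.2 ^+ 2 <= K * 4^-1 ^+ n.
  have [h1 h2] := est Y Ys n YsC; rewrite big_cat /=; apply: K_le'.
    exact: le_trans (blk2 _ _ _ _ _ (r2 n)) (h2 n.+1).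
  exact: le_trans (blk2 _ _ _ _ _ (q2 n)) h1.
have [u [v [us vs uv]]] := ultraweak_of_blocks (total _ B1) (total _ B2).
exists u, v; split=> // T MT.
have ETb := E_bounded MT.
have [_ [C C0 EC]] := (iffLR (bounded_opP _) ETb).
have aL := amplify_linear ETb.
pose q n : R[i]^o := inner (amplify (E T) (Xs n)) (Ys n).
have D_past Zs n m s : finite_past m s (Zs n) -> finite_past m s (Zs n.+1) ->
    finite_past m s (D Zs n).
  by rewrite /D addrC -scaleN1r; exact: finite_past_lin.
have blkE a b n U V : a * b = 1 -> finite_past (ms n).1 (ms n).2 U ->
    finite_past (ms n).1 (ms n).2 V ->
    \sum_(p <- blk a b n U V) inner (T p.1) p.2 = inner (amplify (E T) U) V.
  move=> ab PU PV; rewrite big_map (inner_amplify_past MT PU PV) /=.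
  by apply: eq_bigr => i _; exact: double_scaling.
have BE n : \sum_(p <- B n) inner (T p.1) p.2 = q n.+1 - q n.
  have [P1 P2 P3 P4] := msP n.
  have qr : 2 ^+ n * 2^-1 ^+ n = 1 :> R by rewrite -exprMn mulfV ?expr1n.
  rewrite big_cat /= !blkE//; [|by rewrite mulrC|exact: D_past|exact: D_past].
  rewrite /D (linB aL) innerBl innerBr /q.
  by rewrite addrA subrK.
have Zcvg Z Zs : (forall n, nrm (Z - Zs n) <= (nrm Z + 1) * 4^-1 ^+ n) -> Zs @ \oo --> Z.
  move=> ZC; have g0 : (fun n => geometric (nrm Z + 1) 4^-1 n) @ \oo --> (0 : R).
    by apply: cvg_geometric; rewrite ger0_norm ?invr_ge0// invf_lt1 ?ltr1n.
  apply/nrm_cvgP => e e0; move/cvgrPdist_lt/(_ _ e0): g0 => [N _ NP].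
  exists N => n /NP; rewrite sub0r normrN nrmC; apply: le_lt_trans.
  by apply: le_trans (ZC n) (ler_norm _).
have qcvg : q @ \oo --> (inner (amplify (E T) X) Y : R[i]^o).
  exact: (inner_op_cvg C0 aL (fun x => amplify_bound ETb x C0 EC) (Zcvg _ _ XsC) (Zcvg _ _ YsC)).
have -> : ultraweak_functional x y (E T) = inner (amplify (E T) X) Y.
  by rewrite -(ultraweak_amplify ETb) Xx Yy.
apply: (nrm_cvg_unique qcvg).
have uvT := uv T (M_bounded MT).
suff <- : (fun N => \sum_(0 <= k < N) \sum_(p <- B k) inner (T p.1) p.2 : R[i]^o) = q.
  exact: uvT.
apply/funext => N.
have q0 : q 0%N = 0 by rewrite /q Ys0 inner0r.
have h := @sum_telescope R[i]^o (fun n => \sum_(p <- B n) inner (T p.1) p.2) q N BE.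
by rewrite [LHS]h q0 subr0.
Qed.

(** By the previous lemma, composing an ultraweak functional with E gives an
    ultraweak functional. *)
Lemma normal_of_dense_compression : normal_map M E.
Proof.
move=> F FF FM T MT FT x y xs ys.
have [u [v [us vs uv]]] := ultraweak_preimage xs ys.
rewrite (uv T MT).
have h := FT u v us vs.
apply: cvg_trans h; rewrite -fmap_comp.
apply: near_eq_cvg; apply: filterS FM => S MS /=.
by rewrite uv.
Qed.

End NormalMaps.

End Ultraweak.

(** * Free products, commutants and operators *)

Section FreeProducts.
Variables (R : realType) (A : cstarType R).

Lemma star_hom_comp (B C D : cstarType R) (F : C -> D) (G : B -> C) :
  star_hom F -> star_hom G -> star_hom (F \o G).
Proof.
move=> [FL FM F1 FS] [GL GM G1 GS]; split=> [|a b||a] /=.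
- exact: linear_comp.
- by rewrite GM FM.
- by rewrite G1 F1.
- by rewrite GS FS.
Qed.

Lemma star_rep_comp (B C : cstarType R) (H : hilbertType R)
    (rho : C -> H -> H) (G : B -> C) :
  star_representation rho -> star_hom G -> star_representation (rho \o G).
Proof.
move=> [rB rL rM r1 rS] [GL GM G1 GS]; split=> [a||a b||a x y] /=.
- exact: rB.
- by move=> c a b /=; rewrite GL rL.
- by rewrite GM rM.
- by rewrite G1 r1.
- by rewrite GS rS.
Qed.

Section Lift.
Variables (I : Type) (P : free_product A I).

Lemma fp_lift_spec (B : cstarType R) (g : I -> A -> B) :
  (forall j, star_hom (g j)) ->
  star_hom (fp_lift (P := P) g) /\
  forall j a, fp_lift (P := P) g (fp_in P j a) = g j a.
Proof.
move=> gh; have [F Fh Fg] := fp_universal P gh.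
exact: (@xgetPex _ (fun=> 0)
  [set F | star_hom F /\ forall j a, F (fp_in P j a) = g j a] (ex_intro _ F (conj Fh Fg))).
Qed.

Lemma fp_endo_hom f : star_hom (fp_endo (P := P) f).
Proof. exact: (fp_lift_spec (fun j => fp_in_hom P (f j))).1. Qed.

Lemma fp_endo_in f j a : fp_endo f (fp_in P j a) = fp_in P (f j) a.
Proof. exact: (fp_lift_spec (fun j => fp_in_hom P (f j))).2. Qed.

Lemma fp_rep_eq (H : hilbertType R) (rho rho' : P -> H -> H) :
  star_representation rho -> star_representation rho' ->
  (forall j a, rho (fp_in P j a) = rho' (fp_in P j a)) -> rho = rho'.
Proof.
move=> rep rep' rr; apply: (rep_eq (fp_generated P)) => // _ [j _ [a _ <-]].
exact: rr.
Qed.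

Lemma fp_dense (B : set P) : star_subalgebra B ->
  (forall j a, B (fp_in P j a)) -> closure B = setT.
Proof.
move=> Bsub BP; apply: (star_subalgebra_dense (fp_generated P) Bsub).
by move=> _ [j _ [a _ <-]].
Qed.

(** Commuting with S is not stable under adjoints, but the generators are: the
    set of all a such that both a and its adjoint commute with S is a closed
    star-subalgebra. *)
Lemma fp_commute (H : hilbertType R) (rho : P -> H -> H) (S : H -> H) :
  star_representation rho -> bounded_op S ->
  (forall j a, rho (fp_in P j a) \o S = S \o rho (fp_in P j a)) ->
  forall a, rho a \o S = S \o rho a.
Proof.
move=> rep Sb Sin; have [rB rL rM r1 rS] := rep.
have [SL [C C0 SC]] := (iffLR (bounded_opP S) Sb).
pose B := [set a | rho a \o S = S \o rho a /\ rho (star a) \o S = S \o rho (star a)].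
have BP j a : B (fp_in P j a).
  by have [_ _ _ hs] := fp_in_hom P j; split; [exact: Sin|rewrite -hs; exact: Sin].
have Bsub : star_subalgebra B.
  split.
  - by rewrite /B /= star_cone r1.
  - move=> k a b [a1 a2] [b1 b2]; rewrite /B /= starD starZ !rL; split.
      apply/funext => x /=; move/(congr1 (fun f => f x)): a1 => /= a1.
      move/(congr1 (fun f => f x)): b1 => /= b1.
      by rewrite !fctE SL -a1 -b1.
    apply/funext => x /=; move/(congr1 (fun f => f x)): a2 => /= a2.
    move/(congr1 (fun f => f x)): b2 => /= b2.
    by rewrite !fctE SL -a2 -b2.
  - move=> a b [a1 a2] [b1 b2]; rewrite /B /= starM !rM; split.
      by rewrite -compA b1 compA a1.
    by rewrite -compA a2 compA b2.
  - by move=> a [a1 a2]; split; rewrite ?starK.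
have BT := fp_dense Bsub BP.
move=> a; apply/funext => x /=; apply/eqP; rewrite -subr_eq0; apply/eqP/nrm0_eq0/eqP.
rewrite eq_le nrm_ge0 andbT; apply/ler_addgt0Pl => e e0; rewrite addr0.
have c0 : 0 < 4 * C * nrm x + 1 by rewrite ltr_wpDl// !mulr_ge0 ?nrm_ge0.
have : closure B a by rewrite BT.
move=> /closure_nrmP/(_ (e / (4 * C * nrm x + 1))) [|b [Bb _]]; first by rewrite divr_gt0.
rewrite ltr_pdivlMr// => h; apply: le_trans (ltW h).
have -> : rho a (S x) - S (rho a x) = rho (a - b) (S x) - S (rho (a - b) x).
  move/(congr1 (fun f => f x)): Bb => /= Bb.
  by rewrite (linB rL) !fctE (linB SL) -Bb opprB addrA subrK.
apply: le_trans (nrmB _ _) _.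
have h1 := rep_bound (a - b) (S x) rep; have h2 := SC (rho (a - b) x).
have h3 := rep_bound (a - b) x rep; have h4 := SC x.
have n0 := nrm_ge0 (a - b); have n1 := nrm_ge0 x.
have h5 : nrm (rho (a - b) (S x)) <= 2 * nrm (a - b) * (C * nrm x).
  by apply: le_trans h1 _; rewrite ler_wpM2l// mulr_ge0.
have h6 : nrm (S (rho (a - b) x)) <= C * (2 * nrm (a - b) * nrm x).
  by apply: le_trans h2 _; rewrite ler_wpM2l.
apply: le_trans (lerD h5 h6) _; rewrite mulrDr mulr1.
by move: (nrm (a - b)) (nrm x) n0 n1 => p q p0 q0; nra.
Qed.

End Lift.

Lemma fp_incl_hom (PN : free_product A nat) (PZ : free_product A int) :
  star_hom (@fp_incl _ _ PN PZ).
Proof. exact: (fp_lift_spec PN (fun j : nat => fp_in_hom PZ j%:Z)).1. Qed.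

Lemma fp_incl_in (PN : free_product A nat) (PZ : free_product A int) j a :
  fp_incl PZ (fp_in PN j a) = fp_in PZ j%:Z a.
Proof. exact: (fp_lift_spec PN (fun j : nat => fp_in_hom PZ j%:Z)).2. Qed.

End FreeProducts.

Section OperatorLemmas.
Variables (R : realType) (H : hilbertType R).
Implicit Types (S T V : H -> H) (x y : H).

(** Polarization with the scalars 1 and i. *)
Lemma isometry_inner V : linear V -> (forall x, nrm (V x) = nrm x) ->
  forall x y, inner (V x) (V y) = inner x y.
Proof.
move=> VL Vn x y.
have polar c : inner (V x) (V (c *: y)) + Num.conj (inner (V x) (V (c *: y))) =
    inner x (c *: y) + Num.conj (inner x (c *: y)).
  have := inner_nrm (V (x + c *: y)); rewrite Vn -inner_nrm (linD VL).
  rewrite !dnormD !inner_nrm !Vn => /addrI; exact.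
have h1 := polar 1; have h2 := polar 'i%R.
rewrite !scale1r in h1; rewrite !(linZ VL) !innerZr !rmorphM /= !conjCK conjCi in h2.
move: h1 h2; move: (inner (V x) (V y)) (inner x y) => a b h1.
rewrite !mulNr ![- _ + _]addrC -!mulrBr => /(mulfI (neq0Ci _)) h2.
have : a + a = b + b.
  have e (z : R[i]) : z + z = (z + Num.conj z) - (Num.conj z - z).
    by rewrite opprB addrA addrAC addrK addrC.
  by rewrite [LHS]e [RHS]e h1 h2.
move=> ab; have two : (2%:R : R[i]) != 0 by rewrite pnatr_eq0.
by apply: (mulfI two); rewrite !mulr_natl.
Qed.

Lemma isometry_bounded V : linear V -> (forall x, nrm (V x) = nrm x) -> bounded_op V.
Proof.
move=> VL Vn; apply/bounded_opP; split=> //; exists 1 => // x.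
by rewrite Vn mul1r.
Qed.

Lemma bounded_dense_eq S T (D : set H) : bounded_op S -> bounded_op T ->
  closure D = setT -> (forall x, D x -> S x = T x) -> S = T.
Proof.
move=> /bounded_opP[SL [C C0 SC]] /bounded_opP[TL [B B0 TB]] DT ST.
apply/funext => x; apply/eqP; rewrite -subr_eq0; apply/eqP/nrm0_eq0/eqP.
rewrite eq_le nrm_ge0 andbT; apply/ler_addgt0Pl => e e0; rewrite addr0.
have c0 : 0 < C + B + 1 by rewrite ltr_wpDl// addr_ge0.
have : closure D x by rewrite DT.
move=> /closure_nrmP/(_ (e / (C + B + 1))) [|y Dy]; first by rewrite divr_gt0.
rewrite ltr_pdivlMr// => h; apply: le_trans (ltW h).
have -> : S x - T x = S (x - y) - T (x - y).
  by rewrite (linB SL) (linB TL) (ST y Dy) opprB addrA subrK.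
apply: le_trans (nrmB _ _) _.
have := SC (x - y); have := TB (x - y); have := nrm_ge0 (x - y).
by clear DT; move: (nrm (x - y)) => p; nra.
Qed.

Lemma weak_dense_eq S T (D : set H) : bounded_op S -> bounded_op T ->
  closure D = setT -> (forall x y, D x -> D y -> inner (S x) y = inner (T x) y) ->
  S = T.
Proof.
move=> Sb Tb DT ST; apply: (bounded_dense_eq Sb Tb DT) => x Dx.
apply/eqP; rewrite -subr_eq0; apply/eqP/nrm0_eq0/eqP.
rewrite eq_le nrm_ge0 andbT; apply/ler_addgt0Pl => e e0; rewrite addr0.
set w := S x - T x.
have : closure D w by rewrite DT.
move=> /closure_nrmP/(_ e e0)[y Dy wy].
have [->|w0] := eqVneq (nrm w) 0; first exact: ltW.
have wp : 0 < nrm w by rewrite lt_def w0 nrm_ge0.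
have : nrm (inner w (w - y) : R[i]^o) <= nrm w * nrm (w - y).
  exact: inner_cauchy_schwarz.
have -> : inner w (w - y) = inner w w.
  have wy0 : inner w y = 0 by rewrite /w innerBl (ST x y Dx Dy) subrr.
  by rewrite innerBr wy0 subr0.
rewrite inner_nrm nrm_real ger0_norm ?sqr_ge0// expr2 ler_pM2l// => h.
exact: le_trans h (ltW wy).
Qed.

(** The coefficient <S z, y> is of the form <z, w>, where w is the image of y
    under the adjoint of S. *)
Lemma wot_cvg_compl (T_ : nat -> H -> H) T S : bounded_op S ->
  wot_cvg T_ T -> wot_cvg (fun n => S \o T_ n) (S \o T).
Proof.
move=> /bounded_opP[SL [C C0 SC]] TT x y.
have [||w wP] := @riesz _ _ (fun z => inner (S z) y) (C * nrm y).
- by move=> c u v; rewrite SL innerDl innerZl.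
- move=> z; apply: le_trans (inner_cauchy_schwarz _ _) _.
  by rewrite mulrAC ler_wpM2r ?nrm_ge0.
rewrite /= wP; have -> : (fun n => inner (S (T_ n x)) y : R[i]^o) =
    (fun n => inner (T_ n x) w : R[i]^o) by apply/funext => n; exact: wP.
exact: TT.
Qed.

Lemma commutant_bounded (M : set (H -> H)) T : commutant M T -> bounded_op T.
Proof. by case. Qed.

Lemma commutantS (M N : set (H -> H)) : M `<=` N -> commutant N `<=` commutant M.
Proof. by move=> MN T [Tb TN]; split=> // S /MN; exact: TN. Qed.

Lemma commutant_lin (M : set (H -> H)) c S T : (forall Q, M Q -> linear Q) ->
  commutant M S -> commutant M T -> commutant M (c *: S + T).
Proof.
move=> ML [Sb SM] [Tb TM]; split; first exact: bounded_op_lin.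
move=> Q MQ; apply/funext => x /=.
move/(congr1 (fun f => f x)): (SM Q MQ) => /= h1.
move/(congr1 (fun f => f x)): (TM Q MQ) => /= h2.
by rewrite (ML Q MQ) !fctE h1 h2.
Qed.

Lemma commutant_comp (M : set (H -> H)) S T :
  commutant M S -> commutant M T -> commutant M (S \o T).
Proof.
move=> [Sb SM] [Tb TM]; split; first exact: bounded_op_comp.
by move=> Q MQ; rewrite -compA TM// compA SM.
Qed.

Lemma bicommutant_sub (M : set (H -> H)) :
  (forall T, M T -> bounded_op T) -> M `<=` bicommutant M.
Proof. by move=> Mb T MT; split; [exact: Mb|move=> S [_ SM]; rewrite SM]. Qed.

Lemma ultraweak_separates S T : bounded_op S -> bounded_op T ->
  (forall s t : nat -> H, square_summable s -> square_summable t ->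
     ultraweak_functional s t S = ultraweak_functional s t T) -> S = T.
Proof.
move=> Sb Tb ST; apply/funext => u; apply: inner_eqP => v.
have single Q : bounded_op Q -> inner (Q u) v =
    ultraweak_functional (coord (ell2_single 0 u)) (coord (ell2_single 0 v)) Q.
  move=> Qb; rewrite (ultraweak_amplify Qb) (amplify_single Qb).
  rewrite (@inner_finite_support _ _ _ _ 1) => [|k k0]; last first.
    by rewrite coord_single; case: k k0.
  by rewrite big_nat1 !coord_single.
by rewrite !single// ST//; exact: ell2_summable.
Qed.

End OperatorLemmas.

(** * Maps of the index sets *)

Definition shift_by (k j : int) : int := j + k.

Definition extend_by_id (f : nat -> nat) (j : int) : int :=
  if j is Posz n then Posz (f n) else j.

(** The map that extend_by_id f induces on the indices >= -k once these are
    shifted to start at 0. *)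
Definition delay (k : nat) (f : nat -> nat) (n : nat) : nat :=
  if (n < k)%N then n else (f (n - k) + k)%N.

Lemma extend_by_id_neg f j : j < 0 -> extend_by_id f j = j.
Proof. by case: j. Qed.

Lemma cofinite_increasing_delay k h :
  cofinite_increasing h -> cofinite_increasing (delay k h).
Proof.
move=> [hmono hfin]; split=> [m n mn|].
  rewrite /delay; case: (ltnP m k) => mk; case: (ltnP n k) => nk //.
  - exact: leq_trans mk (leq_addl _ _).
  - by have := ltn_trans mn nk; rewrite ltnNge mk.
  - by rewrite ltn_add2r hmono// ltn_sub2r// (leq_ltn_trans mk mn).
apply: sub_finite_set (finite_image (fun n => (n + k)%N) hfin) => m mP.
have km : (k <= m)%N.
  rewrite leqNgt; apply/negP => mk; apply: mP; exists m => //.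
  by rewrite /delay mk.
exists (m - k)%N; last by rewrite subnK.
move=> [n _ hn]; apply: mP; exists (n + k)%N => //.
by rewrite /delay ltnNge leq_addl/= addnK hn subnK.
Qed.

Lemma finite_permutation_delay k s :
  finite_permutation s -> finite_permutation (delay k s).
Proof.
move=> [[t st ts] sfin]; split.
  exists (delay k t) => n; rewrite /delay; case: (ltnP n k) => nk; rewrite ?nk//.
    by rewrite ltnNge leq_addl/= addnK st subnK.
  by rewrite ltnNge leq_addl/= addnK ts subnK.
apply: sub_finite_set (finite_image (fun n => (n + k)%N) sfin) => m /= /eqP mP.
have km : (k <= m)%N.
  by rewrite leqNgt; apply/negP => mk; apply: mP; rewrite /delay mk.
exists (m - k)%N; last by rewrite subnK.
apply/eqP => smk; apply: mP.
by rewrite /delay ltnNge km /= smk subnK.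
Qed.

Lemma cofinite_increasing_succ : cofinite_increasing succn.
Proof.
split=> // ; apply: (sub_finite_set _ (finite_set1 0%N)) => n nP.
by case: n nP => // n []; exists n.
Qed.

(** * Isometries that implement index maps *)

Section Dynamics.
Variables (R : realType) (A : cstarType R).
Variables (PN : free_product A nat) (PZ : free_product A int).
Variables (phi : PN -> R[i]) (phiZ : PZ -> R[i]).
Variables (H : hilbertType R) (pi : PZ -> H -> H) (xi : H).
Hypotheses (phi_spreadable : spreadable phi)
  (phiZ_ext : shift_extension phi phiZ) (gns : gns_triple phiZ pi xi).

Local Notation J := (fp_endo (P := PZ)).
Local Notation incl := (@fp_incl R A PN PZ).

Let pi_rep : star_representation pi. Proof. by case: gns. Qed.
Let pi_lin : linear pi. Proof. by case: pi_rep. Qed.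
Let piM a b : pi (cmul a b) = pi a \o pi b. Proof. by case: pi_rep. Qed.
Let pi1 : pi cone = id. Proof. by case: pi_rep. Qed.
Let pi_bounded a : bounded_op (pi a). Proof. by case: pi_rep. Qed.
Let pi_star a x y : inner (pi (star a) x) y = inner x (pi a y).
Proof. by case: pi_rep. Qed.
Let phiZE a : phiZ a = inner (pi a xi) xi. Proof. by case: gns. Qed.

Let pi_star_eq a b : pi a = pi b -> pi (star a) = pi (star b).
Proof.
move=> ab; apply/funext => x; apply: inner_eqP => y.
by rewrite !pi_star ab.
Qed.

(** Morphisms that agree on the generators are compared after pi, which is
    continuous. *)
Lemma pi_endo_comp g f x : pi (J g (J f x)) = pi (J (g \o f) x).
Proof.
have := @fp_rep_eq R A int PZ H (pi \o (J g \o J f)) (pi \o J (g \o f)).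
move=> /(_ _ _ _)/(congr1 (fun r => r x)); apply.
- by apply: star_rep_comp pi_rep _; apply: star_hom_comp; exact: fp_endo_hom.
- by apply: star_rep_comp pi_rep _; exact: fp_endo_hom.
- by move=> j a /=; rewrite !fp_endo_in.
Qed.

Lemma pi_endo_id x : pi (J id x) = pi x.
Proof.
have := @fp_rep_eq R A int PZ H (pi \o J id) pi.
move=> /(_ _ _ _)/(congr1 (fun r => r x)); apply => //.
- by apply: star_rep_comp pi_rep _; exact: fp_endo_hom.
- by move=> j a /=; rewrite !fp_endo_in.
Qed.

Lemma pi_incl_endo g f : (forall n : nat, g n%:Z = (f n)%:Z) ->
  forall a, pi (J g (incl a)) = pi (incl (fp_endo f a)).
Proof.
move=> gf a.
have := @fp_rep_eq R A nat PN H (pi \o (J g \o incl)) (pi \o (incl \o fp_endo f)).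
move=> /(_ _ _ _)/(congr1 (fun r => r a)); apply.
- apply: star_rep_comp pi_rep _; apply: star_hom_comp; first exact: fp_endo_hom.
  exact: fp_incl_hom.
- apply: star_rep_comp pi_rep _; apply: star_hom_comp; first exact: fp_incl_hom.
  exact: fp_endo_hom.
- by move=> j b /=; rewrite fp_endo_in !fp_incl_in fp_endo_in gf.
Qed.

Definition state_invariant (g : int -> int) := forall x, phiZ (J g x) = phiZ x.

Lemma state_invariant_comp g f :
  state_invariant g -> state_invariant f -> state_invariant (g \o f).
Proof. by move=> gi fi x; rewrite phiZE -pi_endo_comp -phiZE gi fi. Qed.

Lemma state_invariant_id : state_invariant id.
Proof. by move=> x; rewrite !phiZE pi_endo_id. Qed.

Lemma shift_byD k l : shift_by k \o shift_by l = shift_by (k + l).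
Proof. by apply/funext => j; rewrite /shift_by /= -addrA [l + k]addrC. Qed.

Lemma shift_by0 : shift_by 0 = id.
Proof. by apply/funext => j; rewrite /shift_by addr0. Qed.

Lemma state_invariant_shift k : state_invariant (shift_by k).
Proof.
have i1 : state_invariant (shift_by 1).
  by move=> x; have [_ /(congr1 (fun f => f x)) h _] := phiZ_ext.
have iN1 : state_invariant (shift_by (-1)).
  move=> x; rewrite -[LHS]i1 phiZE pi_endo_comp shift_byD addrN shift_by0.
  by rewrite pi_endo_id -phiZE.
case: k => n.
  elim: n => [|n IH]; first by rewrite shift_by0; exact: state_invariant_id.
  by rewrite -addn1 PoszD addrC -shift_byD; exact: state_invariant_comp.
elim: n => [|n IH]; first exact: iN1.
by rewrite !NegzE in IH *; rewrite -addn1 PoszD opprD addrC -shift_byD;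
  exact: state_invariant_comp.
Qed.

(** Spreadability and exchangeability both reduce to this property, because the
    maps that they involve are stable under delay. *)
Definition locally_invariant (f : nat -> nat) :=
  forall k, phi \o fp_endo (delay k f) = phi.

(** Shifted far enough to the right, a word in the generators involves
    nonnegative indices only, and extend_by_id f acts on it like delay k f,
    which preserves phi. Words are dense and states are continuous. *)
Lemma state_invariant_extend f : locally_invariant f -> state_invariant (extend_by_id f).
Proof.
move=> fi x.
pose Q : set PZ := [set x | exists k0 : nat, forall k : nat, (k0 <= k)%N ->
  exists y : PN, pi (J (shift_by k%:Z) x) = pi (incl y) /\
    pi (J (shift_by k%:Z) (J (extend_by_id f) x)) = pi (incl (fp_endo (delay k f) y))].
have [hL hM h1 hS] := fp_incl_hom PN PZ.
have homJ g : star_hom (J g) by exact: fp_endo_hom.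
have Qsub : star_subalgebra Q.
  split.
  - exists 0%N => k _; exists cone.
    have [_ _ J1 _] := homJ (shift_by k%:Z).
    have [_ _ Je1 _] := homJ (extend_by_id f).
    have [_ _ Jd1 _] := @fp_endo_hom R A nat PN (delay k f).
    by rewrite Je1 J1 Jd1 h1.
  - move=> c a b [m am] [n bn]; exists (maxn m n) => k; rewrite geq_max => /andP[mk nk].
    have [y [y1 y2]] := am k mk; have [z [z1 z2]] := bn k nk.
    exists (c *: y + z).
    have [JL _ _ _] := homJ (shift_by k%:Z).
    have [JeL _ _ _] := homJ (extend_by_id f).
    have [JdL _ _ _] := @fp_endo_hom R A nat PN (delay k f).
    by rewrite JeL !JL JdL !hL !pi_lin y1 y2 z1 z2.
  - move=> a b [m am] [n bn]; exists (maxn m n) => k; rewrite geq_max => /andP[mk nk].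
    have [y [y1 y2]] := am k mk; have [z [z1 z2]] := bn k nk.
    exists (cmul y z).
    have [_ JM _ _] := homJ (shift_by k%:Z).
    have [_ JeM _ _] := homJ (extend_by_id f).
    have [_ JdM _ _] := @fp_endo_hom R A nat PN (delay k f).
    by rewrite JeM !JM JdM !hM !piM y1 y2 z1 z2.
  - move=> a [m am]; exists m => k mk; have [y [y1 y2]] := am k mk.
    exists (star y).
    have [_ _ _ JS] := homJ (shift_by k%:Z).
    have [_ _ _ JeS] := homJ (extend_by_id f).
    have [_ _ _ JdS] := @fp_endo_hom R A nat PN (delay k f).
    by rewrite JeS !JS JdS !hS (pi_star_eq y1) (pi_star_eq y2).
have Qin j a : Q (fp_in PZ j a).
  exists `|j|%N => k jk; exists (fp_in PN (absz (j + k%:Z)) a).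
  rewrite !fp_endo_in !fp_incl_in /shift_by; case: j jk => n /= nk.
    by rewrite /delay ltnNge leq_addl/= addnK.
  have nk' : (n < k)%N by exact: nk.
  have -> : Negz n + k%:Z = (k - n.+1)%N%:Z.
    by rewrite NegzE -subzn// addrC.
  by rewrite /delay /= ltn_subrL (leq_ltn_trans (leq0n _) nk').
have QT := fp_dense Qsub Qin.
have Qinv y : Q y -> phiZ (J (extend_by_id f) y) = phiZ y.
  move=> [k /(_ k (leqnn k))[z [z1 z2]]].
  rewrite -(state_invariant_shift k%:Z) phiZE z2 -phiZE.
  rewrite -[RHS](state_invariant_shift k%:Z) [RHS]phiZE z1 -[RHS]phiZE.
  have [_ _ pN] := phiZ_ext.
  have pNE a : phiZ (incl a) = phi a by rewrite -pN.
  by rewrite !pNE -[in RHS](fi k).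
apply/eqP; rewrite -subr_eq0; apply/eqP/(@nrm0_eq0 _ R[i]^o)/eqP.
rewrite eq_le nrm_ge0 andbT; apply/ler_addgt0Pl => e e0; rewrite addr0.
have c0 : 0 < 4 * nrm xi ^+ 2 + 1 by rewrite ltr_wpDl// mulr_ge0 ?sqr_ge0.
have : closure Q x by rewrite QT.
move=> /closure_nrmP/(_ (e / (4 * nrm xi ^+ 2 + 1))) [|y Qy]; first by rewrite divr_gt0.
rewrite ltr_pdivlMr// => h; apply: le_trans (ltW h).
have [JeL _ _ _] := homJ (extend_by_id f).
have -> : phiZ (J (extend_by_id f) x) - phiZ x =
    phiZ (J (extend_by_id f) (x - y)) - phiZ (x - y).
  rewrite (linB JeL) !phiZE !(linB pi_lin) !innerBl -!phiZE (Qinv _ Qy).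
  by rewrite opprB addrA subrK.
apply: le_trans (nrmB _ _) _; rewrite !phiZE.
have rep2 : star_representation (pi \o J (extend_by_id f)) by exact: star_rep_comp.
have b1 := rep_bound (x - y) xi pi_rep.
have b2 := rep_bound (x - y) xi rep2.
have b3 := inner_cauchy_schwarz (pi (x - y) xi) xi.
have b4 := inner_cauchy_schwarz (pi (J (extend_by_id f) (x - y)) xi) xi.
have n0 := nrm_ge0 xi; have n1 := nrm_ge0 (x - y).
have b5 := le_trans b3 (ler_wpM2r n0 b1).
have b6 := le_trans b4 (ler_wpM2r n0 b2).
apply: le_trans (lerD b6 b5) _; rewrite expr2.
by clear QT; move: (nrm (x - y)) (nrm xi) n0 n1 => p q p0 q0; nra.
Qed.

(** On the dense set of the vectors pi(a) xi, the isometry maps pi(a) xi to pi(J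
    g a) xi. For other g any V will do, so that V can be chosen as a function of
    g. *)
Lemma invariant_isometry g : exists V : H -> H, state_invariant g ->
  [/\ linear V, forall x, nrm (V x) = nrm x, V xi = xi &
      forall x, V \o pi x = pi (J g x) \o V].
Proof.
have [gi|] := pselect (state_invariant g); last by exists id.
have [gL gM g1 gS] := @fp_endo_hom R A int PZ g.
have [_ dense _] := gns.
have [] := @isometry_extension R PZ H (fun a => pi a xi) (fun a => pi (J g a) xi).
- by move=> c a b; rewrite pi_lin.
- by move=> c a b; rewrite gL pi_lin.
- exact: dense.
- move=> a; apply/eqP; rewrite -(@eqrXn2 _ 2) ?nrm_ge0//.
  apply/eqP/complexI; rewrite -!inner_nrm.
  have E b : inner (pi b xi) (pi b xi) = phiZ (cmul (star b) b).
    by rewrite phiZE piM /= pi_star.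
  by rewrite !E -gS -gM gi.
move=> V [VL Vn VE]; exists V => _.
have V1 : V xi = xi.
  by have := VE cone; rewrite g1 pi1.
split=> // x; apply: (bounded_dense_eq _ _ dense).
- by apply: bounded_op_comp => //; exact: isometry_bounded.
- by apply: bounded_op_comp => //; exact: isometry_bounded.
- move=> _ [a _ <-] /=; rewrite VE.
  by rewrite -[LHS]/(V ((pi x \o pi a) xi)) -piM VE gM piM.
Qed.

Definition implement g : H -> H := projT1 (cid (invariant_isometry g)).

Lemma implementP g : state_invariant g ->
  [/\ linear (implement g), forall x, nrm (implement g x) = nrm x,
      implement g xi = xi &
      forall x, implement g \o pi x = pi (J g x) \o implement g].
Proof. by move=> gi; rewrite /implement; case: cid => V /= /(_ gi). Qed.

Lemma implement_bounded g : state_invariant g -> bounded_op (implement g).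
Proof. by move=> /implementP[VL Vn _ _]; exact: isometry_bounded. Qed.

Lemma implement_cyclic g a : state_invariant g -> implement g (pi a xi) = pi (J g a) xi.
Proof.
move=> /implementP[_ _ V1 VE]; have := congr1 (fun f => f xi) (VE a).
by rewrite /= V1.
Qed.

Lemma implement_comp g f : state_invariant g -> state_invariant f ->
  implement g \o implement f = implement (g \o f).
Proof.
move=> gi fi; have gfi := state_invariant_comp gi fi; have [_ dense _] := gns.
apply: (bounded_dense_eq _ _ dense).
- by apply: bounded_op_comp; exact: implement_bounded.
- exact: implement_bounded.
- by move=> _ [a _ <-] /=; rewrite !implement_cyclic// pi_endo_comp.
Qed.

Lemma implement_id : implement id = id.
Proof.
have [_ dense _] := gns; apply: (bounded_dense_eq _ _ dense).
- exact: implement_bounded state_invariant_id.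
- by split=> // x; exact: cvg_id.
- by move=> _ [a _ <-]; rewrite (implement_cyclic _ state_invariant_id) pi_endo_id.
Qed.

Local Notation U := (fun n : nat => implement (shift_by n%:Z)).
Local Notation D := (fun n : nat => implement (shift_by (- n%:Z))).
Local Notation V := (fun f : nat -> nat => implement (extend_by_id f)).

Let UL n : linear (U n). Proof. by have [] := implementP (state_invariant_shift n%:Z). Qed.
Let DL n : linear (D n). Proof. by have [] := implementP (state_invariant_shift (- n%:Z)). Qed.
Let Un n x : nrm (U n x) = nrm x.
Proof. by have [_ ->] := implementP (state_invariant_shift n%:Z). Qed.
Let Dn n x : nrm (D n x) = nrm x.
Proof. by have [_ ->] := implementP (state_invariant_shift (- n%:Z)). Qed.
Let Ub n : bounded_op (U n). Proof. exact/implement_bounded/state_invariant_shift. Qed.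
Let Db n : bounded_op (D n). Proof. exact/implement_bounded/state_invariant_shift. Qed.

Let UD n x : U n (D n x) = x.
Proof.
rewrite -[LHS]/((U n \o D n) x) implement_comp; try exact: state_invariant_shift.
by rewrite shift_byD subrr shift_by0 implement_id.
Qed.

Let DU n x : D n (U n x) = x.
Proof.
rewrite -[LHS]/((D n \o U n) x) implement_comp; try exact: state_invariant_shift.
by rewrite shift_byD addNr shift_by0 implement_id.
Qed.

Let DD m n x : D m (D n x) = D (m + n)%N x.
Proof.
rewrite -[LHS]/((D m \o D n) x) implement_comp; try exact: state_invariant_shift.
by rewrite shift_byD -opprD PoszD.
Qed.

Let U_adj n x y : inner (U n x) y = inner x (D n y).
Proof. by rewrite -[in LHS](UD n y) (isometry_inner (UL n) (Un n)). Qed.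

Let U_pi n a x : U n (pi a x) = pi (J (shift_by n%:Z) a) (U n x).
Proof.
have [_ _ _ h] := implementP (state_invariant_shift n%:Z).
exact: (congr1 (fun f => f x) (h a)).
Qed.

Let D_pi n a x : D n (pi a x) = pi (J (shift_by (- n%:Z)) a) (D n x).
Proof.
have [_ _ _ h] := implementP (state_invariant_shift (- n%:Z)).
exact: (congr1 (fun f => f x) (h a)).
Qed.

Definition conj_shift n (T : H -> H) : H -> H := U n \o T \o D n.

(** Typical elements are pi(b) xi, with b built from the indices below m:
    shifted back by m or more, b involves negative indices only, which
    extend_by_id does not move. *)
Definition past m : set H := [set x | forall n, (m <= n)%N ->
  forall f, locally_invariant f -> V f (D n x) = D n x].

Lemma past_submodule m : submodule (past m).
Proof.
split=> [n mn f fi|c x y xP yP n mn f fi].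
  have [VL _ _ _] := implementP (state_invariant_extend fi).
  by rewrite (lin0 (DL n)) (lin0 VL).
have [VL _ _ _] := implementP (state_invariant_extend fi).
by rewrite DL VL xP// yP.
Qed.

Lemma past_le m n : (m <= n)%N -> past m `<=` past n.
Proof. by move=> mn x xP k nk; apply: xP; exact: leq_trans nk. Qed.

Lemma past_cyclic : past 0 xi.
Proof.
move=> n _ f fi.
have [_ _ V1 _] := implementP (state_invariant_extend fi).
have [_ _ D1 _] := implementP (state_invariant_shift (- n%:Z)).
by rewrite D1 V1.
Qed.

(** For b in the dense subalgebra of words in the generators, pi(b) xi belongs
    to some past. *)
Lemma past_dense : closure (\bigcup_m past m) = setT.
Proof.
pose B : set PZ := [set x | exists m0 : nat, forall m : nat, (m0 <= m)%N -> forall f,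
  pi (J (extend_by_id f) (J (shift_by (- m%:Z)) x)) = pi (J (shift_by (- m%:Z)) x)].
have homJ g : star_hom (J g) by exact: fp_endo_hom.
have Bsub : star_subalgebra B.
  split.
  - exists 0%N => m _ f; have [_ _ J1 _] := homJ (shift_by (- m%:Z)).
    by have [_ _ Je1 _] := homJ (extend_by_id f); rewrite J1 Je1.
  - move=> c a b [m am] [n bn]; exists (maxn m n) => k; rewrite geq_max => /andP[mk nk] f.
    have [JL _ _ _] := homJ (shift_by (- k%:Z)).
    have [JeL _ _ _] := homJ (extend_by_id f).
    by rewrite JL JeL !pi_lin am// bn.
  - move=> a b [m am] [n bn]; exists (maxn m n) => k; rewrite geq_max => /andP[mk nk] f.
    have [_ JM _ _] := homJ (shift_by (- k%:Z)).
    have [_ JeM _ _] := homJ (extend_by_id f).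
    by rewrite JM JeM !piM am// bn.
  - move=> a [m am]; exists m => k mk f.
    have [_ _ _ JS] := homJ (shift_by (- k%:Z)).
    have [_ _ _ JeS] := homJ (extend_by_id f).
    by rewrite JS JeS; apply: pi_star_eq; exact: am.
have Bin j a : B (fp_in PZ j a).
  exists (absz j).+1 => m jm f; rewrite !fp_endo_in /shift_by.
  by rewrite extend_by_id_neg// subr_lt0 (le_lt_trans (lez_abs j))// ltz_nat.
have BT := fp_dense Bsub Bin.
have [_ dense _] := gns.
apply/seteqP; split=> // y _; apply/closure_nrmP => e e0.
have : closure (range (fun a => pi a xi)) y by rewrite dense.
move=> /closure_nrmP/(_ (e / 2)) [|_ [a _ <-] ya]; first by rewrite divr_gt0.
have c0 : 0 < 2 * nrm xi + 1 by rewrite ltr_wpDl// mulr_ge0 ?nrm_ge0.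
have : closure B a by rewrite BT.
move=> /closure_nrmP/(_ (e / 2 / (2 * nrm xi + 1))) [|b [m Bb] ab].
  by rewrite !divr_gt0.
exists (pi b xi).
  exists m => // n mn f fi.
  rewrite !implement_cyclic; [|exact: state_invariant_extend|exact: state_invariant_shift].
  by rewrite Bb.
apply: le_lt_trans (nrm_triangle (pi a xi) _ _) _.
rewrite [e]splitr; apply: ltrD => //.
have -> : pi a xi - pi b xi = pi (a - b) xi by rewrite (linB pi_lin).
apply: le_lt_trans (rep_bound (a - b) xi pi_rep) _.
move: ab; rewrite ltr_pdivlMr//; apply: le_lt_trans.
by rewrite mulrDr mulr1 mulrAC [_ * (2 * _)]mulrC mulrAC lerDl nrm_ge0.
Qed.

(** * The expectation onto the tail algebra *)

Local Notation RA := (range (pi \o incl)).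
Local Notation M := (vN_right PN pi).
Local Notation N := (vN_tail pi).
Local Notation gens n :=
  (\bigcup_(k in [set k : nat | (n <= k)%N]) range (pi \o fp_in PZ k%:Z)).

Let homI : star_hom incl. Proof. exact: fp_incl_hom. Qed.

Lemma right_star_algebra : star_algebra_of_operators RA.
Proof.
have [hL hM h1 hS] := homI; split.
- by move=> _ [a _ <-] /=.
- by exists cone => //=; rewrite h1 pi1.
- by move=> c _ _ [a _ <-] [b _ <-]; exists (c *: a + b) => //=; rewrite hL pi_lin.
- by move=> _ _ [a _ <-] [b _ <-]; exists (cmul a b) => //=; rewrite hM piM.
- move=> _ [a _ <-]; exists (pi (incl (star a))); first by exists (star a).
  by move=> x y /=; rewrite hS -{1}[incl a]starK pi_star.
Qed.

Let M_bounded T : M T -> bounded_op T. Proof. exact: commutant_bounded. Qed.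

Let commutant_linear (X : set (H -> H)) T : commutant X T -> linear T.
Proof. by move=> [[]]. Qed.

Let M_lin c S T : M S -> M T -> M (c *: S + T).
Proof. by apply: commutant_lin => Q; exact: commutant_linear. Qed.

Let M_comp S T : M S -> M T -> M (S \o T).
Proof. exact: commutant_comp. Qed.

Let M_pi a : M (pi (incl a)).
Proof.
by apply: bicommutant_sub; [move=> _ [b _ <-]; exact: pi_bounded|exists a].
Qed.

Lemma tail_sub_right : N `<=` M.
Proof.
move=> T /(_ 0%N I); apply: commutantS; apply: commutantS => _ [k _ [a _ <-]].
by exists (fp_in PN k a) => //=; rewrite fp_incl_in.
Qed.

Let locally_invariant_succ : locally_invariant succn.
Proof.
by move=> k; apply: phi_spreadable; exact/cofinite_increasing_delay/cofinite_increasing_succ.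
Qed.

Let VP f (fi : locally_invariant f) := implementP (state_invariant_extend fi).

Lemma extend_intertwines f a x : locally_invariant f ->
  V f (pi (incl a) x) = pi (incl (fp_endo f a)) (V f x).
Proof.
move=> fi; have [_ _ _ h] := VP fi.
by have := congr1 (fun F => F x) (h (incl a)); rewrite /= (@pi_incl_endo _ f).
Qed.

(** The isometry of the successor opens a gap at index 0, and the shift back
    closes it: the product acts as the identity on the nonnegative indices. *)
Definition gap : H -> H := D 1%N \o V succn.

Lemma gap_commutes : commutant RA gap.
Proof.
split; first by apply: bounded_op_comp; [exact: Db|exact: implement_bounded (state_invariant_extend locally_invariant_succ)].
move=> _ [a _ <-]; apply/funext => x.
have succ_shift n : shift_by 1 n%:Z = n.+1%:Z by rewrite /shift_by -PoszD addn1.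
rewrite /gap /= (extend_intertwines _ _ locally_invariant_succ).
by rewrite -(pi_incl_endo succ_shift) -[in LHS](UD 1 (V succn x)) -U_pi !DU.
Qed.

(** The vectors x and y are fixed by the isometry of the successor, so that D 1
    acts on them like gap, which can be moved through T and then cancelled. *)
Lemma gap_step T x y : T \o gap = gap \o T -> V succn x = x -> V succn y = y ->
  inner (T (D 1%N x)) (D 1%N y) = inner (T x) y.
Proof.
move=> TW Vx Vy; have [VL Vn _ _] := VP locally_invariant_succ.
have -> : D 1%N x = gap x by rewrite /gap /= Vx.
have -> : T (gap x) = gap (T x) by exact: (congr1 (fun F => F x) TW).
rewrite /gap /= (isometry_inner (DL 1%N) (Dn 1%N)) -[in LHS]Vy.
exact: isometry_inner.
Qed.

(** The matrix coefficients of the shifted copies of T are eventually constant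
    between past vectors: this is what makes the limit exist for all T in the
    von Neumann algebra, and not only for elements pi(a). *)
Lemma conj_shift_past T m n x y : M T -> past m x -> past m y -> (m <= n)%N ->
  inner (conj_shift n T x) y = inner (T (D m x)) (D m y).
Proof.
move=> [_ TM] xP yP mn; rewrite /conj_shift /= U_adj.
have TW : T \o gap = gap \o T by apply: TM; exact: gap_commutes.
rewrite -(subnK mn); elim: (n - m)%N => // d IH.
rewrite addSn -add1n -(DD 1 _ x) -(DD 1 _ y) -[RHS]IH; apply: gap_step TW _ _.
  by apply: xP locally_invariant_succ; rewrite leq_addl.
by apply: yP locally_invariant_succ; rewrite leq_addl.
Qed.

(** The default value is only taken outside the von Neumann algebra of the
    nonnegative indices. *)
Definition tail_expectation (T : H -> H) : H -> H :=
  xget (fun=> 0) [set L | bounded_op L /\ wot_cvg (fun n => conj_shift n T) L].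
Local Notation E := tail_expectation.

Let conj_bound n T C : (forall x, nrm (T x) <= C * nrm x) ->
  forall x, nrm (conj_shift n T x) <= C * nrm x.
Proof. by move=> TC x; rewrite /conj_shift /= Un -[nrm x in leRHS](Dn n). Qed.

Let conj_bounded n T : bounded_op T -> bounded_op (conj_shift n T).
Proof. by move=> Tb; apply: bounded_op_comp => //; exact: bounded_op_comp. Qed.

Let tail_expectation_ex T C : M T -> 0 <= C -> (forall x, nrm (T x) <= C * nrm x) ->
  exists L, [/\ bounded_op L, forall x, nrm (L x) <= C * nrm x &
    wot_cvg (fun n => conj_shift n T) L].
Proof.
move=> MT C0 TC; have Tb := M_bounded MT.
have [|||L [LL LC LT]] := @wot_limit R H (fun n => conj_shift n T) C _ C0 _ _ past_dense.
- by move=> n; have [] := conj_bounded n Tb.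
- by move=> n; exact: conj_bound.
- move=> x y [m _ xP] [n _ yP]; pose k := maxn m n.
  have {}xP : past k x by exact: past_le (leq_maxl _ _) _ xP.
  have {}yP : past k y by exact: past_le (leq_maxr _ _) _ yP.
  exists (inner (T (D k x)) (D k y)); apply/nrm_cvgP => e e0; exists k => l kl.
  by rewrite (conj_shift_past MT xP yP kl) subrr nrm0.
by exists L; split=> //; apply/bounded_opP; split=> //; exists C.
Qed.

Lemma tail_expectation_spec T : M T ->
  bounded_op (E T) /\ wot_cvg (fun n => conj_shift n T) (E T).
Proof.
move=> MT; have [_ [C C0 TC]] := (iffLR (bounded_opP T) (M_bounded MT)).
have [L [Lb _ LT]] := tail_expectation_ex MT C0 TC.
exact: (@xgetPex _ (fun=> 0)
  [set L | bounded_op L /\ wot_cvg (fun n => conj_shift n T) L] (ex_intro _ L (conj Lb LT))).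
Qed.

Let E_bounded T : M T -> bounded_op (E T).
Proof. by move=> /tail_expectation_spec[]. Qed.

Let E_wot T : M T -> wot_cvg (fun n => conj_shift n T) (E T).
Proof. by move=> /tail_expectation_spec[]. Qed.

Let E_unique T L : M T -> wot_cvg (fun n => conj_shift n T) L -> E T = L.
Proof. by move=> MT; apply: wot_cvg_unique; exact: E_wot. Qed.

Lemma tail_expectation_bound T C : M T -> 0 <= C ->
  (forall x, nrm (T x) <= C * nrm x) -> forall x, nrm (E T x) <= C * nrm x.
Proof.
move=> MT C0 TC; have [L [_ LC LT]] := tail_expectation_ex MT C0 TC.
by rewrite (E_unique MT LT).
Qed.

(** This formula determines the expectation, and gives its normality and its
    invariances. *)
Lemma tail_expectation_past T m x y : M T -> past m x -> past m y ->
  inner (E T x) y = inner (T (D m x)) (D m y).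
Proof.
move=> MT xP yP; have h1 := @E_wot T MT x y.
have h2 : (fun n => inner (conj_shift n T x) y : R[i]^o) @ \oo -->
    (inner (T (D m x)) (D m y) : R[i]^o).
  apply/nrm_cvgP => e e0; exists m => n mn.
  by rewrite (conj_shift_past MT xP yP mn) subrr nrm0.
exact: nrm_cvg_unique h1 h2.
Qed.

(** On past vectors, the isometry V f fixes both arguments of the matrix
    coefficient and moves a to its image under f. *)
Lemma tail_expectation_invariant f a : locally_invariant f ->
  E (pi (incl (fp_endo f a))) = E (pi (incl a)).
Proof.
move=> fi; have [VL Vn _ _] := VP fi.
apply: (weak_dense_eq (E_bounded (M_pi _)) (E_bounded (M_pi _)) past_dense).
move=> x y [m _ xP] [n _ yP]; pose k := maxn m n.
have {}xP : past k x by exact: past_le (leq_maxl _ _) _ xP.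
have {}yP : past k y by exact: past_le (leq_maxr _ _) _ yP.
rewrite !(tail_expectation_past (M_pi _) xP yP).
rewrite -{1}(xP k (leqnn k) f fi) -{1}(yP k (leqnn k) f fi).
by rewrite -(extend_intertwines _ _ fi) (isometry_inner VL Vn).
Qed.

Lemma tail_expectation_state T : M T -> inner (E T xi) xi = inner (T xi) xi.
Proof.
move=> MT; rewrite (tail_expectation_past MT past_cyclic past_cyclic).
by have [_ _ -> _] := implementP (state_invariant_shift (- 0%:Z)).
Qed.

(** Shifted by m, the operator T lies in the von Neumann algebra of the indices
    >= m. *)
Let conj_shift_commute n m T S : M T -> (n <= m)%N -> commutant (gens n) S ->
  conj_shift m T \o S = S \o conj_shift m T.
Proof.
move=> [_ TM] nm [Sb SC]; have [hL hM h1 hS] := homI.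
pose S' := D m \o S \o U m.
have rep : star_representation (pi \o (J (shift_by m%:Z) \o incl)).
  by apply: star_rep_comp pi_rep _; apply: star_hom_comp homI; exact: fp_endo_hom.
have S'C : commutant RA S'.
  split; first by apply: bounded_op_comp => //; exact: bounded_op_comp.
  move=> _ [a _ <-]; apply/funext => x; rewrite /S' /=.
  have h := fp_commute rep Sb _ a.
  have {}h : pi (J (shift_by m%:Z) (incl a)) \o S = S \o pi (J (shift_by m%:Z) (incl a)).
    apply: h => j b; rewrite /= fp_incl_in fp_endo_in /shift_by -PoszD.
    by rewrite SC//; exists (j + m)%N; [rewrite /= (leq_trans nm)// leq_addl|exists b].
  rewrite U_pi -[S (pi _ _)]/((S \o pi _) _) -h /=.
  by rewrite -[in LHS](UD m (S _)) -U_pi DU.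
have := TM _ S'C; move=> TS'; apply/funext => x; rewrite /conj_shift /=.
have := congr1 (fun F => F (D m x)) TS'; rewrite /S' /= UD => ->.
by rewrite UD.
Qed.

(** The commutation relations of conj_shift_commute pass to weak limits. *)
Lemma tail_expectation_range T : M T -> N (E T).
Proof.
move=> MT n _; split=> [|S SC]; first exact: E_bounded.
have Sb := commutant_bounded SC.
have SE := wot_cvg_compl Sb (@E_wot T MT).
have ES : wot_cvg (fun m => conj_shift m T \o S) (E T \o S).
  by move=> x y; exact: (@E_wot T MT (S x) y).
apply/funext => x; apply: inner_eqP => y; rewrite -[LHS]/(inner ((E T \o S) x) y).
apply: (@nrm_cvg_unique R R[i]^o _ _ _ (ES x y)).
apply/nrm_cvgP => e e0; have [K KP] := (iffLR (nrm_cvgP _ _) (SE x y)) _ e0.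
exists (maxn K n) => m; rewrite geq_max => /andP[Km nm].
by rewrite (conj_shift_commute MT nm SC); exact: KP.
Qed.

(** An element of the tail commutes with gap and with all its translates, since
    the translate by n commutes with the indices >= n. By gap_step, T and its
    conjugate by the shift have the same matrix coefficients on every past, and
    these exhaust a dense subspace. *)
Lemma tail_shift_invariant T : N T -> forall n, conj_shift n T = T.
Proof.
move=> NT; have Tb : bounded_op T by have /M_bounded := tail_sub_right NT.
have gapn n : commutant (gens n) (U n \o gap \o D n).
  have [gb gC] := gap_commutes.
  split; first by apply: bounded_op_comp => //; exact: bounded_op_comp.
  move=> _ [k /= nk [a _ <-]]; apply/funext => x /=.
  have kE : (k - n)%N%:Z = shift_by (- n%:Z) k%:Z by rewrite /shift_by subzn.
  have h : pi (fp_in PZ (k - n)%N%:Z a) \o gap = gap \o pi (fp_in PZ (k - n)%N%:Z a).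
    rewrite gC//; by exists (fp_in PN (k - n)%N a) => //=; rewrite fp_incl_in.
  rewrite D_pi fp_endo_in -kE.
  rewrite -[gap (pi _ _)]/((gap \o pi _) _) -h /= U_pi fp_endo_in.
  by rewrite kE /shift_by subrK.
have step n x y : past n x -> past n y ->
    inner (T (D 1%N x)) (D 1%N y) = inner (T x) y.
  move=> xP yP; have [_ TC] := NT n I.
  have TW := TC _ (gapn n).
  pose T' := D n \o T \o U n.
  have TW' : T' \o gap = gap \o T'.
    apply/funext => z; rewrite /T' /=.
    have := congr1 (fun F => F (U n z)) TW; rewrite /= DU => ->.
    by rewrite !DU.
  have fix_x := xP n (leqnn n) _ locally_invariant_succ.
  have fix_y := yP n (leqnn n) _ locally_invariant_succ.
  have := gap_step TW' fix_x fix_y.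
  rewrite !DD addnC -!DD /T' /= !UD.
  by rewrite !(isometry_inner (DL n) (Dn n)).
have conj1 : conj_shift 1 T = T.
  apply: (weak_dense_eq (conj_bounded 1 Tb) Tb past_dense) => x y [m _ xP] [n _ yP].
  pose k := maxn m n.
  rewrite /conj_shift /= U_adj; apply: (step k).
  - exact: past_le (leq_maxl _ _) _ xP.
  - exact: past_le (leq_maxr _ _) _ yP.
have TD x : T (D 1%N x) = D 1%N (T x).
  by rewrite -{2}conj1 /conj_shift /= DU.
have TDn n x : T (D n x) = D n (T x).
  elim: n x => [|n IH] x.
    by rewrite -[D 0%N]/(implement (shift_by 0)) shift_by0 implement_id.
  by rewrite -add1n -!DD TD IH.
by move=> n; apply/funext => x; rewrite /conj_shift /= TDn UD.
Qed.

Lemma tail_expectation_linear (c : R[i]) S T : M S -> M T ->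
  E (c *: S + T) = c *: E S + E T.
Proof.
move=> MS MT; apply: E_unique; first exact: M_lin.
move=> x y; have hS := @E_wot S MS x y; have hT := @E_wot T MT x y.
have -> : (fun n => inner (conj_shift n (c *: S + T) x) y : R[i]^o) =
    (fun n => c *: (inner (conj_shift n S x) y : R[i]^o) + (inner (conj_shift n T x) y : R[i]^o)).
  apply/funext => n; rewrite /conj_shift /= -[(c *: S + T) _]/(c *: S _ + T _) UL.
  by rewrite innerDl innerZl.
have -> : inner ((c *: E S + E T) x) y = c * inner (E S x) y + inner (E T x) y.
  by rewrite -[(c *: E S + E T) _]/(c *: E S _ + E T _) innerDl innerZl.
by apply: cvgD; [apply: cvgZr; exact: hS|exact: hT].
Qed.

Lemma tail_expectation_fix T : N T -> E T = T.
Proof.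
move=> NT; apply: E_unique; first exact: tail_sub_right.
by move=> x y; rewrite (_ : (fun n => _) = (fun=> inner (T x) y : R[i]^o));
  [exact: cvg_cst|apply/funext => n; rewrite tail_shift_invariant].
Qed.

Lemma tail_expectation_bimodule S T S' : N S -> M T -> N S' ->
  E (S \o T \o S') = S \o E T \o S'.
Proof.
move=> NS MT NS'; have MS := tail_sub_right NS; have MS' := tail_sub_right NS'.
apply: E_unique; first by apply: M_comp => //; exact: M_comp.
have conjE n : conj_shift n (S \o T \o S') = S \o (conj_shift n T \o S').
  have h := tail_shift_invariant NS n; have h' := tail_shift_invariant NS' n.
  by rewrite -{2}h -{2}h'; apply/funext => x; rewrite /conj_shift /= !DU.
have := @wot_cvg_compl R H (fun n => conj_shift n T) (E T) S (M_bounded MS) (@E_wot T MT).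
move=> h x y; rewrite (_ : (fun n => _) =
  (fun n => inner ((S \o conj_shift n T) (S' x)) y : R[i]^o)).
  exact: h.
by apply/funext => n; rewrite conjE.
Qed.

Lemma tail_expectation_contractive T : M T -> opnorm (E T) <= opnorm T.
Proof.
move=> MT; have [_ [C C0 TC]] := (iffLR (bounded_opP T) (M_bounded MT)).
have le (c : R) (v w : H) : (`|v| <= c%:C * `|w|) = (nrm v <= c * nrm w).
  by rewrite !nrmE -rmorphM lecR.
apply: lb_le_inf; first by exists C; split=> // x; rewrite le.
move=> c [c0 cT]; apply: ge_inf; first by exists 0 => d [].
split=> // x; rewrite le; apply: tail_expectation_bound => // z.
by rewrite -le.
Qed.

Let cvg_sum_fin (n : nat) (a : nat -> 'I_n -> R[i]^o) (b : 'I_n -> R[i]^o) :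
  (forall i, (fun k => a k i) @ \oo --> b i) ->
  (fun k => \sum_i a k i) @ \oo --> \sum_i b i.
Proof.
move=> ab.
pose a' k j : R[i]^o := oapp (a k) 0 (insub j).
pose b' j : R[i]^o := oapp b 0 (insub j).
have ab' j : (fun k => a' k j) @ \oo --> b' j.
  by rewrite /a' /b'; case: insubP => [i _ _|_] /=; [exact: ab|exact: cvg_cst].
have aE k : \sum_i a k i = \sum_(0 <= j < n) a' k j.
  by rewrite big_mkord; apply: eq_bigr => i _; rewrite /a' valK.
have bE : \sum_i b i = \sum_(0 <= j < n) b' j.
  by rewrite big_mkord; apply: eq_bigr => i _; rewrite /b' valK.
rewrite bE (_ : (fun k => _) = (fun k => \sum_(0 <= j < n) a' k j)).
  exact: cvg_finite_sum.
by apply/funext => k; exact: aE.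
Qed.

(** The operator matrix of the shifted copies is positive because the shift can
    be moved to the vectors; positivity of matrix coefficients passes to limits. *)
Lemma tail_expectation_cp : completely_positive M E.
Proof.
move=> n T MT Tpos x.
pose a k : R[i]^o := \sum_i \sum_j inner (conj_shift k (T i j) (x j)) (x i).
have a0 k : 0 <= (a k : R[i]).
  have := Tpos (fun j => D k (x j)); congr (0 <= _).
  by apply: eq_bigr => i _; apply: eq_bigr => j _; rewrite /conj_shift /= U_adj.
have al : a @ \oo --> (\sum_i \sum_j inner (E (T i j) (x j)) (x i) : R[i]^o).
  apply: cvg_sum_fin => i; apply: cvg_sum_fin => j.
  exact: (@E_wot (T i j) (MT i j) (x j) (x i)).
exact: cvg_complex_ge0 a0 al.
Qed.

Lemma tail_expectation_normal : normal_map M E.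
Proof.
apply: (@normal_of_dense_compression R H M E past (fun n => D n)).
- exact: M_bounded.
- exact: E_bounded.
- exact: past_submodule.
- by move=> m; exact: past_le.
- exact: past_dense.
- by move=> m x; rewrite Dn.
- by move=> T m x y MT xP yP; exact: tail_expectation_past.
Qed.

Lemma tail_expectation_cexp : normal_conditional_expectation M N E.
Proof.
split.
- exact: tail_expectation_range.
- exact: tail_expectation_linear.
- exact: tail_expectation_fix.
- exact: tail_expectation_bimodule.
- exact: tail_expectation_contractive.
- exact: tail_expectation_cp.
- exact: tail_expectation_normal.
Qed.

Lemma iter_shift_conj n a :
  pi (incl (iter n (@shiftN R A PN) a)) = conj_shift n (pi (incl a)).
Proof.
apply/funext => x; rewrite /conj_shift /= U_pi UD.
have hom : star_hom (iter n (@shiftN R A PN)).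
  elim: n => [|n IH]; first by split.
  by apply: star_hom_comp IH; exact: fp_endo_hom.
have := @fp_rep_eq R A nat PN H (pi \o (incl \o iter n (@shiftN R A PN)))
  (pi \o (J (shift_by n%:Z) \o incl)).
move=> /(_ _ _ _)/(congr1 (fun r => r a x)); apply.
- by apply: star_rep_comp pi_rep _; exact: star_hom_comp.
- by apply: star_rep_comp pi_rep _; apply: star_hom_comp homI; exact: fp_endo_hom.
- move=> j b /=; rewrite fp_incl_in fp_endo_in /shift_by -PoszD addnC.
  have -> : iter n (@shiftN R A PN) (fp_in PN j b) = fp_in PN (n + j)%N b.
    by elim: n {hom} => //= n ->; rewrite /shiftN fp_endo_in addSn.
  by rewrite fp_incl_in.
Qed.

Lemma tail_expectation_limit a :
  wot_cvg (fun n => pi (incl (iter n (@shiftN R A PN) a))) (E (pi (incl a))).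
Proof.
have -> : (fun n => pi (incl (iter n (@shiftN R A PN) a))) =
    (fun n => conj_shift n (pi (incl a))).
  by apply/funext => n; exact: iter_shift_conj.
exact: E_wot.
Qed.

(** An invariant E' takes the same value at pi(a) and at all its shifted copies,
    which converge ultraweakly to E(pi(a)); by normality this value is
    E'(E(pi(a))) = E(pi(a)). So E' and E agree on the algebra pi(PN), which is
    ultraweakly dense, and both are normal. *)
Lemma tail_expectation_unique E' : normal_conditional_expectation M N E' ->
  invariant_under pi (@shiftN R A PN) E' -> forall T, M T -> E' T = E T.
Proof.
move=> [E'N E'L E'fix _ _ _ E'normal] E'inv.
have N_bounded T : N T -> bounded_op T by move=> /tail_sub_right/M_bounded.
have E'R a : E' (pi (incl a)) = E (pi (incl a)).
  have NE := tail_expectation_range (M_pi a).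
  apply: ultraweak_separates; [exact/N_bounded/E'N/M_pi|exact: N_bounded|].
  move=> s t ss ts.
  have [_ [C C0 TC]] := (iffLR (bounded_opP _) (pi_bounded (incl a))).
  have cv := wot_cvg_bounded_ultraweak C0 (fun n => conj_bounded n (pi_bounded (incl a)))
    (E_bounded (M_pi a)) (fun n => conj_bound n TC)
    (tail_expectation_bound (M_pi a) C0 TC) (@E_wot _ (M_pi a)).
  have FM : ((fun n => conj_shift n (pi (incl a))) @ \oo) M.
    by exists 0%N => // n _ /=; rewrite -iter_shift_conj; exact: M_pi.
  have PF : ProperFilter ((fun n => conj_shift n (pi (incl a))) @ \oo).
    exact: fmap_proper_filter.
  have := @E'normal _ PF FM _ (tail_sub_right NE) cv s t ss ts.
  rewrite (E'fix _ NE) => h.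
  have E'c n : ultraweak_functional s t (E' (conj_shift n (pi (incl a)))) =
      ultraweak_functional s t (E' (pi (incl a))).
    congr (ultraweak_functional s t _).
    rewrite -iter_shift_conj; elim: n => //= n IH.
    by rewrite E'inv.
  have c : (fun n => ultraweak_functional s t (E' (conj_shift n (pi (incl a)))))
      @ \oo --> ultraweak_functional s t (E' (pi (incl a))).
    by rewrite (funext E'c); exact: cvg_cst.
  exact: nrm_cvg_unique c h.
move=> T MT.
have [F [FF FA FT]] := bicommutant_ultraweak_limit right_star_algebra MT.
have AM : RA `<=` M by move=> _ [a _ <-]; exact: M_pi.
have FM : F M by exact: filterS FA.
apply: ultraweak_separates; [exact/N_bounded/E'N|exact: E_bounded|].
move=> s t ss ts.
have h1 := @E'normal F FF FM T MT FT s t ss ts.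
have h2 := @tail_expectation_normal F FF FM T MT FT s t ss ts.
have h3 : ultraweak_functional s t @ (E' @ F) --> ultraweak_functional s t (E T).
  move=> B /h2 h; change (F [set S | B (ultraweak_functional s t (E' S))]).
  have {}h : F [set S | B (ultraweak_functional s t (E S))] := h.
  apply: filterS (filterI FA h) => _ [[a _ <-] /=].
  by rewrite E'R.
exact: (@cvg_unique _ (@norm_hausdorff R[i] R[i]^o) _
  (fmap_proper_filter _ (fmap_proper_filter _ FF)) _ _ h1 h3).
Qed.

End Dynamics.

Theorem theorem4p1 (R : realType) (A : cstarType R)
    (PN : free_product A nat) (PZ : free_product A int)
    (phi : PN -> R[i]) (phiZ : PZ -> R[i])
    (H : hilbertType R) (pi : PZ -> H -> H) (xi : H)
    (phi_state : state phi) (phi_spreadable : spreadable phi)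
    (phiZ_ext : shift_extension phi phiZ)
    (gns : gns_triple phiZ pi xi) :
  exists E : (H -> H) -> (H -> H),
    normal_conditional_expectation (vN_right PN pi) (vN_tail pi) E
    /\ invariant_under pi (@shiftN R A PN) E
    /\ (forall E' : (H -> H) -> (H -> H),
          normal_conditional_expectation (vN_right PN pi) (vN_tail pi) E' ->
          invariant_under pi (@shiftN R A PN) E' ->
          forall T, vN_right PN pi T -> E' T = E T)
    /\ (forall T, vN_right PN pi T -> inner (E T xi) xi = inner (T xi) xi)
    /\ (forall a : PN, localized a ->
          wot_cvg (fun n => pi (fp_incl PZ (iter n (@shiftN R A PN) a)))
                  (E (pi (fp_incl PZ a))))
    /\ (forall h : nat -> nat, cofinite_increasing h ->
          invariant_under pi (@fp_endo R A nat PN h) E)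
    /\ (exchangeable phi ->
          forall s : nat -> nat, finite_permutation s ->
          invariant_under pi (@fp_endo R A nat PN s) E).
Proof.
have spread_inv h : cofinite_increasing h -> locally_invariant phi h.
  by move=> hi k; apply: phi_spreadable; exact: cofinite_increasing_delay.
have E_inv f : locally_invariant phi f ->
    invariant_under pi (@fp_endo R A nat PN f) (tail_expectation gns).
  by move=> fi a; exact: (tail_expectation_invariant phi_spreadable phiZ_ext).
exists (tail_expectation gns).
split; first exact: (tail_expectation_cexp phi_spreadable phiZ_ext).
split; first exact/E_inv/spread_inv/cofinite_increasing_succ.
split; first exact: (tail_expectation_unique phi_spreadable phiZ_ext).
split; first exact: (tail_expectation_state phi_spreadable phiZ_ext).
split; first by move=> a _; exact: (tail_expectation_limit phi_spreadable phiZ_ext).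
split; first by move=> h /spread_inv; exact: E_inv.
move=> exch s sP; apply: E_inv => k; apply: exch.
exact: finite_permutation_delay.
Qed.
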